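(* Let $(\phi_t)$ be a parabolic semigroup of zero hyperbolic step in $\mathbb{H}$ with Denjoy--Wolff point $\infty$ and infinitesimal generator $G\colon\mathbb{H}\to\mathbb{H}$. Then $(\phi_t)$ is of extremal rate if and only if $\angle\lim_{z\to\infty}zG(z)\in(-\infty,0)$. Moreover, in that case, for all $z\in\mathbb{H}$, $$\lim_{t\to+\infty}\frac{|\phi_t(z)|}{\sqrt t}=\sqrt{-2\,\angle\lim_{w\to\infty}wG(w)}.$$
   Context: $\mathbb{H}$ is the upper half-plane. A semigroup in $\mathbb{H}$ is a family $(\phi_t)_{t\ge0}$ of holomorphic self-maps of $\mathbb{H}$ with $\phi_0=\mathrm{id}$, $\phi_{t+s}=\phi_t\circ\phi_s$, and $\phi_t\to\mathrm{id}$ pointwise as $t\to0^+$; its infinitesimal generator $G$ satisfies $\partial_t\phi_t(z)=G(\phi_t(z))$. Non-elliptic: no fixed points of $\phi_t$, $t>0$, in $\mathbb{H}$; orbits then converge to a common boundary point (Denjoy--Wolff point). With Denjoy--Wolff point $\infty$, parabolic means $\angle\lim_{z\to\infty}\phi_t(z)/z=1$; zero hyperbolic step means $d_{\mathbb{H}}(\phi_{t+1}(z),\phi_t(z))\to0$ as $t\to+\infty$ ($d_{\mathbb{H}}$ hyperbolic distance). Extremal rate: there is $L\in(0,+\infty)$ with $\lim_{t\to+\infty}|\phi_t(z)|/\sqrt t=L$ for all $z$. The angular limit $\angle\lim_{z\to\infty}f(z)=\ell$ means $f(z)\to\ell$ as $z\to\infty$ within every sector $\{z\in\mathbb{H}:|\arg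 z-\pi/2|<\theta\}$, $\theta\in(0,\pi/2)$. *)

(* Defs.v *)
From Stdlib Require Import Reals.
From Coquelicot Require Import Coquelicot.
Open Scope R_scope.

Definition inH (z : C) : Prop := 0 < Im z.

Definition holo_H (f : C -> C) : Prop :=
  forall z : C, inH z -> @ex_derive C_AbsRing C_NormedModule f z.

Definition hol_selfmap_H (f : C -> C) : Prop :=
  holo_H f /\ forall z, inH z -> inH (f z).

Definition argH (z : C) : R := acos (Re z / Cmod z).

Definition sector (theta : R) (z : C) : Prop :=
  inH z /\ Rabs (argH z - PI / 2) < theta.

Definition ang_lim_infty (f : C -> C) (l : C) : Prop :=
  forall theta : R, 0 < theta < PI / 2 ->
  forall eps : R, 0 < eps ->
  exists M : R, forall z : C, sector theta z -> M < Cmod z ->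
    Cmod (f z - l)%C < eps.

Definition semigroup_H (phi : R -> C -> C) : Prop :=
  (forall t, 0 <= t -> hol_selfmap_H (phi t)) /\
  (forall z, inH z -> phi 0 z = z) /\
  (forall t s z, 0 <= t -> 0 <= s -> inH z -> phi (t + s) z = phi t (phi s z)) /\
  (forall z, inH z -> filterlim (fun t => phi t z) (at_right 0) (locally z)).

Definition generator_of (phi : R -> C -> C) (G : C -> C) : Prop :=
  holo_H G /\
  forall z t, inH z -> 0 < t ->
    is_derive (fun s => Re (phi s z)) t (Re (G (phi t z))) /\
    is_derive (fun s => Im (phi s z)) t (Im (G (phi t z))).

Definition non_elliptic (phi : R -> C -> C) : Prop :=
  forall t z, 0 < t -> inH z -> phi t z <> z.

Definition DW_infty (phi : R -> C -> C) : Prop :=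
  forall z, inH z -> is_lim (fun t => Cmod (phi t z)) p_infty p_infty.

Definition parabolic (phi : R -> C -> C) : Prop :=
  forall t, 0 <= t -> ang_lim_infty (fun z => (phi t z / z)%C) 1.

(* hyperbolic distance in H (curvature -1) *)
Definition dH (z w : C) : R :=
  ln ((Cmod (z - Cconj w)%C + Cmod (z - w)%C) / (Cmod (z - Cconj w)%C - Cmod (z - w)%C)).

Definition zero_hyp_step (phi : R -> C -> C) : Prop :=
  forall z, inH z -> is_lim (fun t => dH (phi (t + 1) z) (phi t z)) p_infty 0.

Definition extremal_rate (phi : R -> C -> C) : Prop :=
  exists L : R, 0 < L /\
    forall z, inH z -> is_lim (fun t => Cmod (phi t z) / sqrt t) p_infty L.

(* Main.v *)
Require Import Defs.
From Stdlib Require Import Reals Lra Psatz ClassicalEpsilon List Ranalysis5.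
From Coquelicot Require Import Coquelicot.
Open Scope R_scope.
Set Bullet Behavior "Strict Subproofs".

(** Let [F = -1/G], a holomorphic self-map of the half-plane.  By the Julia-Wolff-Caratheodory
    theorem [F z / z] has an angular limit [c >= 0] at infinity, so [z G z] tends to [-1/c],
    read as infinity when [c = 0].

    If [l = -1/c] is finite, then [d/dt (phi_t z)^2 = 2 phi_t z G (phi_t z)] is close to [2 l]
    as long as the orbit is far out in a Stolz angle.  An orbit started high on the imaginary
    axis is trapped there, since its square runs to the left; by Schwarz-Pick all orbits
    are then nontangential, hence [(phi_t z)^2 / t] tends to [2 l].

    It remains to exclude [c = 0] when [|phi_t z| / sqrt t] tends to a finite limit [L].  The
    Koenigs function [h], with [h' = 1/G] and [h (phi_t z) = h z + t], is univalent because
    [Im h' < 0].  On the invariant half-plane [Im z > 1] it therefore omits the half-line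
    [h i - s], [s >= 0], so [K = i sqrt (h - h i)] maps it into the upper half-plane, and
    [c = 0] gives [K z = o(|z|)] in Stolz angles.  But [Im K] is of order [sqrt t], that is, of
    order [|z|], along orbits.  So the orbits are tangential, and a minimum principle for
    [Im K] carries the lower bound from the orbit into a Stolz angle, a contradiction. *)

(** * Compactness *)

(** Extremal rate controls only the modulus of an orbit. A priori the orbit may approach infinity
    tangentially, where nothing is known about [z G z], so the converse cannot be read off from the
    derivative of [(phi_t z)^2]. A point where [h] takes the value [h i - s] flows into [i] after
    time [s]; as [Im] increases along orbits, such a point has [Im <= 1], which explains the
    half-plane [Im z > 1]. That [K z = o(|z|)] comes from the angular limit of [K z / z]: a positive
    limit would make [h = h i - K^2] grow quadratically on the imaginary axis, while
    [h' = 1/G = o(|z|)] allows only [o(|z|^2)]. Holomorphy is given as mere pointwise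
    differentiability, so the function theory starts from Goursat's lemma: potentials of closed
    forms yield primitives and, in the coordinate [log (z - p)], the mean value property, hence the
    maximum principle and Schwarz-Pick. *)

Lemma half_pow_small (w d : R) : 0 < d -> exists n : nat, w / 2 ^ n < d.
Proof.
  intros Hd.
  destruct (Rle_lt_dec w 0) as [Hw|Hw].
  - exists 0%nat. simpl. lra.
  - destruct (pow_lt_1_zero (/2)) with (y := d / w) as [N HN].
    + rewrite Rabs_pos_eq; lra.
    + apply Rdiv_lt_0_compat; lra.
    + exists N. specialize (HN N (Nat.le_refl N)).
      rewrite Rabs_pos_eq in HN by (apply pow_le; lra).
      rewrite pow_inv in HN.
      apply (Rmult_lt_compat_r w) in HN; [|lra].
      unfold Rdiv in *. rewrite Rmult_assoc, Rinv_l in HN by lra. lra.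
Qed.

(** Bisection: if [P] fails on a rectangle it fails on one of its quarters, and the nested bad
    quarters shrink to a point that contradicts the local hypothesis. It serves both as Heine-Borel
    and as the subdivision in Goursat's lemma. The rectangle is given by its lower left corner,
    width and height. *)
Lemma quad_ind (P : R -> R -> R -> R -> Prop) (a0 c0 w0 h0 : R) :
  0 <= w0 -> 0 <= h0 ->
  (forall a c w h, 0 <= w -> 0 <= h -> a0 <= a -> a + w <= a0 + w0 ->
     c0 <= c -> c + h <= c0 + h0 ->
     P a c (w / 2) (h / 2) -> P (a + w / 2) c (w / 2) (h / 2) ->
     P a (c + h / 2) (w / 2) (h / 2) ->
     P (a + w / 2) (c + h / 2) (w / 2) (h / 2) -> P a c w h) ->
  (forall x y, a0 <= x <= a0 + w0 -> c0 <= y <= c0 + h0 ->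
     exists d, 0 < d /\ forall a c w h, 0 <= w < d -> 0 <= h < d ->
       a <= x <= a + w -> c <= y <= c + h ->
       a0 <= a -> a + w <= a0 + w0 -> c0 <= c -> c + h <= c0 + h0 ->
       P a c w h) ->
  P a0 c0 w0 h0.
Proof.
  intros Hw0 Hh0 Hsub Hloc.
  apply NNPP; intros HnP.
  (* [q] is the corner of a bad rectangle of generation [n + 1] inside the one of generation [n] at
     [p]; [s] iterates a choice of such corners. *)
  pose (good := fun (n : nat) (p q : R * R) =>
    (fst p <= fst q /\ fst q + w0 / 2 ^ (S n) <= fst p + w0 / 2 ^ n /\
     snd p <= snd q /\ snd q + h0 / 2 ^ (S n) <= snd p + h0 / 2 ^ n /\
     ~ P (fst q) (snd q) (w0 / 2 ^ (S n)) (h0 / 2 ^ (S n)))).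
  pose (s := fix s (n : nat) : R * R :=
    match n with
    | O => (a0, c0)
    | S m => epsilon (inhabits (0, 0)) (good m (s m))
    end).
  assert (Hpos : forall n (w : R), 0 <= w -> 0 <= w / 2 ^ n).
  { intros n w Hw. apply Rdiv_le_0_compat; [lra|apply pow_lt; lra]. }
  assert (Hhalf : forall n (w : R), w / 2 ^ (S n) = w / 2 ^ n / 2).
  { intros n w. simpl. field. apply pow_nonzero; lra. }
  assert (Hs : forall n, ~ P (fst (s n)) (snd (s n)) (w0 / 2 ^ n) (h0 / 2 ^ n) /\
     a0 <= fst (s n) /\ fst (s n) + w0 / 2 ^ n <= a0 + w0 /\
     c0 <= snd (s n) /\ snd (s n) + h0 / 2 ^ n <= c0 + h0 /\
     good n (s n) (s (S n))).
  { induction n as [|n IH].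
    - assert (G : ~ P a0 c0 (w0 / 2 ^ 0) (h0 / 2 ^ 0)).
      { simpl. rewrite !Rdiv_1_r. exact HnP. }
      split; [exact G|]. simpl fst; simpl snd. simpl (_ / 2 ^ 0).
      split; [lra|]. split; [lra|]. split; [lra|]. split; [lra|].
      change (s 1%nat) with (epsilon (inhabits (0, 0)) (good 0%nat (a0, c0))).
      apply (epsilon_spec (inhabits (0, 0)) (good 0%nat (a0, c0))).
      apply NNPP; intros Hno; apply HnP; apply Hsub; try lra;
        apply NNPP; intros HH; apply Hno.
      all: unfold good; simpl; rewrite ?Rmult_1_r, ?Rdiv_1_r.
      1: exists (a0, c0). 2: exists (a0 + w0/2, c0). 3: exists (a0, c0+h0/2).
      4: exists (a0+w0/2, c0+h0/2).
      all: simpl; repeat split; try lra; exact HH.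
    - destruct IH as (IH1 & IH2 & IH3 & IH4 & IH5 & IH6).
      destruct IH6 as (G1 & G2 & G3 & G4 & G5).
      split; [exact G5|]. split; [lra|]. split; [lra|]. split; [lra|]. split; [lra|].
      change (s (S (S n))) with (epsilon (inhabits (0, 0)) (good (S n) (s (S n)))).
      apply (epsilon_spec (inhabits (0, 0)) (good (S n) (s (S n)))).
      set (p := s (S n)) in *.
      pose proof (Hpos (S n) w0 Hw0). pose proof (Hpos (S n) h0 Hh0).
      apply NNPP; intros Hno; apply G5; apply Hsub; try lra;
        apply NNPP; intros HH; apply Hno; unfold good; rewrite !(Hhalf (S n)).
      1: exists p. 2: exists (fst p + w0/2^(S n)/2, snd p).
      3: exists (fst p, snd p +h0/2^(S n)/2).
      4: exists (fst p + w0/2^(S n)/2, snd p+h0/2^(S n)/2).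
      all: cbn [fst snd]; repeat split; try lra; exact HH. }
  assert (Hmono : forall n m, fst (s n) <= fst (s (n + m)%nat) /\
     fst (s (n+m)%nat) + w0 / 2 ^ (n+m) <= fst (s n) + w0 / 2 ^ n /\
     snd (s n) <= snd (s (n + m)%nat) /\
     snd (s (n+m)%nat) + h0 / 2 ^ (n+m) <= snd (s n) + h0 / 2 ^ n).
  { intros n; induction m as [|m IH].
    - rewrite Nat.add_0_r. lra.
    - rewrite Nat.add_succ_r. destruct (Hs (n+m)%nat) as (_&_&_&_&_&(G1&G2&G3&G4&_)). lra. }
  assert (Hcross : forall n m, fst (s m) <= fst (s n) + w0 / 2 ^ n /\
     snd (s m) <= snd (s n) + h0 / 2 ^ n).
  { intros n m. pose proof (Hmono n m) as H1. pose proof (Hmono m n) as H2.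
    rewrite (Nat.add_comm m n) in H2.
    pose proof (Hpos (n+m)%nat w0 Hw0). pose proof (Hpos (n+m)%nat h0 Hh0). lra. }
  destruct (completeness (fun x => exists n, x = fst (s n))) as [x [Hx1 Hx2]].
  { exists (fst (s 0%nat) + w0 / 2 ^ 0). intros y [n ->]. apply Hcross. }
  { exists (fst (s 0%nat)). now exists 0%nat. }
  destruct (completeness (fun x => exists n, x = snd (s n))) as [y [Hy1 Hy2]].
  { exists (snd (s 0%nat) + h0 / 2 ^ 0). intros z [n ->]. apply Hcross. }
  { exists (snd (s 0%nat)). now exists 0%nat. }
  assert (Hin : forall n, fst (s n) <= x <= fst (s n) + w0 / 2 ^ n /\
     snd (s n) <= y <= snd (s n) + h0 / 2 ^ n).
  { intros n. split; split.
    - apply Hx1. now exists n.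
    - apply Hx2. intros z [m ->]. apply Hcross.
    - apply Hy1. now exists n.
    - apply Hy2. intros z [m ->]. apply Hcross. }
  destruct (Hloc x y) as [d [Hd HP]].
  { pose proof (Hin 0%nat) as H. simpl in H. lra. }
  { pose proof (Hin 0%nat) as H. simpl in H. lra. }
  destruct (half_pow_small (w0 + h0) d Hd) as [n Hn].
  assert (Hsum : (w0 + h0) / 2 ^ n = w0 / 2 ^ n + h0 / 2 ^ n)
    by (unfold Rdiv; ring).
  pose proof (Hpos n w0 Hw0). pose proof (Hpos n h0 Hh0).
  destruct (Hs n) as (G & ? & ? & ? & ? & _).
  apply G. pose proof (Hin n). apply HP; lra.
Qed.

(** Local upper bounds are glued over the box by [quad_ind]. If the supremum [M] were not attained,
    the local bounds could all be taken below [M], and so could their maximum. *)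
Lemma usc_max (K : R -> R -> Prop) (f : R -> R -> R) (a c w h x0 y0 : R) :
  (forall x y, K x y -> a <= x <= a + w /\ c <= y <= c + h) ->
  (forall x y, ~ K x y -> exists d, 0 < d /\
     forall x' y', Rabs (x' - x) < d -> Rabs (y' - y) < d -> ~ K x' y') ->
  (forall x y eps, K x y -> 0 < eps -> exists d, 0 < d /\
     forall x' y', Rabs (x' - x) < d -> Rabs (y' - y) < d -> K x' y' ->
       f x' y' < f x y + eps) ->
  K x0 y0 ->
  exists x y, K x y /\ forall x' y', K x' y' -> f x' y' <= f x y.
Proof.
  intros HK Hcl Husc H0.
  assert (Hw : 0 <= w) by (pose proof (HK _ _ H0); lra).
  assert (Hh : 0 <= h) by (pose proof (HK _ _ H0); lra).
  assert (Hsmall : forall x x' aa ww d, 0 <= ww < d -> aa <= x <= aa + ww ->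
      aa <= x' <= aa + ww -> Rabs (x' - x) < d).
  { intros. apply Rabs_def1; lra. }
  (* [Q] is the property that survives the gluing: it is trivial when boundedness is proved, and
     [B < M] when attainment is. *)
  assert (Hbound : forall Q : R -> Prop,
    (forall B1 B2, Q B1 -> Q B2 -> Q (Rmax B1 B2)) -> (exists B, Q B) ->
    (forall x y, K x y -> exists eps, 0 < eps /\ Q (f x y + eps)) ->
    exists B, Q B /\ forall x y, K x y -> f x y <= B).
  { intros Q Qmax [Q0 HQ0] Hpt.
    cut (exists B, Q B /\ forall x y, a <= x <= a + w -> c <= y <= c + h ->
      K x y -> f x y <= B).
    { intros [B [H1 H2]]. exists B. split; [exact H1|]. intros x y Hxy.
      destruct (HK x y Hxy). auto. }
    apply (quad_ind (fun a c w h => exists B, Q B /\ forall x y, a <= x <= a + w ->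
       c <= y <= c + h -> K x y -> f x y <= B) a c w h Hw Hh).
    - intros a' c' w' h' Hw' Hh' _ _ _ _ [B1 [L1 H1]] [B2 [L2 H2]] [B3 [L3 H3]] [B4 [L4 H4]].
      exists (Rmax (Rmax B1 B2) (Rmax B3 B4)). split; [now auto|].
      intros x y Hx Hy Hxy.
      destruct (Rle_lt_dec x (a' + w'/2)); destruct (Rle_lt_dec y (c' + h'/2)).
      + eapply Rle_trans; [apply H1; auto; lra|].
        eapply Rle_trans; [apply Rmax_l|apply Rmax_l].
      + eapply Rle_trans; [apply H3; auto; lra|].
        eapply Rle_trans; [apply Rmax_l|apply Rmax_r].
      + eapply Rle_trans; [apply H2; auto; lra|].
        eapply Rle_trans; [apply Rmax_r|apply Rmax_l].
      + eapply Rle_trans; [apply H4; auto; lra|].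
        eapply Rle_trans; [apply Rmax_r|apply Rmax_r].
    - intros x y _ _. destruct (classic (K x y)) as [Hxy|Hxy].
      + destruct (Hpt x y Hxy) as [e [He HQ]].
        destruct (Husc x y e Hxy He) as [d [Hd H]].
        exists d; split; [exact Hd|]. intros a' c' w' h' Hw' Hh' Hx Hy _ _ _ _.
        exists (f x y + e). split; [exact HQ|].
        intros x' y' Hx' Hy' HK'. left. apply H; eauto.
      + destruct (Hcl x y Hxy) as [d [Hd H]].
        exists d; split; [exact Hd|]. intros a' c' w' h' Hw' Hh' Hx Hy _ _ _ _.
        exists Q0. split; [exact HQ0|].
        intros x' y' Hx' Hy' HK'. exfalso. apply (H x' y'); eauto. }
  destruct (Hbound (fun _ => True)) as [B [_ HB]]; try tauto.
  { now exists 0. }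
  { intros x y _. exists 1. split; [lra|exact I]. }
  destruct (completeness (fun v => exists x y, K x y /\ v = f x y)) as [M [HM1 HM2]].
  { exists B. intros v (x & y & Hxy & ->). now apply HB. }
  { exists (f x0 y0). now exists x0, y0. }
  apply NNPP; intros Hno.
  assert (Hlt : forall x y, K x y -> f x y < M).
  { intros x y Hxy. destruct (Rle_lt_dec M (f x y)) as [HH|HH]; [|exact HH].
    exfalso. apply Hno. exists x, y. split; [exact Hxy|]. intros x' y' HK'.
    apply Rle_trans with M; [|exact HH]. apply HM1. now exists x', y'. }
  destruct (Hbound (fun B => B < M)) as [B' [HB1 HB2]].
  { intros. now apply Rmax_lub_lt. }
  { exists (M - 1). lra. }
  { intros x y Hxy. pose proof (Hlt x y Hxy). exists ((M - f x y) / 2). lra. }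
  assert (M <= B'); [|lra]. apply HM2. intros v (x & y & Hxy & ->). now apply HB2.
Qed.

(** * Potentials of closed forms *)

(** The shared coefficient [b] is the closedness condition for [P dx + Q dy]. Differentiability is
    required at the point only, without continuity of the partial derivatives. *)
Definition closed_form_at (P Q : R -> R -> R) (x y : R) : Prop :=
  exists a b c, differentiable_pt_lim P x y a b /\ differentiable_pt_lim Q x y b c.

(** This keeps the two-legged, axis-parallel paths that define a potential inside [D]. *)
Definition box_convex (D : R -> R -> Prop) : Prop :=
  forall x1 y1 x2 y2 x y, D x1 y1 -> D x2 y2 ->
    Rmin x1 x2 <= x <= Rmax x1 x2 -> Rmin y1 y2 <= y <= Rmax y1 y2 -> D x y.

Definition open_2d (D : R -> R -> Prop) : Prop :=
  forall x y, D x y -> locally_2d D x y.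

(** The integral of [P dx + Q dy] counterclockwise around the rectangle with opposite corners
    [(a, c)] and [(b, d)]. *)
Definition circulation (P Q : R -> R -> R) (a b c d : R) : R :=
  RInt (fun x => P x c) a b + RInt (fun y => Q b y) c d
  - RInt (fun x => P x d) a b - RInt (fun y => Q a y) c d.

Lemma differentiable_pt_lim_continuous (f : R -> R -> R) (x y a b : R) :
  differentiable_pt_lim f x y a b ->
  continuous (fun s => f s y) x /\ continuous (fun s => f x s) y.
Proof.
  intros H. split.
  - apply (ex_derive_continuous (V := R_NormedModule)). exists (a * 1 + b * 0).
    apply is_derive_Reals.
    apply (derivable_pt_lim_comp_2d f (fun s => s) (fun _ => y)); [exact H| |].
    + apply derivable_pt_lim_id.
    + apply derivable_pt_lim_const.
  - apply (ex_derive_continuous (V := R_NormedModule)). exists (a * 0 + b * 1).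
    apply is_derive_Reals.
    apply (derivable_pt_lim_comp_2d f (fun _ => x) (fun s => s)); [exact H| |].
    + apply derivable_pt_lim_const.
    + apply derivable_pt_lim_id.
Qed.

Lemma box_convex_corner (D : R -> R -> Prop) (x1 y1 x2 y2 : R) :
  box_convex D -> D x1 y1 -> D x2 y2 -> D x1 y2.
Proof.
  intros HD H1 H2. apply (HD x1 y1 x2 y2); auto using Rmin_l, Rmin_r, Rmax_l, Rmax_r.
Qed.

Lemma closed_form_ex_RInt (D : R -> R -> Prop) (P Q : R -> R -> R) :
  box_convex D -> (forall x y, D x y -> closed_form_at P Q x y) ->
  (forall y x1 x2, D x1 y -> D x2 y -> ex_RInt (fun x => P x y) x1 x2) /\
  (forall x y1 y2, D x y1 -> D x y2 -> ex_RInt (fun y => Q x y) y1 y2).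
Proof.
  intros HD Hcl. split.
  - intros y x1 x2 D1 D2. apply (ex_RInt_continuous (V := R_CompleteNormedModule)).
    intros z Hz. destruct (Hcl z y) as (l1 & l2 & l3 & E1 & E2).
    + apply (HD x1 y x2 y); auto. rewrite Rmin_left, Rmax_left; lra.
    + exact (proj1 (differentiable_pt_lim_continuous _ _ _ _ _ E1)).
  - intros x y1 y2 D1 D2. apply (ex_RInt_continuous (V := R_CompleteNormedModule)).
    intros z Hz. destruct (Hcl x z) as (l1 & l2 & l3 & E1 & E2).
    + apply (HD x y1 x y2); auto. rewrite Rmin_left, Rmax_left; lra.
    + exact (proj2 (differentiable_pt_lim_continuous _ _ _ _ _ E2)).
Qed.

Lemma RInt_Chasles_R (f : R -> R) (a b c : R) :
  ex_RInt f a b -> ex_RInt f b c -> RInt f a c = RInt f a b + RInt f b c.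
Proof. intros. symmetry. now apply (RInt_Chasles f). Qed.

Lemma circulation_split (P Q : R -> R -> R) (a m b c n d : R) :
  (forall x1 x2 y, In x1 (a :: m :: b :: nil) -> In x2 (a :: m :: b :: nil) ->
     In y (c :: n :: d :: nil) -> ex_RInt (fun x => P x y) x1 x2) ->
  (forall y1 y2 x, In y1 (c :: n :: d :: nil) -> In y2 (c :: n :: d :: nil) ->
     In x (a :: m :: b :: nil) -> ex_RInt (fun y => Q x y) y1 y2) ->
  circulation P Q a b c d =
  circulation P Q a m c n + circulation P Q m b c n
  + circulation P Q a m n d + circulation P Q m b n d.
Proof.
  intros HP HQ. unfold circulation.
  rewrite (RInt_Chasles_R (fun x => P x c) a m b) by (apply HP; simpl; tauto).
  rewrite (RInt_Chasles_R (fun x => P x d) a m b) by (apply HP; simpl; tauto).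
  rewrite (RInt_Chasles_R (fun y => Q a y) c n d) by (apply HQ; simpl; tauto).
  rewrite (RInt_Chasles_R (fun y => Q b y) c n d) by (apply HQ; simpl; tauto).
  ring.
Qed.

Lemma RInt_affine_close (f : R -> R) (a b k e : R) :
  a <= b -> ex_RInt f a b -> (forall x, a <= x <= b -> Rabs (f x - k) <= e) ->
  Rabs (RInt f a b - k * (b - a)) <= e * (b - a).
Proof.
  intros Hab Hex H.
  replace (RInt f a b - k * (b - a)) with (RInt (fun x => f x - k) a b).
  - rewrite Rmult_comm. apply abs_RInt_le_const; [exact Hab| |exact H].
    apply (ex_RInt_minus f (fun _ => k)); [exact Hex|apply ex_RInt_const].
  - rewrite (RInt_minus f (fun _ => k)); [|exact Hex|apply ex_RInt_const].
    rewrite RInt_const. unfold minus, plus, opp, scal; simpl. unfold mult; simpl. ring.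
Qed.

Lemma RInt_affine_close_swap (f : R -> R) (a b k e : R) :
  ex_RInt f a b -> (forall x, Rmin a b <= x <= Rmax a b -> Rabs (f x - k) <= e) ->
  Rabs (RInt f a b - k * (b - a)) <= e * Rabs (b - a).
Proof.
  intros Hex H. destruct (Rle_lt_dec a b) as [Hab|Hab].
  - rewrite Rmin_left, Rmax_right in H by lra.
    rewrite (Rabs_pos_eq (b - a)) by lra. now apply RInt_affine_close.
  - rewrite Rmin_right, Rmax_left in H by lra.
    rewrite (Rabs_left (b - a)) by lra.
    rewrite <- (opp_RInt_swap f b a) by now apply ex_RInt_swap.
    replace (opp (RInt f b a) - k * (b - a)) with (- (RInt f b a - k * (a - b)))
      by (unfold opp; simpl; ring).
    rewrite Rabs_Ropp. replace (- (b - a)) with (a - b) by ring.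
    apply RInt_affine_close; [lra|now apply ex_RInt_swap|exact H].
Qed.

(* Goursat's lemma: near a point the form is closed and linear up to o(diameter), so the
   circulation along a small rectangle is o(diameter^2), while it is additive. *)
Lemma goursat_rectangle (P Q : R -> R -> R) (a c w h : R) :
  0 <= w -> 0 <= h ->
  (forall x y, a <= x <= a + w -> c <= y <= c + h -> closed_form_at P Q x y) ->
  circulation P Q a (a + w) c (c + h) = 0.
Proof.
  intros Hw Hh Hcl.
  pose (D := fun x y => a <= x <= a + w /\ c <= y <= c + h).
  assert (HD : box_convex D).
  { intros x1 y1 x2 y2 x y [] [] Hx Hy. unfold D.
    revert Hx Hy. unfold Rmin, Rmax. destruct (Rle_dec x1 x2), (Rle_dec y1 y2); lra. }
  destruct (closed_form_ex_RInt D P Q HD (fun x y H => Hcl x y (proj1 H) (proj2 H)))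
    as [exP exQ].
  (* The bound is invariant under subdivision: four quarters with half the sides contribute
     [4 * 2 * ((w + h) / 2)^2 = 2 * (w + h)^2]. *)
  assert (Hsmall : forall e, 0 < e ->
     Rabs (circulation P Q a (a + w) c (c + h)) <= e * (2 * (w + h) ^ 2)).
  { intros e He.
    apply (quad_ind (fun a c w h =>
      Rabs (circulation P Q a (a + w) c (c + h)) <= e * (2 * (w + h) ^ 2)) a c w h Hw Hh).
    - intros a' c' w' h' Hw' Hh' Ha1 Ha2 Hc1 Hc2 I1 I2 I3 I4.
      replace (a' + w' / 2 + w' / 2) with (a' + w') in * by lra.
      replace (c' + h' / 2 + h' / 2) with (c' + h') in * by lra.
      rewrite (circulation_split P Q a' (a' + w' / 2) (a' + w') c' (c' + h' / 2) (c' + h')).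
      + assert (HH : e * (2 * (w' + h') ^ 2) = 4 * (e * (2 * (w' / 2 + h' / 2) ^ 2))) by field.
        rewrite HH.
        eapply Rle_trans; [apply Rabs_triang|].
        pose proof (Rabs_triang (circulation P Q a' (a' + w' / 2) c' (c' + h' / 2) +
           circulation P Q (a' + w' / 2) (a' + w') c' (c' + h' / 2))
           (circulation P Q a' (a' + w' / 2) (c' + h' / 2) (c' + h'))) as T1.
        pose proof (Rabs_triang (circulation P Q a' (a' + w' / 2) c' (c' + h' / 2))
           (circulation P Q (a' + w' / 2) (a' + w') c' (c' + h' / 2))) as T2.
        lra.
      + simpl In. intros x1 x2 y [<-|[<-|[<-|[]]]] [<-|[<-|[<-|[]]]] [<-|[<-|[<-|[]]]];
          apply exP; split; lra.
      + simpl In. intros x1 x2 y [<-|[<-|[<-|[]]]] [<-|[<-|[<-|[]]]] [<-|[<-|[<-|[]]]];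
          apply exQ; split; lra.
    - intros x y Hx Hy. destruct (Hcl x y Hx Hy) as (l1 & l2 & l3 & H1 & H2).
      destruct (H1 (mkposreal e He)) as [d1 D1]. destruct (H2 (mkposreal e He)) as [d2 D2].
      simpl in D1, D2.
      exists (Rmin d1 d2). split; [apply Rmin_pos; apply cond_pos|].
      intros a' c' w' h' [Hw1 Hw2] [Hh1 Hh2] Hx' Hy' Ha1 Ha2 Hc1 Hc2.
      assert (Hw3 : w' < d1) by (eapply Rlt_le_trans; [exact Hw2|apply Rmin_l]).
      assert (Hw4 : w' < d2) by (eapply Rlt_le_trans; [exact Hw2|apply Rmin_r]).
      assert (Hh3 : h' < d1) by (eapply Rlt_le_trans; [exact Hh2|apply Rmin_l]).
      assert (Hh4 : h' < d2) by (eapply Rlt_le_trans; [exact Hh2|apply Rmin_r]).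
      assert (Hm : forall u v, a' <= u <= a' + w' -> c' <= v <= c' + h' ->
         e * Rmax (Rabs (u - x)) (Rabs (v - y)) <= e * (w' + h')).
      { intros u v Hu Hv. apply Rmult_le_compat_l; [lra|].
        apply Rmax_lub; apply Rabs_le; lra. }
      (* Opposite sides are paired. The horizontal pair has main term [- l2 * h' * w'] and the
         vertical pair [l2 * w' * h']; they cancel because the form is closed. *)
      assert (Eh : Rabs (RInt (fun s => P s c' - P s (c' + h')) a' (a' + w')
          - (- l2 * h') * (a' + w' - a')) <= (2 * (e * (w' + h'))) * (a' + w' - a')).
      { apply RInt_affine_close; [lra| |].
        - apply (ex_RInt_minus (fun s => P s c') (fun s => P s (c' + h'))); apply exP; split; lra.
        - intros s Hs.
          assert (A1 := D1 s c' ltac:(apply Rabs_def1; lra) ltac:(apply Rabs_def1; lra)).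
          assert (A2 := D1 s (c' + h') ltac:(apply Rabs_def1; lra) ltac:(apply Rabs_def1; lra)).
          pose proof (Hm s c' Hs ltac:(lra)). pose proof (Hm s (c' + h') Hs ltac:(lra)).
          apply Rabs_le_between in A1. apply Rabs_le_between in A2.
          apply Rabs_le. lra. }
      assert (Ev : Rabs (RInt (fun s => Q (a' + w') s - Q a' s) c' (c' + h')
          - (l2 * w') * (c' + h' - c')) <= (2 * (e * (w' + h'))) * (c' + h' - c')).
      { apply RInt_affine_close; [lra| |].
        - apply (ex_RInt_minus (fun s => Q (a' + w') s) (fun s => Q a' s)); apply exQ; split; lra.
        - intros s Hs.
          assert (A1 := D2 a' s ltac:(apply Rabs_def1; lra) ltac:(apply Rabs_def1; lra)).
          assert (A2 := D2 (a' + w') s ltac:(apply Rabs_def1; lra) ltac:(apply Rabs_def1; lra)).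
          pose proof (Hm a' s ltac:(lra) Hs). pose proof (Hm (a' + w') s ltac:(lra) Hs).
          apply Rabs_le_between in A1. apply Rabs_le_between in A2.
          apply Rabs_le. lra. }
      rewrite (RInt_minus (fun s => P s c') (fun s => P s (c' + h'))) in Eh by (apply exP; split; lra).
      rewrite (RInt_minus (fun s => Q (a' + w') s) (fun s => Q a' s)) in Ev by (apply exQ; split; lra).
      unfold minus, plus, opp in Eh, Ev; simpl in Eh, Ev.
      unfold circulation.
      apply Rabs_le_between in Eh. apply Rabs_le_between in Ev.
      apply Rabs_le. lra. }
  apply NNPP; intros Hne.
  assert (Hpos : 0 < Rabs (circulation P Q a (a + w) c (c + h))) by now apply Rabs_pos_lt.
  set (I := Rabs (circulation P Q a (a + w) c (c + h))) in *.
  assert (HS : 0 <= (w + h) ^ 2) by apply pow2_ge_0.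
  specialize (Hsmall (I / (4 * (w + h) ^ 2 + 1)) ltac:(apply Rdiv_lt_0_compat; lra)).
  assert (I / (4 * (w + h) ^ 2 + 1) * (2 * (w + h) ^ 2) < I); [|lra].
  apply (Rmult_lt_reg_r (4 * (w + h) ^ 2 + 1)); [lra|].
  field_simplify; [|lra]. nra.
Qed.

(** Reversing either interval changes the sign of the circulation, so unordered corners reduce to
    Goursat's case. *)
Lemma circulation_zero (D : R -> R -> Prop) (P Q : R -> R -> R) (a b c d : R) :
  box_convex D -> (forall x y, D x y -> closed_form_at P Q x y) ->
  D a c -> D b d -> circulation P Q a b c d = 0.
Proof.
  intros HD Hcl H1 H2.
  assert (ordered : forall a b c d, a <= b -> c <= d ->
    (forall x y, a <= x <= b -> c <= y <= d -> D x y) -> circulation P Q a b c d = 0).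
  { intros a' b' c' d' Hab Hcd H.
    replace b' with (a' + (b' - a')) by ring. replace d' with (c' + (d' - c')) by ring.
    apply goursat_rectangle; try lra. intros x y Hx Hy. apply Hcl, H; lra. }
  assert (H3 : D b c) by exact (box_convex_corner D b d a c HD H2 H1).
  assert (H4 : D a d) by exact (box_convex_corner D a c b d HD H1 H2).
  destruct (closed_form_ex_RInt D P Q HD Hcl) as [exP exQ].
  assert (swx : circulation P Q a b c d = - circulation P Q b a c d).
  { unfold circulation.
    rewrite <- (opp_RInt_swap (fun x => P x c) b a), <- (opp_RInt_swap (fun x => P x d) b a)
      by auto.
    unfold opp; simpl. ring. }
  assert (swy : forall a b, D a c -> D b c -> D a d -> D b d ->
    circulation P Q a b c d = - circulation P Q a b d c).
  { intros a' b' ? ? ? ?. unfold circulation.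
    rewrite <- (opp_RInt_swap (fun y => Q a' y) d c), <- (opp_RInt_swap (fun y => Q b' y) d c)
      by auto.
    unfold opp; simpl. ring. }
  assert (box : forall x y, Rmin a b <= x <= Rmax a b -> Rmin c d <= y <= Rmax c d -> D x y).
  { intros. apply (HD a c b d); auto. }
  revert box. unfold Rmin, Rmax.
  destruct (Rle_dec a b), (Rle_dec c d); intros box.
  - apply ordered; auto; lra.
  - rewrite swy, ordered; auto; lra.
  - rewrite swx, ordered; auto; lra.
  - rewrite swx, swy, ordered; auto; lra.
Qed.

Lemma closed_form_potential (D : R -> R -> Prop) (P Q : R -> R -> R) :
  box_convex D -> open_2d D -> (forall x y, D x y -> closed_form_at P Q x y) ->
  exists U : R -> R -> R,
    forall x y, D x y -> differentiable_pt_lim U x y (P x y) (Q x y).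
Proof.
  intros HD HO Hcl.
  destruct (classic (exists x0 y0, D x0 y0)) as [(x0 & y0 & H0)|Hno];
    [|exists (fun _ _ => 0); intros x y Hxy; exfalso; eauto].
  destruct (closed_form_ex_RInt D P Q HD Hcl) as [exP exQ].
  assert (corner : forall x1 y1 x2 y2, D x1 y1 -> D x2 y2 -> D x1 y2)
    by (intros; now apply (box_convex_corner D x1 y1 x2 y2)).
  pose (U := fun x y => RInt (fun s => P s y0) x0 x + RInt (fun s => Q x s) y0 y).
  exists U.
  (* Vanishing circulation moves the path of integration: the increment of [U] is taken along the
     two legs from [(x, y)] to [(u, v)], where [P] and [Q] are almost constant. *)
  assert (incr : forall x y u v, D x y -> D u v ->
    U u v - U x y = RInt (fun s => P s y) x u + RInt (fun s => Q u s) y v).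
  { intros x y u v H1 H2. unfold U.
    pose proof (circulation_zero D P Q x u y0 y HD Hcl) as HC.
    unfold circulation in HC.
    assert (D x y0) by eauto. assert (D u y) by eauto. assert (D u y0) by eauto.
    specialize (HC ltac:(eauto) ltac:(eauto)).
    rewrite (RInt_Chasles_R (fun s => P s y0) x0 x u) by eauto.
    rewrite (RInt_Chasles_R (fun s => Q u s) y0 y v) by eauto.
    lra. }
  intros x y Hxy.
  destruct (Hcl x y Hxy) as (l1 & l2 & l3 & E1 & E2).
  intros eps.
  assert (Hc1 := differentiable_continuity_pt P x y (ex_intro _ _ (ex_intro _ _ E1))).
  assert (Hc2 := differentiable_continuity_pt Q x y (ex_intro _ _ (ex_intro _ _ E2))).
  destruct (Hc1 (pos_div_2 eps)) as [d1 D1]. destruct (Hc2 (pos_div_2 eps)) as [d2 D2].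
  destruct (HO x y Hxy) as [d3 D3]. simpl in D1, D2.
  assert (Hd : 0 < Rmin d1 (Rmin d2 d3))
    by (repeat apply Rmin_pos; apply cond_pos).
  exists (mkposreal _ Hd). simpl. intros u v Hu Hv.
  assert (Hm : Rmin d1 (Rmin d2 d3) <= d1 /\ Rmin d1 (Rmin d2 d3) <= d2
     /\ Rmin d1 (Rmin d2 d3) <= d3).
  { pose proof (Rmin_l d1 (Rmin d2 d3)). pose proof (Rmin_r d1 (Rmin d2 d3)).
    pose proof (Rmin_l d2 d3). pose proof (Rmin_r d2 d3). lra. }
  assert (Huv : D u v) by (apply D3; lra).
  rewrite (incr x y u v Hxy Huv).
  assert (B : forall s p q, Rmin p q <= s <= Rmax p q -> Rabs (s - p) <= Rabs (q - p)).
  { intros s p q. unfold Rmin, Rmax. destruct (Rle_dec p q); intros Hs.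
    - rewrite !Rabs_pos_eq; lra.
    - rewrite !Rabs_left1; lra. }
  assert (I1 : Rabs (RInt (fun s => P s y) x u - P x y * (u - x)) <= eps / 2 * Rabs (u - x)).
  { apply RInt_affine_close_swap; [apply exP; eauto|]. intros s Hs. left. apply D1.
    - pose proof (B s x u Hs). lra.
    - rewrite Rminus_diag, Rabs_R0. apply cond_pos. }
  assert (I2 : Rabs (RInt (fun s => Q u s) y v - Q x y * (v - y)) <= eps / 2 * Rabs (v - y)).
  { apply RInt_affine_close_swap; [apply exQ; eauto|]. intros s Hs. left. apply D2.
    - lra.
    - pose proof (B s y v Hs). lra. }
  pose proof (Rmax_l (Rabs (u - x)) (Rabs (v - y))) as M1.
  pose proof (Rmax_r (Rabs (u - x)) (Rabs (v - y))) as M2.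
  pose proof (cond_pos eps) as He.
  apply (Rmult_le_compat_l (eps / 2)) in M1; [|lra].
  apply (Rmult_le_compat_l (eps / 2)) in M2; [|lra].
  apply Rabs_le_between in I1. apply Rabs_le_between in I2. apply Rabs_le. lra.
Qed.

(** * Complex derivatives *)

Definition is_cderiv (f : C -> C) (z l : C) : Prop :=
  forall eps, 0 < eps -> exists d, 0 < d /\ forall w, Cmod (w - z) < d ->
    Cmod (f w - f z - l * (w - z)) <= eps * Cmod (w - z).

Definition ccont (f : C -> C) (z : C) : Prop :=
  forall eps, 0 < eps -> exists d, 0 < d /\ forall w, Cmod (w - z) < d ->
    Cmod (f w - f z) < eps.

Lemma is_derive_cderiv (f : C -> C) (z l : C) :
  @is_derive C_AbsRing C_NormedModule f z l -> is_cderiv f z l.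
Proof.
  intros [_ H] eps Heps.
  destruct (H z (fun P HP => HP) (mkposreal eps Heps)) as [d Hd].
  exists d. split; [apply cond_pos|]. intros w Hw.
  specialize (Hd w Hw).
  change (Cmod (f w - f z - (w - z) * l) <= eps * Cmod (w - z)) in Hd.
  now rewrite (Cmult_comm l).
Qed.


Lemma is_cderiv_cont (f : C -> C) (z l : C) : is_cderiv f z l -> ccont f z.
Proof.
  intros H eps Heps. destruct (H 1 ltac:(lra)) as [d [Hd HH]].
  pose proof (Cmod_ge_0 l) as Hl.
  exists (Rmin d (eps / (2 + Cmod l))). split.
  { apply Rmin_pos; [exact Hd|]. apply Rdiv_lt_0_compat; lra. }
  intros w Hw.
  assert (Hw1 := Rlt_le_trans _ _ _ Hw (Rmin_l _ _)).
  assert (Hw2 := Rlt_le_trans _ _ _ Hw (Rmin_r _ _)).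
  specialize (HH w Hw1).
  replace (f w - f z)%C with ((f w - f z - l * (w - z)) + l * (w - z))%C by ring.
  eapply Rle_lt_trans; [apply Cmod_triangle|]. rewrite Cmod_mult.
  pose proof (Cmod_ge_0 (w - z)).
  apply (Rmult_lt_compat_r (2 + Cmod l)) in Hw2; [|lra].
  unfold Rdiv in Hw2. rewrite Rmult_assoc, Rinv_l in Hw2 by lra. nra.
Qed.

Lemma is_cderiv_ext_loc (f g : C -> C) (z l : C) (r : R) :
  0 < r -> (forall w, Cmod (w - z) < r -> f w = g w) -> is_cderiv f z l -> is_cderiv g z l.
Proof.
  intros Hr He H eps Heps. destruct (H eps Heps) as [d [Hd HH]].
  exists (Rmin d r). split; [now apply Rmin_pos|]. intros w Hw.
  rewrite <- !He.
  - apply HH. eapply Rlt_le_trans; [exact Hw|apply Rmin_l].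
  - now replace (z - z)%C with (RtoC 0) by ring; rewrite Cmod_0.
  - eapply Rlt_le_trans; [exact Hw|apply Rmin_r].
Qed.

Lemma is_cderiv_const (c z : C) : is_cderiv (fun _ => c) z 0.
Proof.
  intros eps Heps. exists 1. split; [lra|]. intros w _.
  replace (c - c - 0 * (w - z))%C with (RtoC 0) by ring. rewrite Cmod_0.
  apply Rmult_le_pos; [lra|apply Cmod_ge_0].
Qed.

Lemma is_cderiv_id (z : C) : is_cderiv (fun w => w) z 1.
Proof.
  intros eps Heps. exists 1. split; [lra|]. intros w _.
  replace (w - z - 1 * (w - z))%C with (RtoC 0) by ring. rewrite Cmod_0.
  apply Rmult_le_pos; [lra|apply Cmod_ge_0].
Qed.

Lemma is_cderiv_plus (f g : C -> C) (z l m : C) :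
  is_cderiv f z l -> is_cderiv g z m -> is_cderiv (fun w => f w + g w)%C z (l + m)%C.
Proof.
  intros Hf Hg eps Heps.
  destruct (Hf (eps / 2) ltac:(lra)) as [d1 [Hd1 H1]].
  destruct (Hg (eps / 2) ltac:(lra)) as [d2 [Hd2 H2]].
  exists (Rmin d1 d2). split; [now apply Rmin_pos|]. intros w Hw.
  specialize (H1 w (Rlt_le_trans _ _ _ Hw (Rmin_l _ _))).
  specialize (H2 w (Rlt_le_trans _ _ _ Hw (Rmin_r _ _))).
  replace (f w + g w - (f z + g z) - (l + m) * (w - z))%C
    with ((f w - f z - l * (w - z)) + (g w - g z - m * (w - z)))%C by ring.
  eapply Rle_trans; [apply Cmod_triangle|]. lra.
Qed.

Lemma is_cderiv_mult (f g : C -> C) (z l m : C) :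
  is_cderiv f z l -> is_cderiv g z m ->
  is_cderiv (fun w => f w * g w)%C z (l * g z + f z * m)%C.
Proof.
  intros Hf Hg eps Heps.
  pose proof (Cmod_ge_0 (g z)) as Pg. pose proof (Cmod_ge_0 (f z)) as Pf.
  pose proof (Cmod_ge_0 l) as Pl.
  assert (E1 : 0 < eps / (3 * (Cmod (g z) + 1))) by (apply Rdiv_lt_0_compat; lra).
  assert (E2 : 0 < eps / (3 * (Cmod l + 1))) by (apply Rdiv_lt_0_compat; lra).
  assert (E3 : 0 < eps / (3 * (Cmod (f z) + 1))) by (apply Rdiv_lt_0_compat; lra).
  destruct (Hf _ E1) as [d1 [Hd1 H1]].
  destruct (Hg _ E3) as [d2 [Hd2 H2]].
  destruct (is_cderiv_cont g z m Hg _ E2) as [d3 [Hd3 H3]].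
  destruct (is_cderiv_cont g z m Hg 1 ltac:(lra)) as [d4 [Hd4 H4]].
  exists (Rmin (Rmin d1 d2) (Rmin d3 d4)).
  split; [repeat apply Rmin_pos; assumption|]. intros w Hw.
  pose proof (Rmin_l (Rmin d1 d2) (Rmin d3 d4)). pose proof (Rmin_r (Rmin d1 d2) (Rmin d3 d4)).
  pose proof (Rmin_l d1 d2). pose proof (Rmin_r d1 d2).
  pose proof (Rmin_l d3 d4). pose proof (Rmin_r d3 d4).
  specialize (H1 w ltac:(lra)). specialize (H2 w ltac:(lra)).
  specialize (H3 w ltac:(lra)). specialize (H4 w ltac:(lra)).
  replace (f w * g w - f z * g z - (l * g z + f z * m) * (w - z))%C
    with ((f w - f z - l * (w - z)) * g w
          + (l * (w - z) * (g w - g z) + f z * (g w - g z - m * (w - z))))%C by ring.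
  eapply Rle_trans; [apply Cmod_triangle|].
  eapply Rle_trans; [apply Rplus_le_compat_l, Cmod_triangle|].
  rewrite !Cmod_mult.
  set (k := Cmod (w - z)) in *. assert (Hk : 0 <= k) by apply Cmod_ge_0.
  assert (Hgw : Cmod (g w) <= Cmod (g z) + 1).
  { replace (g w) with (g z + (g w - g z))%C by ring.
    eapply Rle_trans; [apply Cmod_triangle|]. lra. }
  assert (T1 : Cmod (f w - f z - l * (w - z)) * Cmod (g w) <= eps / 3 * k).
  { eapply Rle_trans; [apply Rmult_le_compat; try apply Cmod_ge_0; eassumption|].
    right. field. lra. }
  assert (T2 : Cmod l * k * Cmod (g w - g z) <= eps / 3 * k).
  { apply Rle_trans with ((Cmod l + 1) * k * (eps / (3 * (Cmod l + 1)))).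
    - apply Rmult_le_compat; try apply Cmod_ge_0; try lra.
      apply Rmult_le_pos; lra.
    - right. field. lra. }
  assert (T3 : Cmod (f z) * Cmod (g w - g z - m * (w - z)) <= eps / 3 * k).
  { apply Rle_trans with ((Cmod (f z) + 1) * (eps / (3 * (Cmod (f z) + 1)) * k)).
    - apply Rmult_le_compat; try apply Cmod_ge_0; lra.
    - right. field. lra. }
  lra.
Qed.

Lemma is_cderiv_scal (c : C) (f : C -> C) (z l : C) :
  is_cderiv f z l -> is_cderiv (fun w => c * f w)%C z (c * l)%C.
Proof.
  intros Hf. replace (c * l)%C with (0 * f z + c * l)%C by ring.
  apply (is_cderiv_mult (fun _ => c)); [apply is_cderiv_const|exact Hf].
Qed.

Lemma is_cderiv_inv (f : C -> C) (z l : C) :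
  is_cderiv f z l -> f z <> 0 -> is_cderiv (fun w => / f w)%C z (- l / (f z * f z))%C.
Proof.
  intros Hf Hz eps Heps.
  pose proof (proj1 (Cmod_gt_0 (f z)) Hz) as Pf.
  pose proof (Cmod_ge_0 l) as Pl.
  set (a := Cmod (f z)) in *.
  assert (E1 : 0 < eps * a * a / 4) by (repeat apply Rmult_lt_0_compat; lra).
  assert (E2 : 0 < eps * a * a * a / (4 * (Cmod l + 1))).
  { apply Rdiv_lt_0_compat; [repeat apply Rmult_lt_0_compat|]; lra. }
  destruct (Hf _ E1) as [d1 [Hd1 H1]].
  destruct (is_cderiv_cont f z l Hf _ E2) as [d2 [Hd2 H2]].
  destruct (is_cderiv_cont f z l Hf (a / 2) ltac:(lra)) as [d3 [Hd3 H3]].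
  exists (Rmin d1 (Rmin d2 d3)).
  split; [repeat apply Rmin_pos; assumption|]. intros w Hw.
  pose proof (Rmin_l d1 (Rmin d2 d3)). pose proof (Rmin_r d1 (Rmin d2 d3)).
  pose proof (Rmin_l d2 d3). pose proof (Rmin_r d2 d3).
  specialize (H1 w ltac:(lra)). specialize (H2 w ltac:(lra)). specialize (H3 w ltac:(lra)).
  assert (Hfw : a / 2 <= Cmod (f w)).
  { assert (a <= Cmod (f w) + Cmod (f w - f z)); [|lra].
    unfold a. replace (f z) with (f w + - (f w - f z))%C at 1 by ring.
    eapply Rle_trans; [apply Cmod_triangle|]. rewrite Cmod_opp. lra. }
  assert (Hw0 : f w <> 0) by (apply Cmod_gt_0; lra).
  replace (/ f w - / f z - - l / (f z * f z) * (w - z))%C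
    with ((- (f w - f z - l * (w - z)) * f z + l * (w - z) * (f w - f z)) / (f z * f z * f w))%C
    by (field; tauto).
  rewrite Cmod_div by (apply Cmult_neq_0; [apply Cmult_neq_0|]; assumption).
  rewrite !Cmod_mult. fold a.
  assert (Hden : 0 < a * a * Cmod (f w)) by (repeat apply Rmult_lt_0_compat; lra).
  apply (Rmult_le_reg_r (a * a * Cmod (f w))); [exact Hden|].
  unfold Rdiv. rewrite Rmult_assoc, Rinv_l, Rmult_1_r by lra.
  eapply Rle_trans; [apply Cmod_triangle|]. rewrite !Cmod_mult, Cmod_opp. fold a.
  set (k := Cmod (w - z)) in *. assert (Hk : 0 <= k) by apply Cmod_ge_0.
  assert (T1 : Cmod (f w - f z - l * (w - z)) * a <= eps * a * a / 4 * k * a).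
  { apply Rmult_le_compat_r; [lra|exact H1]. }
  assert (T2 : Cmod l * k * Cmod (f w - f z) <= eps * a * a * a / 4 * k).
  { apply Rle_trans with ((Cmod l + 1) * k * (eps * a * a * a / (4 * (Cmod l + 1)))).
    - apply Rmult_le_compat; try apply Cmod_ge_0; try lra.
      apply Rmult_le_pos; lra.
    - right. field. lra. }
  assert (T3 : eps * k * (a * a * (a / 2)) <= eps * k * (a * a * Cmod (f w))).
  { apply Rmult_le_compat_l; [apply Rmult_le_pos; lra|].
    apply Rmult_le_compat_l; [apply Rmult_le_pos; lra|exact Hfw]. }
  lra.
Qed.

Lemma Cmod_le_Rabs_sum (z : C) : Cmod z <= Rabs (Re z) + Rabs (Im z).
Proof.
  destruct z as [x y]. simpl.
  replace (x, y) with (RtoC x + Ci * RtoC y)%C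
    by (unfold RtoC, Ci, Cplus, Cmult; simpl; f_equal; ring).
  eapply Rle_trans; [apply Cmod_triangle|]. rewrite Cmod_mult, !Cmod_R.
  replace (Cmod Ci) with 1; [lra|].
  unfold Cmod, Ci; simpl. replace (0 * (0 * 1) + 1 * (1 * 1)) with 1 by ring.
  now rewrite sqrt_1.
Qed.

Lemma Re_le_Cmod (z : C) : Rabs (Re z) <= Cmod z.
Proof. eapply Rle_trans; [apply Rmax_l|apply Rmax_Cmod]. Qed.

Lemma Im_le_Cmod (z : C) : Rabs (Im z) <= Cmod z.
Proof. eapply Rle_trans; [apply Rmax_r|apply Rmax_Cmod]. Qed.

(** The two real differentials carry the Cauchy-Riemann equations in their coefficients; this is
    what makes the forms built from [f] closed. The factor 2 between modulus and maximum norm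
    explains the halved [eps]. *)
Lemma is_cderiv_components (f : C -> C) (x y a b : R) :
  is_cderiv f (x, y) (a, b) <->
  differentiable_pt_lim (fun u v => Re (f (u, v))) x y a (- b) /\
  differentiable_pt_lim (fun u v => Im (f (u, v))) x y b a.
Proof.
  assert (Hd : forall u v, ((u, v) - (x, y))%C = (u - x, v - y)) by reflexivity.
  assert (HRe : forall u v, Re (f (u, v) - f (x, y) - (a, b) * ((u, v) - (x, y)))%C
     = Re (f (u, v)) - Re (f (x, y)) - (a * (u - x) + - b * (v - y))).
  { intros. destruct (f (u, v)), (f (x, y)). simpl. ring. }
  assert (HIm : forall u v, Im (f (u, v) - f (x, y) - (a, b) * ((u, v) - (x, y)))%C
     = Im (f (u, v)) - Im (f (x, y)) - (b * (u - x) + a * (v - y))).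
  { intros. destruct (f (u, v)), (f (x, y)). simpl. ring. }
  split.
  - intros H. split.
    all: intros eps; destruct (H (eps / 2)) as [d [Hdp HH]]; [pose proof (cond_pos eps); lra|].
    all: assert (Hd2 : 0 < d / 2) by lra; exists (mkposreal _ Hd2); simpl; intros u v Hu Hv.
    all: assert (Hk := Cmod_le_Rabs_sum ((u, v) - (x, y))%C); rewrite Hd in Hk; simpl in Hk.
    all: specialize (HH (u, v)); rewrite Hd in HH; specialize (HH ltac:(lra)); rewrite <- Hd in HH.
    all: pose proof (cond_pos eps); pose proof (Rmax_l (Rabs (u - x)) (Rabs (v - y))).
    all: pose proof (Rmax_r (Rabs (u - x)) (Rabs (v - y))).
    1: rewrite <- HRe; eapply Rle_trans; [apply Re_le_Cmod|].
    2: rewrite <- HIm; eapply Rle_trans; [apply Im_le_Cmod|].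
    all: eapply Rle_trans; [exact HH|]; rewrite Hd.
    all: replace (eps * Rmax (Rabs (u - x)) (Rabs (v - y)))
      with (eps / 2 * (2 * Rmax (Rabs (u - x)) (Rabs (v - y)))) by field.
    all: apply Rmult_le_compat_l; lra.
  - intros [H1 H2] eps Heps.
    assert (He : 0 < eps / 2) by lra.
    destruct (H1 (mkposreal _ He)) as [d1 D1]. destruct (H2 (mkposreal _ He)) as [d2 D2].
    simpl in D1, D2.
    exists (Rmin d1 d2). split; [apply Rmin_pos; apply cond_pos|].
    intros [u v]. rewrite Hd. intros Hw.
    pose proof (Rmin_l d1 d2). pose proof (Rmin_r d1 d2).
    pose proof (Re_le_Cmod (u - x, v - y)) as K1. pose proof (Im_le_Cmod (u - x, v - y)) as K2.
    simpl in K1, K2.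
    specialize (D1 u v ltac:(lra) ltac:(lra)). specialize (D2 u v ltac:(lra) ltac:(lra)).
    rewrite <- Hd.
    eapply Rle_trans; [apply Cmod_le_Rabs_sum|]. rewrite HRe, HIm, Hd.
    assert (Rmax (Rabs (u - x)) (Rabs (v - y)) <= Cmod (u - x, v - y)) by now apply Rmax_lub.
    assert (eps / 2 * Rmax (Rabs (u - x)) (Rabs (v - y)) <= eps / 2 * Cmod (u - x, v - y)).
    { apply Rmult_le_compat_l; lra. }
    lra.
Qed.

Lemma is_cderiv_curve (f : C -> C) (x y : R -> R) (t x' y' : R) (l : C) :
  is_cderiv f (x t, y t) l -> is_derive x t x' -> is_derive y t y' ->
  is_derive (fun s => Re (f (x s, y s))) t (Re (l * (x', y'))%C) /\
  is_derive (fun s => Im (f (x s, y s))) t (Im (l * (x', y'))%C).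
Proof.
  intros Hf Hx Hy. destruct l as [a b]. apply is_cderiv_components in Hf.
  destruct Hf as [H1 H2].
  apply is_derive_Reals in Hx. apply is_derive_Reals in Hy.
  split; apply is_derive_Reals.
  - replace (Re ((a, b) * (x', y'))%C) with (a * x' + - b * y') by (simpl; ring).
    apply (derivable_pt_lim_comp_2d (fun u v => Re (f (u, v))) x y); assumption.
  - replace (Im ((a, b) * (x', y'))%C) with (b * x' + a * y') by (simpl; ring).
    apply (derivable_pt_lim_comp_2d (fun u v => Im (f (u, v))) x y); assumption.
Qed.

(** * Maximum principle and Schwarz-Pick lemma *)

Lemma differentiable_pt_lim_fst (f : R -> R) (x y l : R) :
  is_derive f x l -> differentiable_pt_lim (fun u _ => f u) x y l 0.
Proof. intros H. apply differentiable_pt_lim_proj1_0. now apply is_derive_Reals. Qed.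

Lemma differentiable_pt_lim_snd (f : R -> R) (x y l : R) :
  is_derive f y l -> differentiable_pt_lim (fun _ v => f v) x y 0 l.
Proof.
  intros H eps. destruct (differentiable_pt_lim_fst f y x l H eps) as [d Hd].
  exists d. intros u v Hu Hv. specialize (Hd v u Hv Hu).
  rewrite Rmax_comm. replace (0 * (u - x) + l * (v - y)) with (l * (v - y) + 0 * (u - x)) by ring.
  exact Hd.
Qed.

Lemma differentiable_pt_lim_add (f g : R -> R -> R) (x y a b c d : R) :
  differentiable_pt_lim f x y a b -> differentiable_pt_lim g x y c d ->
  differentiable_pt_lim (fun u v => f u v + g u v) x y (a + c) (b + d).
Proof.
  intros Hf Hg.
  replace (a + c) with (1 * a + 1 * c) by ring. replace (b + d) with (1 * b + 1 * d) by ring.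
  apply (differentiable_pt_lim_comp (fun u v => u + v) f g); try assumption.
  intros eps. exists (mkposreal 1 Rlt_0_1). intros u v _ _.
  replace (u + v - _ - _) with 0 by ring. rewrite Rabs_R0.
  apply Rmult_le_pos; [left; apply cond_pos|].
  eapply Rle_trans; [apply Rabs_pos|apply Rmax_l].
Qed.

Lemma differentiable_pt_lim_mul (f g : R -> R -> R) (x y a b c d : R) :
  differentiable_pt_lim f x y a b -> differentiable_pt_lim g x y c d ->
  differentiable_pt_lim (fun u v => f u v * g u v) x y
    (g x y * a + f x y * c) (g x y * b + f x y * d).
Proof.
  intros Hf Hg.
  apply (differentiable_pt_lim_comp (fun u v => u * v) f g); try assumption.
  intros eps. exists eps. intros u v Hu Hv.
  replace (u * v - f x y * g x y - _) with ((u - f x y) * (v - g x y)) by ring.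
  rewrite Rabs_mult. apply Rmult_le_compat; try apply Rabs_pos; [lra|apply Rmax_r].
Qed.

Definition polar (p : C) (s th : R) : C :=
  (Re p + exp s * cos th, Im p + exp s * sin th).

Lemma Cmod_polar (p : C) (s th : R) : Cmod (polar p s th - p)%C = exp s.
Proof.
  destruct p as [a b]. unfold polar, Cmod; simpl.
  replace (_ + _) with (exp s * exp s).
  - apply sqrt_square. left; apply exp_pos.
  - pose proof (sin2_cos2 th) as H. unfold Rsqr in H.
    transitivity (exp s * exp s * (sin th * sin th + cos th * cos th)); [rewrite H|]; ring.
Qed.

(** With [s] the logarithm of the radius, [s + i th] is the holomorphic coordinate [log (z - p)],
    and the form is the imaginary part of [f d(log (z - p))]. *)
Lemma polar_closed_form (f : C -> C) (p : C) (s th : R) :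
  (exists l, is_cderiv f (polar p s th) l) ->
  closed_form_at (fun s th => Im (f (polar p s th))) (fun s th => Re (f (polar p s th))) s th.
Proof.
  intros [[a b] H]. apply is_cderiv_components in H. destruct H as [H1 H2].
  assert (Hx : differentiable_pt_lim (fun s th => Re p + exp s * cos th) s th
     (exp s * cos th) (- exp s * sin th)).
  { replace (exp s * cos th) with (0 + (cos th * exp s + exp s * 0)) at 1 by ring.
    replace (- exp s * sin th) with (0 + (cos th * 0 + exp s * (- sin th))) by ring.
    apply (differentiable_pt_lim_add (fun _ _ => Re p)).
    - apply (differentiable_pt_lim_fst (fun _ => Re p)). apply @is_derive_const.
    - apply (differentiable_pt_lim_mul (fun u _ => exp u) (fun _ v => cos v)).
      + apply differentiable_pt_lim_fst. auto_derive; [exact I|ring].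
      + apply differentiable_pt_lim_snd. auto_derive; [exact I|ring]. }
  assert (Hy : differentiable_pt_lim (fun s th => Im p + exp s * sin th) s th
     (exp s * sin th) (exp s * cos th)).
  { replace (exp s * sin th) with (0 + (sin th * exp s + exp s * 0)) at 1 by ring.
    replace (exp s * cos th) with (0 + (sin th * 0 + exp s * cos th)) by ring.
    apply (differentiable_pt_lim_add (fun _ _ => Im p)).
    - apply (differentiable_pt_lim_fst (fun _ => Im p)). apply @is_derive_const.
    - apply (differentiable_pt_lim_mul (fun u _ => exp u) (fun _ v => sin v)).
      + apply differentiable_pt_lim_fst. auto_derive; [exact I|ring].
      + apply differentiable_pt_lim_snd. auto_derive; [exact I|ring]. }
  pose proof (differentiable_pt_lim_comp (fun u v => Im (f (u, v))) _ _ s th _ _ _ _ _ _ H2 Hx Hy) as K1.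
  pose proof (differentiable_pt_lim_comp (fun u v => Re (f (u, v))) _ _ s th _ _ _ _ _ _ H1 Hx Hy) as K2.
  eexists _, _, _. split; [exact K1|].
  replace (b * (- exp s * sin th) + a * (exp s * cos th))
    with (a * (exp s * cos th) + - b * (exp s * sin th)) by ring.
  exact K2.
Qed.

(* The potential [U] of the closed form [Im f ds + Re f dth] in logarithmic polar coordinates
   shows that the circular means of [Re f] do not depend on the radius, so they equal
   [Re f p]; the quadratic term would push them strictly below. *)
Lemma no_local_max (f : C -> C) (p : C) (r0 al be A B : R) :
  0 < r0 -> 0 < A + B ->
  (forall z, 0 < Cmod (z - p) < r0 -> exists l, is_cderiv f z l) -> ccont f p ->
  (forall z, Cmod (z - p) < r0 ->
     Re (f z) + al * Re (z - p)%C + be * Im (z - p)%C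
     + A * Re (z - p)%C ^ 2 + B * Im (z - p)%C ^ 2 <= Re (f p)) ->
  False.
Proof.
  intros Hr0 HAB Hhol Hcont Hmax.
  pose (D := fun s th : R => exp s < r0).
  destruct (closed_form_potential D (fun s th => Im (f (polar p s th)))
     (fun s th => Re (f (polar p s th)))) as [U HU].
  - intros x1 y1 x2 y2 x y H1 H2 [_ Hx] _. unfold D in *.
    revert Hx. unfold Rmax. destruct (Rle_dec x1 x2); intros Hx.
    + apply Rle_lt_trans with (exp x2); [|exact H2].
      destruct Hx as [Hx| ->]; [left; now apply exp_increasing|right; reflexivity].
    + apply Rle_lt_trans with (exp x1); [|exact H1].
      destruct Hx as [Hx| ->]; [left; now apply exp_increasing|right; reflexivity].
  - intros x y H. unfold D in *.
    assert (Hx : x < ln r0) by (apply exp_lt_inv; rewrite exp_ln; assumption).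
    assert (Hd : 0 < ln r0 - x) by lra.
    exists (mkposreal _ Hd). simpl. intros u v Hu _.
    apply Rabs_def2 in Hu. rewrite <- (exp_ln r0) by exact Hr0. apply exp_increasing. lra.
  - intros s th H. apply polar_closed_form. apply Hhol. rewrite Cmod_polar.
    split; [apply exp_pos|exact H].
  - assert (dth : forall s th, D s th ->
      derivable_pt_lim (fun v => U s v) th (Re (f (polar p s th)))).
    { intros s th H.
      replace (Re (f (polar p s th)))
        with (Im (f (polar p s th)) * 0 + Re (f (polar p s th)) * 1) by ring.
      apply (derivable_pt_lim_comp_2d U (fun _ => s) (fun v => v)); [now apply HU| |].
      - apply derivable_pt_lim_const.
      - apply derivable_pt_lim_id. }
    assert (ds : forall s th, D s th ->
      derivable_pt_lim (fun v => U v th) s (Im (f (polar p s th)))).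
    { intros s th H.
      replace (Im (f (polar p s th)))
        with (Im (f (polar p s th)) * 1 + Re (f (polar p s th)) * 0) by ring.
      apply (derivable_pt_lim_comp_2d U (fun v => v) (fun _ => th)); [now apply HU| |].
      - apply derivable_pt_lim_id.
      - apply derivable_pt_lim_const. }
    pose proof PI_RGT_0 as HPI.
    (* [J s] is the integral of [Re f] over the circle of radius [exp s]. Its derivative in [s]
       vanishes because angles [0] and [2 * PI] give the same point. *)
    pose (J := fun s => U s (2 * PI) - U s 0).
    assert (HJ : forall s s', s < s' -> exp s' < r0 -> J s' = J s).
    { intros s s' Hs Hs'.
      destruct (MVT_cor2 J (fun _ => 0) s s' Hs) as [c [Hc _]]; [|lra].
      intros c Hc.
      assert (HD : D c 0).
      { unfold D. apply Rle_lt_trans with (exp s'); [|exact Hs'].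
        destruct Hc as [_ [Hc| ->]]; [left; now apply exp_increasing|right; reflexivity]. }
      assert (E := derivable_pt_lim_minus (fun v => U v (2 * PI)) (fun v => U v 0) c _ _
        (ds c (2 * PI) HD) (ds c 0 HD)).
      replace (polar p c (2 * PI)) with (polar p c 0) in E
        by (unfold polar; now rewrite cos_2PI, sin_2PI, cos_0, sin_0).
      rewrite Rminus_diag in E. exact E. }
    pose (s1 := ln (r0 / 2)).
    assert (Hs1 : exp s1 = r0 / 2) by (apply exp_ln; lra).
    pose (k := r0 / 2).
    assert (Hup : J s1 <= 2 * PI * Re (f p) - k * k * (A + B) * PI).
    { pose (N := fun th => U s1 th + k * (al * sin th - be * cos th)
         + k * k * ((A + B) / 2 * th + (A - B) / 4 * sin (2 * th))
         - Re (f p) * th).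
      destruct (MVT_cor2 N (fun th => Re (f (polar p s1 th)) + k * (al * cos th + be * sin th)
         + k * k * (A * cos th ^ 2 + B * sin th ^ 2) - Re (f p)) 0 (2 * PI))
         as [c [Hc _]]; [lra| |].
      - intros c _. unfold N. apply is_derive_Reals.
        assert (E := dth s1 c). apply is_derive_Reals in E; [|unfold D; lra].
        evar_last.
        + apply @is_derive_minus; [apply @is_derive_plus; [apply @is_derive_plus; [exact E|]|]|].
          * auto_derive; [exact I|reflexivity].
          * auto_derive; [exact I|reflexivity].
          * auto_derive; [exact I|reflexivity].
        + unfold plus, minus, opp; simpl. unfold plus, opp; simpl.
          rewrite cos_2a. pose proof (sin2_cos2 c) as S. unfold Rsqr in S.
          replace ((A + B) / 2 * 1) with ((A + B) / 2 * (sin c * sin c + cos c * cos c))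
            by (rewrite S; ring).
          field.
      - assert (HN : N (2 * PI) - N 0 = J s1 + k * k * (A + B) * PI - 2 * PI * Re (f p)).
        { unfold N, J. replace (2 * (2 * PI)) with (0 + 2 * INR 2 * PI) by (simpl; ring).
          rewrite sin_period. replace (2 * 0) with 0 by ring.
          rewrite sin_2PI, cos_2PI, sin_0, cos_0. field. }
        rewrite HN in Hc.
        specialize (Hmax (polar p s1 c)). rewrite Cmod_polar, Hs1 in Hmax.
        specialize (Hmax ltac:(lra)).
        replace (Re (polar p s1 c - p)%C) with (k * cos c) in Hmax
          by (destruct p; simpl; rewrite Hs1; unfold k; ring).
        replace (Im (polar p s1 c - p)%C) with (k * sin c) in Hmax
          by (destruct p; simpl; rewrite Hs1; unfold k; ring).
        assert (J s1 + k * k * (A + B) * PI - 2 * PI * Re (f p) <= 0); [|lra].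
        rewrite Hc. assert (0 <= 2 * PI - 0) by lra. nra. }
    assert (Hk : 0 < k * k * (A + B)).
    { unfold k. repeat apply Rmult_lt_0_compat; lra. }
    (* On a small circle continuity at [p] loses at most half of that gain. Only continuity is
       needed at the centre, so a removable singularity there is harmless. *)
    destruct (Hcont (k * k * (A + B) / 4) ltac:(lra)) as [d [Hd Hc]].
    pose (m := Rmin (d / 2) (r0 / 4)).
    assert (Hm : 0 < m) by (apply Rmin_pos; lra).
    assert (Hm1 : m <= d / 2) by apply Rmin_l. assert (Hm2 : m <= r0 / 4) by apply Rmin_r.
    pose (s2 := ln m). assert (Hs2 : exp s2 = m) by now apply exp_ln.
    assert (HJ12 : J s1 = J s2).
    { apply HJ; [|rewrite Hs1; lra]. apply exp_lt_inv. rewrite Hs1, Hs2. lra. }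
    destruct (MVT_cor2 (fun v => U s2 v) (fun th => Re (f (polar p s2 th))) 0 (2 * PI))
      as [c [E _]]; [lra| |].
    { intros c _. apply dth. unfold D. lra. }
    assert (HRe : Rabs (Re (f (polar p s2 c) - f p)%C) < k * k * (A + B) / 4).
    { eapply Rle_lt_trans; [apply Re_le_Cmod|]. apply Hc. rewrite Cmod_polar. lra. }
    replace (Re (f (polar p s2 c) - f p)%C) with (Re (f (polar p s2 c)) - Re (f p)) in HRe
      by (destruct (f (polar p s2 c)), (f p); reflexivity).
    apply Rabs_def2 in HRe. unfold J in *. nra.
Qed.

Lemma Cmod_sq (z : C) : Cmod z ^ 2 = Re z ^ 2 + Im z ^ 2.
Proof. unfold Cmod. rewrite pow2_sqrt; [reflexivity|]. nra. Qed.

Lemma Cmod_rev_triangle (a b : C) : Rabs (Cmod a - Cmod b) <= Cmod (a - b)%C.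
Proof.
  assert (H1 := Cmod_triangle (a - b)%C b). assert (H2 := Cmod_triangle (b - a)%C a).
  replace (a - b + b)%C with a in H1 by ring. replace (b - a + a)%C with b in H2 by ring.
  replace (b - a)%C with (- (a - b))%C in H2 by ring. rewrite Cmod_opp in H2.
  apply Rabs_le. lra.
Qed.

Lemma ccont_const (c z : C) : ccont (fun _ => c) z.
Proof. exact (is_cderiv_cont _ _ _ (is_cderiv_const c z)). Qed.

Lemma ccont_mult (f g : C -> C) (z : C) :
  ccont f z -> ccont g z -> ccont (fun w => f w * g w)%C z.
Proof.
  intros Hf Hg eps Heps.
  pose proof (Cmod_ge_0 (g z)) as Pg. pose proof (Cmod_ge_0 (f z)) as Pf.
  assert (E1 : 0 < eps / (2 * (Cmod (g z) + 1))) by (apply Rdiv_lt_0_compat; lra).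
  assert (E2 : 0 < eps / (2 * (Cmod (f z) + 1))) by (apply Rdiv_lt_0_compat; lra).
  destruct (Hf _ E1) as [d1 [Hd1 H1]].
  destruct (Hg _ E2) as [d2 [Hd2 H2]].
  destruct (Hg 1 ltac:(lra)) as [d3 [Hd3 H3]].
  exists (Rmin d1 (Rmin d2 d3)). split; [repeat apply Rmin_pos; assumption|]. intros w Hw.
  pose proof (Rmin_l d1 (Rmin d2 d3)). pose proof (Rmin_r d1 (Rmin d2 d3)).
  pose proof (Rmin_l d2 d3). pose proof (Rmin_r d2 d3).
  specialize (H1 w ltac:(lra)). specialize (H2 w ltac:(lra)). specialize (H3 w ltac:(lra)).
  replace (f w * g w - f z * g z)%C with ((f w - f z) * g w + f z * (g w - g z))%C by ring.
  eapply Rle_lt_trans; [apply Cmod_triangle|]. rewrite !Cmod_mult.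
  assert (Hgw : Cmod (g w) <= Cmod (g z) + 1).
  { pose proof (Cmod_rev_triangle (g w) (g z)) as T. apply Rabs_le_between in T. lra. }
  assert (T1 : Cmod (f w - f z) * Cmod (g w) <= eps / (2 * (Cmod (g z) + 1)) * (Cmod (g z) + 1)).
  { apply Rmult_le_compat; try apply Cmod_ge_0; lra. }
  assert (T2 : Cmod (f z) * Cmod (g w - g z) < (Cmod (f z) + 1) * (eps / (2 * (Cmod (f z) + 1)))).
  { apply Rle_lt_trans with (Cmod (f z) * (eps / (2 * (Cmod (f z) + 1)))).
    - apply Rmult_le_compat_l; lra.
    - lra. }
  replace (eps / (2 * (Cmod (g z) + 1)) * (Cmod (g z) + 1)) with (eps / 2) in T1 by (field; lra).
  replace ((Cmod (f z) + 1) * (eps / (2 * (Cmod (f z) + 1)))) with (eps / 2) in T2 by (field; lra).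
  lra.
Qed.

Lemma ccont_Cmod_sq (g : C -> C) (p : C) (e : R) : ccont g p -> 0 < e ->
  exists d, 0 < d /\ forall z, Cmod (z - p)%C < d -> Cmod (g z) ^ 2 < Cmod (g p) ^ 2 + e.
Proof.
  intros Hg He. pose proof (Cmod_ge_0 (g p)) as P.
  pose (h := Rmin 1 (e / (2 * Cmod (g p) + 2))).
  assert (Hh0 : 0 < h) by (apply Rmin_pos; [lra|apply Rdiv_lt_0_compat; lra]).
  destruct (Hg h Hh0) as [d [Hd H]]. exists d. split; [exact Hd|]. intros z Hz.
  specialize (H z Hz).
  pose proof (Cmod_rev_triangle (g z) (g p)) as T. apply Rabs_le_between in T.
  pose proof (Cmod_ge_0 (g z)).
  assert (H1 : h <= 1) by apply Rmin_l.
  assert (H2 : h <= e / (2 * Cmod (g p) + 2)) by apply Rmin_r.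
  apply (Rmult_le_compat_r (2 * Cmod (g p) + 2)) in H2; [|lra].
  unfold Rdiv in H2. rewrite Rmult_assoc, Rinv_l, Rmult_1_r in H2 by lra.
  assert (Cmod (g z) ^ 2 < (Cmod (g p) + h) ^ 2) by nra.
  nra.
Qed.

(** The function [|g|^2 + e |z|^2] is maximized on the compact set [K]. The small term makes it
    strictly subharmonic, so its maximum cannot sit at an interior point. Each interior point may
    itself be singular for [g], which accommodates difference quotients. *)
Lemma max_modulus (K : C -> Prop) (g : C -> C) (M R0 : R) :
  0 <= M ->
  (forall z, K z -> Cmod z <= R0) ->
  (forall z, ~ K z -> exists d, 0 < d /\ forall z', Cmod (z' - z)%C < d -> ~ K z') ->
  (forall z, K z -> ccont g z) ->
  (forall z, K z -> Cmod (g z) <= M \/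
     exists r, 0 < r /\ (forall z', Cmod (z' - z)%C < r -> K z') /\
       forall z', 0 < Cmod (z' - z)%C < r -> exists l, is_cderiv g z' l) ->
  forall z, K z -> Cmod (g z) <= M.
Proof.
  intros HM Hbd Hcl Hcont Hint z0 H0.
  destruct (Rle_lt_dec (Cmod (g z0)) M) as [H|Hlt]; [exact H|exfalso].
  assert (HR0 : 0 <= R0) by (pose proof (Hbd z0 H0); pose proof (Cmod_ge_0 z0); lra).
  (* So small that [e |z|^2] stays below the gap on all of [K]; hence the maximum is not at a point
     where [|g| <= M]. *)
  pose (e := (Cmod (g z0) ^ 2 - M ^ 2) / (2 * (R0 ^ 2 + 1))).
  assert (Hgap : 0 < Cmod (g z0) ^ 2 - M ^ 2) by nra.
  assert (HR2 : 0 <= R0 ^ 2) by nra.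
  assert (He : 0 < e) by (apply Rdiv_lt_0_compat; lra).
  assert (HeR : e * R0 ^ 2 < Cmod (g z0) ^ 2 - M ^ 2).
  { unfold e. apply (Rmult_lt_reg_r (2 * (R0 ^ 2 + 1))); [lra|].
    field_simplify; [|lra]. nra. }
  pose (V := fun x y : R => Cmod (g (x, y)) ^ 2 + e * Cmod (x, y) ^ 2).
  assert (Hsub : forall x y u v d, Rabs (u - x) < d / 2 -> Rabs (v - y) < d / 2 ->
     Cmod ((u, v) - (x, y))%C < d).
  { intros x y u v d Hu Hv. eapply Rle_lt_trans; [apply Cmod_le_Rabs_sum|]. simpl.
    unfold Rminus in *. lra. }
  destruct z0 as [x0 y0].
  destruct (usc_max (fun x y => K (x, y)) V (- R0) (- R0) (2 * R0) (2 * R0) x0 y0)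
    as (px & py & Hp & Hmax); [| | |exact H0|].
  { intros x y Hxy. specialize (Hbd _ Hxy).
    pose proof (Re_le_Cmod (x, y)) as T1. pose proof (Im_le_Cmod (x, y)) as T2. simpl in T1, T2.
    split; [clear T2; rename T1 into T|clear T1; rename T2 into T];
      assert (T' := Rle_trans _ _ _ T Hbd); apply Rabs_le_between in T'; lra. }
  { intros x y Hxy. destruct (Hcl _ Hxy) as [d [Hd H]]. exists (d / 2). split; [lra|].
    intros u v Hu Hv. apply H. now apply Hsub. }
  { intros x y eps Hxy Heps.
    destruct (ccont_Cmod_sq g (x, y) (eps / 2) (Hcont _ Hxy) ltac:(lra)) as [d1 [Hd1 H1]].
    destruct (ccont_Cmod_sq (fun z => z) (x, y) (eps / (2 * e))
      (is_cderiv_cont _ _ _ (is_cderiv_id _))) as [d2 [Hd2 H2]];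
      [apply Rdiv_lt_0_compat; lra|].
    exists (Rmin d1 d2 / 2). split; [assert (0 < Rmin d1 d2) by (now apply Rmin_pos); lra|].
    intros u v Hu Hv _. assert (T := Hsub _ _ _ _ _ Hu Hv).
    specialize (H1 (u, v) (Rlt_le_trans _ _ _ T (Rmin_l _ _))).
    specialize (H2 (u, v) (Rlt_le_trans _ _ _ T (Rmin_r _ _))).
    unfold V. apply (Rmult_lt_compat_l e) in H2; [|exact He].
    rewrite Rmult_plus_distr_l in H2.
    replace (e * (eps / (2 * e))) with (eps / 2) in H2 by (field; lra). lra. }
  set (p := (px, py)) in *.
  assert (HV0 := Hmax x0 y0 H0). unfold V in HV0. fold p in HV0.
  assert (Pz0 : 0 <= e * Cmod (x0, y0) ^ 2) by (apply Rmult_le_pos; [lra|apply pow2_ge_0]).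
  destruct (Hint p Hp) as [Hb|(r & Hr & HrK & Hder)].
  - assert (Cmod (g p) ^ 2 <= M ^ 2).
    { apply pow_incr. split; [apply Cmod_ge_0|exact Hb]. }
    assert (e * Cmod p ^ 2 <= e * R0 ^ 2).
    { apply Rmult_le_compat_l; [lra|]. apply pow_incr. split; [apply Cmod_ge_0|now apply Hbd]. }
    lra.
  - apply (no_local_max (fun z => 2 * Cconj (g p) * g z)%C p r (2 * e * px) (2 * e * py) e e);
      [exact Hr|lra| | |].
    + intros z Hz. destruct (Hder z Hz) as [l Hl]. eexists.
      apply is_cderiv_mult; [apply is_cderiv_const|exact Hl].
    + apply ccont_mult; [apply ccont_const|now apply Hcont].
    + intros [x y] Hz. assert (T := Hmax x y (HrK _ Hz)). unfold V in T. fold p in T.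
      rewrite !Cmod_sq in T. unfold p in *. destruct (g (x, y)) as [a b].
      destruct (g (px, py)) as [a' b']. simpl in *.
      pose proof (pow2_ge_0 (a - a')). pose proof (pow2_ge_0 (b - b')). nra.
Qed.

(** Converts between the pseudo-hyperbolic quotient [|z - w| / |z - conj w|] and
    [|z - w|^2 / (Im z Im w)]. *)
Lemma Cmod_minus_conj_sq (z w : C) :
  Cmod (z - Cconj w)%C ^ 2 = Cmod (z - w)%C ^ 2 + 4 * Im z * Im w.
Proof. rewrite !Cmod_sq. destruct z, w; simpl. ring. Qed.

Lemma minus_conj_neq_0 (z w : C) : 0 < Im z -> 0 < Im w -> (z - Cconj w)%C <> 0.
Proof.
  intros Hz Hw H. apply (f_equal Im) in H. destruct z, w; simpl in *. lra.
Qed.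

Lemma is_cderiv_diff_quotient (f : C -> C) (w z l : C) :
  z <> w -> is_cderiv f z l ->
  exists m, is_cderiv (fun z => (f z - f w) * / (z - w))%C z m.
Proof.
  intros Hzw Hf. eexists. apply is_cderiv_mult.
  - apply is_cderiv_plus; [exact Hf|apply is_cderiv_const].
  - apply is_cderiv_inv.
    + apply is_cderiv_plus; [apply is_cderiv_id|apply is_cderiv_const].
    + now apply Cminus_eq_contra.
Qed.

Lemma le_of_sq_le (a b : R) : 0 <= b -> a ^ 2 <= b ^ 2 -> a <= b.
Proof. intros Hb H. nra. Qed.

(** The maximum principle is applied to the quotient of the pseudo-hyperbolic expressions of
    [f z, f w] and [z, w] on the disc of pseudo-hyperbolic radius [rho] about [w]. On its boundary
    the numerator is at most 1 and the denominator is [rho], whence the loss [rho], to be removed by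
    letting it tend to 1. *)
Lemma schwarz_pick_disc (f : C -> C) (w : C) (rho : R) :
  (forall z, inH z -> exists l, is_cderiv f z l) -> (forall z, inH z -> inH (f z)) ->
  inH w -> 0 < rho < 1 ->
  forall z, Cmod (z - w)%C <= rho * Cmod (z - Cconj w)%C ->
    rho * (Cmod (f z - f w)%C * Cmod (z - Cconj w)%C)
      <= Cmod (z - w)%C * Cmod (f z - Cconj (f w))%C.
Proof.
  intros Hhol Hself Hw Hrho. unfold inH in *.
  destruct (Hhol w Hw) as [l Hl].
  pose (q := fun z => if excluded_middle_informative (z = w) then l
                      else ((f z - f w) * / (z - w))%C).
  pose (r := fun z => ((z - Cconj w) * / (f z - Cconj (f w)))%C).
  pose (g := fun z => (q z * r z)%C).
  pose (K := fun z => Cmod (z - w)%C <= rho * Cmod (z - Cconj w)%C).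
  assert (KH : forall z, K z -> 0 < Im z).
  { intros z Hz. unfold K in Hz. apply Rnot_le_lt. intros Hle.
    assert (H2 : Cmod (z - Cconj w)%C ^ 2 <= Cmod (z - w)%C ^ 2).
    { rewrite Cmod_minus_conj_sq. nra. }
    pose proof (Cmod_ge_0 (z - w)%C). pose proof (Cmod_ge_0 (z - Cconj w)%C).
    assert (H3 : Cmod (z - Cconj w)%C <= Cmod (z - w)%C) by nra.
    assert (H4 : Cmod (z - Cconj w)%C = 0) by nra.
    assert (H5 : Cmod (z - w)%C = 0) by nra.
    apply Cmod_eq_0 in H4. apply Cmod_eq_0 in H5.
    apply (f_equal Im) in H4. apply (f_equal Im) in H5. destruct z, w; simpl in *. lra. }
  assert (Hr : forall z, 0 < Im z -> exists m, is_cderiv r z m).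
  { intros z Hz. destruct (Hhol z Hz) as [m Hm]. eexists. unfold r. apply is_cderiv_mult.
    - apply is_cderiv_plus; [apply is_cderiv_id|apply is_cderiv_const].
    - apply is_cderiv_inv.
      + apply is_cderiv_plus; [exact Hm|apply is_cderiv_const].
      + now apply minus_conj_neq_0; apply Hself. }
  assert (Hqz : forall z, 0 < Im z -> z <> w -> exists m, is_cderiv q z m).
  { intros z Hz Hzw. destruct (Hhol z Hz) as [m Hm].
    destruct (is_cderiv_diff_quotient f w z m Hzw Hm) as [m' Hm'].
    exists m'. apply is_cderiv_ext_loc with (3 := Hm') (r := Cmod (z - w)%C).
    - apply Cmod_gt_0. now apply Cminus_eq_contra.
    - intros v Hv. unfold q. destruct (excluded_middle_informative (v = w)) as [->|]; [|reflexivity].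
      replace (w - z)%C with (- (z - w))%C in Hv by ring. rewrite Cmod_opp in Hv. lra. }
  assert (Hqw : ccont q w).
  { intros eps Heps. destruct (Hl (eps / 2) ltac:(lra)) as [d [Hd H]].
    exists d. split; [exact Hd|]. intros v Hv. unfold q.
    destruct (excluded_middle_informative (w = w)) as [_|C]; [|tauto].
    destruct (excluded_middle_informative (v = w)) as [_|C].
    - replace (l - l)%C with (RtoC 0) by ring. now rewrite Cmod_0.
    - assert (Hne : (v - w)%C <> 0) by now apply Cminus_eq_contra.
      assert (Hpos := proj1 (Cmod_gt_0 _) Hne).
      replace ((f v - f w) * / (v - w) - l)%C
        with ((f v - f w - l * (v - w)) / (v - w))%C by (field; exact Hne).
      rewrite Cmod_div by exact Hne.
      apply (Rmult_lt_reg_r (Cmod (v - w))); [exact Hpos|].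
      unfold Rdiv. rewrite Rmult_assoc, Rinv_l, Rmult_1_r by lra.
      specialize (H v Hv). nra. }
  assert (Hg : forall z, K z -> Cmod (g z) <= / rho).
  (* For [s = |z - w| > Im w] one has [Im z <= 2 s], so [(1 - rho) s^2 <= 4 Im z Im w] gives
     [s <= 8 Im w / (1 - rho)]. *)
  { apply max_modulus with (R0 := 8 * Im w / (1 - rho) + Cmod w).
    - left. apply Rinv_0_lt_compat. lra.
    - intros z Hz. assert (Hz' := KH z Hz). unfold K in Hz.
      replace z with ((z - w) + w)%C at 1 by ring.
      eapply Rle_trans; [apply Cmod_triangle|]. apply Rplus_le_compat_r.
      pose proof (Cmod_ge_0 (z - w)%C) as P1. pose proof (Cmod_ge_0 (z - Cconj w)%C) as P2.
      pose proof (Im_le_Cmod (z - w)%C) as P3. apply Rabs_le_between in P3.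
      assert (P4 : Im (z - w)%C = Im z - Im w) by (destruct z, w; reflexivity).
      rewrite P4 in P3.
      assert (P5 : Cmod (z - w) ^ 2 <= rho ^ 2 * (Cmod (z - w)%C ^ 2 + 4 * Im z * Im w)).
      { rewrite <- Cmod_minus_conj_sq. rewrite <- Rpow_mult_distr.
        apply pow_incr. now split. }
      set (s := Cmod (z - w)) in *.
      apply (Rmult_le_reg_r (1 - rho)); [lra|].
      unfold Rdiv. rewrite Rmult_assoc, Rinv_l, Rmult_1_r by lra.
      destruct (Rle_lt_dec s (Im w)) as [Hs|Hs]; [nra|].
      assert (P6 : (1 - rho) * s ^ 2 <= 4 * Im z * Im w).
      { assert (0 <= Im z * Im w) by nra. assert (0 <= s ^ 2) by nra.
        assert (rho ^ 2 <= rho) by nra. nra. }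
      assert (P7 : 4 * Im z * Im w <= 8 * s * Im w) by nra.
      apply (Rmult_le_reg_r s); [lra|]. nra.
    - intros z Hz. unfold K in *.
      exists ((Cmod (z - w) - rho * Cmod (z - Cconj w)) / 2). split; [lra|].
      intros v Hv.
      pose proof (Cmod_rev_triangle (z - w) (v - w)) as T1.
      pose proof (Cmod_rev_triangle (v - Cconj w) (z - Cconj w)) as T2.
      replace (z - w - (v - w))%C with (- (v - z))%C in T1 by ring. rewrite Cmod_opp in T1.
      replace (v - Cconj w - (z - Cconj w))%C with (v - z)%C in T2 by ring.
      apply Rabs_le_between in T1. apply Rabs_le_between in T2. nra.
    - intros z Hz. assert (Hz' := KH z Hz). apply ccont_mult.
      + destruct (excluded_middle_informative (z = w)) as [->|Hne]; [exact Hqw|].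
        destruct (Hqz z Hz' Hne) as [m Hm]. exact (is_cderiv_cont _ _ _ Hm).
      + destruct (Hr z Hz') as [m Hm]. exact (is_cderiv_cont _ _ _ Hm).
    - intros z Hz. assert (Hz' := KH z Hz). unfold K in Hz.
      destruct (Rle_lt_or_eq_dec _ _ Hz) as [Hlt|Heq].
      + right. exists (Rmin ((rho * Cmod (z - Cconj w) - Cmod (z - w)) / 2)
          (if excluded_middle_informative (z = w) then 1 else Cmod (z - w)%C)).
        assert (HKz : forall v, Cmod (v - z) < (rho * Cmod (z - Cconj w) - Cmod (z - w)) / 2 -> K v).
        { intros v Hv. unfold K.
          pose proof (Cmod_rev_triangle (v - w) (z - w)) as T1.
          pose proof (Cmod_rev_triangle (z - Cconj w) (v - Cconj w)) as T2.
          replace (v - w - (z - w))%C with (v - z)%C in T1 by ring.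
          replace (z - Cconj w - (v - Cconj w))%C with (- (v - z))%C in T2 by ring.
          rewrite Cmod_opp in T2.
          apply Rabs_le_between in T1. apply Rabs_le_between in T2. nra. }
        split; [|split].
        * apply Rmin_pos; [lra|].
          destruct (excluded_middle_informative (z = w)) as [|Hne]; [lra|].
          apply Cmod_gt_0. now apply Cminus_eq_contra.
        * intros v Hv. apply HKz. eapply Rlt_le_trans; [exact Hv|apply Rmin_l].
        * intros v [Hv0 Hv].
          assert (Hvw : v <> w).
          { intros ->. assert (Hv2 := Rlt_le_trans _ _ _ Hv (Rmin_r _ _)).
            destruct (excluded_middle_informative (z = w)) as [->|Hne].
            - replace (w - w)%C with (RtoC 0) in Hv0 by ring. rewrite Cmod_0 in Hv0. lra.
            - replace (w - z)%C with (- (z - w))%C in Hv2 by ring. rewrite Cmod_opp in Hv2. lra. }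
          assert (Hvi : 0 < Im v).
          { apply KH, HKz. eapply Rlt_le_trans; [exact Hv|apply Rmin_l]. }
          destruct (Hqz v Hvi Hvw) as [m1 M1]. destruct (Hr v Hvi) as [m2 M2].
          eexists. apply is_cderiv_mult; eassumption.
      + left.
        assert (Hcj : 0 < Cmod (z - Cconj w)).
        { apply Cmod_gt_0. now apply minus_conj_neq_0. }
        assert (Hzw : z <> w).
        { intros ->. replace (w - w)%C with (RtoC 0) in Heq by ring.
          rewrite Cmod_0 in Heq. nra. }
        assert (Hne : (z - w)%C <> 0) by now apply Cminus_eq_contra.
        assert (Hf0 := minus_conj_neq_0 (f z) (f w) (Hself z Hz') (Hself w Hw)).
        unfold g, q, r. destruct (excluded_middle_informative (z = w)) as [|_]; [tauto|].
        rewrite !Cmod_mult, !Cmod_inv by assumption. rewrite Heq.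
        assert (Hff : Cmod (f z - f w) <= Cmod (f z - Cconj (f w))).
        { apply le_of_sq_le; [apply Cmod_ge_0|]. rewrite Cmod_minus_conj_sq.
          pose proof (Hself z Hz'). pose proof (Hself w Hw). nra. }
        assert (Hcf := proj1 (Cmod_gt_0 _) Hf0).
        replace (Cmod (f z - f w) * / (rho * Cmod (z - Cconj w)) *
          (Cmod (z - Cconj w) * / Cmod (f z - Cconj (f w))))
          with (/ rho * (Cmod (f z - f w) / Cmod (f z - Cconj (f w)))) by (field; lra).
        rewrite <- (Rmult_1_r (/ rho)) at 2.
        apply Rmult_le_compat_l; [left; apply Rinv_0_lt_compat; lra|].
        apply (Rmult_le_reg_r (Cmod (f z - Cconj (f w)))); [exact Hcf|].
        unfold Rdiv. rewrite Rmult_assoc, Rinv_l; lra. }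
  intros z Hz. assert (HG := Hg z Hz). assert (Hz' := KH z Hz).
  destruct (excluded_middle_informative (z = w)) as [->|Hne].
  - replace (f w - f w)%C with (RtoC 0) by ring. rewrite Cmod_0, Rmult_0_l, Rmult_0_r.
    apply Rmult_le_pos; apply Cmod_ge_0.
  - assert (Hzw : (z - w)%C <> 0) by now apply Cminus_eq_contra.
    assert (Hf0 := minus_conj_neq_0 (f z) (f w) (Hself z Hz') (Hself w Hw)).
    unfold g, q, r in HG. destruct (excluded_middle_informative (z = w)) as [|_]; [tauto|].
    rewrite !Cmod_mult, !Cmod_inv in HG by assumption.
    apply Cmod_gt_0 in Hzw. apply Cmod_gt_0 in Hf0.
    apply (Rmult_le_compat_r (rho * (Cmod (z - w) * Cmod (f z - Cconj (f w))))) in HG;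
      [|apply Rmult_le_pos; [lra|apply Rmult_le_pos; lra]].
    replace (/ rho * (rho * (Cmod (z - w) * Cmod (f z - Cconj (f w)))))
      with (Cmod (z - w) * Cmod (f z - Cconj (f w))) in HG by (field; lra).
    eapply Rle_trans; [|exact HG]. right. field. lra.
Qed.

(* The inequality [d (f z) (f w) <= d z w] of hyperbolic distances, with [|z - w|^2 / (Im z Im w)]
   as the monotone substitute for the distance. *)
Lemma schwarz_pick (f : C -> C) :
  (forall z, inH z -> exists l, is_cderiv f z l) -> (forall z, inH z -> 0 <= Im (f z)) ->
  forall z w, inH z -> inH w ->
    Cmod (f z - f w)%C ^ 2 * (Im z * Im w) <= Cmod (z - w)%C ^ 2 * (Im (f z) * Im (f w)).
Proof.
  intros Hhol Hself z w Hz Hw.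
  assert (strict : forall f : C -> C, (forall z, inH z -> exists l, is_cderiv f z l) ->
    (forall z, inH z -> inH (f z)) ->
    Cmod (f z - f w)%C ^ 2 * (Im z * Im w) <= Cmod (z - w)%C ^ 2 * (Im (f z) * Im (f w))).
  { clear f Hhol Hself. intros f Hhol Hself.
    assert (Hlim : Cmod (f z - f w) * Cmod (z - Cconj w) <= Cmod (z - w) * Cmod (f z - Cconj (f w))).
    { set (X := Cmod (f z - f w) * Cmod (z - Cconj w)).
      set (Y := Cmod (z - w) * Cmod (f z - Cconj (f w))).
      apply Rnot_lt_le. intros Hlt.
      assert (PY : 0 <= Y) by (apply Rmult_le_pos; apply Cmod_ge_0).
      assert (Hd : Cmod (z - w) < Cmod (z - Cconj w)).
      { assert (Cmod (z - w) ^ 2 < Cmod (z - Cconj w) ^ 2).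
        { rewrite Cmod_minus_conj_sq. unfold inH in *. nra. }
        pose proof (Cmod_ge_0 (z - w)). pose proof (Cmod_ge_0 (z - Cconj w)). nra. }
      set (a := Cmod (z - w)) in *. set (b := Cmod (z - Cconj w)) in *.
      assert (Pa : 0 <= a) by apply Cmod_ge_0.
      (* The first bound puts [z] in the disc of radius [rho]; the second makes [rho] exceed
         [Y / X], contradicting [rho * X <= Y]. *)
      pose (rho := Rmax (a / b) ((1 + Y / X) / 2)).
      assert (HYX : Y / X < 1).
      { apply (Rmult_lt_reg_r X); [lra|]. unfold Rdiv. rewrite Rmult_assoc, Rinv_l; lra. }
      assert (HYX0 : 0 <= Y / X) by (apply Rdiv_le_0_compat; lra).
      assert (Hab : a / b < 1).
      { apply (Rmult_lt_reg_r b); [lra|]. unfold Rdiv. rewrite Rmult_assoc, Rinv_l; lra. }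
      assert (R1 : a / b <= rho) by apply Rmax_l.
      assert (R2 : (1 + Y / X) / 2 <= rho) by apply Rmax_r.
      assert (R3 : rho < 1) by (apply Rmax_lub_lt; lra).
      assert (HS := schwarz_pick_disc f w rho Hhol Hself Hw ltac:(lra) z).
      fold a b X Y in HS.
      assert (a <= rho * b).
      { apply (Rmult_le_compat_r b) in R1; [|lra].
        unfold Rdiv in R1. rewrite Rmult_assoc, Rinv_l in R1; lra. }
      specialize (HS ltac:(assumption)).
      assert (Y / X * X = Y) by (field; lra). nra. }
    assert (Hsq : (Cmod (f z - f w) * Cmod (z - Cconj w)) ^ 2
        <= (Cmod (z - w) * Cmod (f z - Cconj (f w))) ^ 2).
    { apply pow_incr. split; [apply Rmult_le_pos; apply Cmod_ge_0|exact Hlim]. }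
    rewrite !Rpow_mult_distr, !Cmod_minus_conj_sq in Hsq. lra. }
  pose (A := Cmod (z - w) ^ 2). pose (X := Cmod (f z - f w) ^ 2 * (Im z * Im w)).
  assert (PA : 0 <= A) by apply pow2_ge_0.
  pose proof (Hself z Hz) as P1. pose proof (Hself w Hw) as P2.
  apply Rnot_lt_le. intros Hlt. fold X A in Hlt.
  pose (c := A * (Im (f z) + Im (f w) + 1)).
  assert (Pc : 0 <= c) by (apply Rmult_le_pos; lra).
  (* When [Im f] may vanish, the strict case is applied to [f + i e]. For [e <= 1] the right side
     grows by at most [c * e], which this choice keeps below the assumed gap. *)
  pose (e := Rmin 1 ((X - A * (Im (f z) * Im (f w))) / (c + 1))).
  assert (He : 0 < e) by (apply Rmin_pos; [lra|apply Rdiv_lt_0_compat; lra]).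
  assert (He1 : e <= 1) by apply Rmin_l.
  assert (He2 : e <= (X - A * (Im (f z) * Im (f w))) / (c + 1)) by apply Rmin_r.
  apply (Rmult_le_compat_r (c + 1)) in He2; [|lra].
  unfold Rdiv in He2. rewrite Rmult_assoc, Rinv_l, Rmult_1_r in He2 by lra.
  assert (HS := strict (fun v => f v + (0, e))%C).
  simpl in HS. replace (f z + (0, e) - (f w + (0, e)))%C with (f z - f w)%C in HS by ring.
  fold X A in HS.
  assert (X <= A * ((Im (f z) + e) * (Im (f w) + e))).
  { apply HS.
    - intros v Hv. destruct (Hhol v Hv) as [l Hl]. eexists.
      apply is_cderiv_plus; [exact Hl|apply is_cderiv_const].
    - intros v Hv. pose proof (Hself v Hv). change (0 < Im (f v) + e). lra. }
  unfold c in *. nra.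
Qed.

(** * Angular limits *)

Lemma inH_Cmod_pos (z : C) : inH z -> 0 < Cmod z.
Proof.
  unfold inH. intros Hz. pose proof (Im_le_Cmod z) as H. apply Rabs_le_between in H. lra.
Qed.

Lemma inH_cos_argH (z : C) : inH z ->
  0 <= argH z <= PI /\ Re z = Cmod z * cos (argH z) /\ Im z = Cmod z * sin (argH z).
Proof.
  intros Hz. assert (Hp := inH_Cmod_pos z Hz). unfold argH.
  pose proof (Re_le_Cmod z) as H. apply Rabs_le_between in H.
  assert (Hu : -1 <= Re z / Cmod z <= 1).
  { split; apply (Rmult_le_reg_r (Cmod z)); try exact Hp;
      unfold Rdiv; rewrite Rmult_assoc, Rinv_l; lra. }
  split; [apply acos_bound|]. rewrite cos_acos, sin_acos by exact Hu.
  split; [field; lra|].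
  apply Rsqr_inj.
  - unfold inH in Hz. lra.
  - apply Rmult_le_pos; [lra|apply sqrt_pos].
  - rewrite Rsqr_mult, Rsqr_sqrt.
    + pose proof (Cmod_sq z) as S. unfold Rsqr.
      transitivity (Cmod z ^ 2 - Re z ^ 2); [rewrite S; ring|]. field. lra.
    + unfold Rsqr. nra.
Qed.

Lemma sector_stolz (th : R) (z : C) : 0 < th < PI / 2 -> sector th z ->
  cos th * Cmod z <= Im z.
Proof.
  intros Hth [Hz Ha]. destruct (inH_cos_argH z Hz) as (H1 & H2 & H3).
  assert (Hp := inH_Cmod_pos z Hz). apply Rabs_def2 in Ha. rewrite H3, Rmult_comm.
  apply Rmult_le_compat_l; [lra|].
  replace (sin (argH z)) with (cos (argH z - PI / 2)).
  - destruct (Rle_lt_dec 0 (argH z - PI / 2)).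
    + apply cos_decr_1; lra.
    + rewrite <- (cos_neg (argH z - PI / 2)). apply cos_decr_1; lra.
  - rewrite <- cos_neg, Ropp_minus_distr. apply cos_shift.
Qed.

Lemma stolz_sector (k : R) : exists th, 0 < th < PI / 2 /\
  forall z, inH z -> Cmod z <= k * Im z -> sector th z.
Proof.
  (* [k] is an arbitrary real; [m >= 1] puts the cosine [c] in [(0, 1)], and the factor 2 in [c]
     makes the sector inequality strict. *)
  pose (m := Rmax 1 k).
  assert (Hm1 : 1 <= m) by apply Rmax_l. assert (Hm2 : k <= m) by apply Rmax_r.
  pose (c := / (2 * m)).
  assert (Hc0 : 0 < c) by (apply Rinv_0_lt_compat; lra).
  assert (Hc1 : c * m = / 2) by (unfold c; field; lra).
  assert (Hc : c < 1) by nra.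
  exists (acos c). pose proof (acos_bound c) as Hb. pose proof PI_RGT_0.
  assert (Hcos : cos (acos c) = c) by (apply cos_acos; lra).
  assert (Hpos : 0 < acos c).
  { apply Rnot_le_lt. intros Hle. replace (acos c) with 0 in Hcos by lra.
    rewrite cos_0 in Hcos. lra. }
  split; [split; [exact Hpos|]|].
  - apply cos_decreasing_0; try lra. rewrite cos_PI2, Hcos. exact Hc0.
  - intros z Hz Hk. split; [exact Hz|].
    destruct (inH_cos_argH z Hz) as (H1 & H2 & H3).
    assert (Hp := inH_Cmod_pos z Hz).
    assert (Hs : c < cos (argH z - PI / 2)).
    { replace (cos (argH z - PI / 2)) with (sin (argH z))
        by (rewrite <- cos_neg, Ropp_minus_distr; symmetry; apply cos_shift).
      assert (Hm : Cmod z <= m * Im z).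
      { eapply Rle_trans; [exact Hk|]. apply Rmult_le_compat_r; [|exact Hm2].
        unfold inH in Hz. lra. }
      rewrite H3 in Hm.
      assert (1 <= m * sin (argH z)) by (apply (Rmult_le_reg_l (Cmod z)); lra).
      nra. }
    rewrite <- Hcos in Hs. apply Rabs_def1.
    + destruct (Rle_lt_dec 0 (argH z - PI / 2)); [|lra].
      apply cos_decreasing_0; lra.
    + destruct (Rle_lt_dec 0 (argH z - PI / 2)); [lra|].
      rewrite <- (cos_neg (argH z - PI / 2)) in Hs.
      assert (- (argH z - PI / 2) < acos c) by (apply cos_decreasing_0; lra). lra.
Qed.

(** Stolz angles written as [|z| <= k Im z], which suits the metric estimates better than the
    argument. *)
Definition stolz_lim (f : C -> C) (l : C) : Prop :=
  forall k eps, 0 < eps -> exists M, forall z, inH z -> Cmod z <= k * Im z -> M < Cmod z ->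
    Cmod (f z - l)%C < eps.

Lemma ang_lim_stolz (f : C -> C) (l : C) : ang_lim_infty f l <-> stolz_lim f l.
Proof.
  split.
  - intros H k eps Heps. destruct (stolz_sector k) as (th & Hth & Hs).
    destruct (H th Hth eps Heps) as [M HM]. exists M. intros z Hz Hk. auto.
  - intros H th Hth eps Heps.
    assert (Hc : 0 < cos th) by (apply cos_gt_0; lra).
    destruct (H (/ cos th) eps Heps) as [M HM]. exists M. intros z Hz HMz.
    assert (Hs := sector_stolz th z Hth Hz). destruct Hz as [Hz _].
    apply HM; [exact Hz| |exact HMz].
    apply (Rmult_le_reg_l (cos th)); [exact Hc|].
    rewrite <- Rmult_assoc, Rinv_r; lra.
Qed.

(* Subtracting [c z] with the best constant [c] leaves a function with nonnegative imaginary
   part to which Schwarz-Pick applies; it compares any point with one where [Im F / Im z] is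
   almost minimal. *)
Lemma julia_wolff_caratheodory (F : C -> C) :
  (forall z, inH z -> exists l, is_cderiv F z l) -> (forall z, inH z -> inH (F z)) ->
  exists c, 0 <= c /\ forall k eps, 0 < eps -> exists M, forall z,
    inH z -> Cmod z <= k * Im z -> M < Cmod z -> Cmod (F z - c * z)%C <= eps * Cmod z.
Proof.
  intros Hhol Hself. unfold inH in *.
  (* The angular derivative is the infimum of [Im F / Im z]; it is obtained as minus a supremum, so
     here [c <= 0]. *)
  destruct (completeness (fun v => exists z, 0 < Im z /\ v = - (Im (F z) / Im z))) as [c [Hc1 Hc2]].
  { exists 0. intros v (z & Hz & ->). pose proof (Hself z Hz).
    assert (0 < Im (F z) / Im z) by now apply Rdiv_lt_0_compat. lra. }
  { exists (- (Im (F Ci) / Im Ci)). exists Ci. split; [simpl; lra|reflexivity]. }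
  assert (Hc : c <= 0).
  { apply Hc2. intros v (z & Hz & ->). pose proof (Hself z Hz).
    assert (0 < Im (F z) / Im z) by now apply Rdiv_lt_0_compat. lra. }
  exists (- c). split; [lra|].
  pose (F0 := fun z => (F z + RtoC c * z)%C).
  assert (ImF0 : forall z, Im (F0 z) = Im (F z) + c * Im z).
  { intros z. unfold F0. destruct (F z), z. simpl. ring. }
  assert (F0pos : forall z, 0 < Im z -> 0 <= Im (F0 z)).
  { intros z Hz. rewrite ImF0.
    assert (- (Im (F z) / Im z) <= c) by (apply Hc1; now exists z).
    assert (Im (F z) = Im (F z) / Im z * Im z) by (field; lra). nra. }
  assert (F0hol : forall z, 0 < Im z -> exists l, is_cderiv F0 z l).
  { intros z Hz. destruct (Hhol z Hz) as [l Hl]. eexists. apply is_cderiv_plus; [exact Hl|].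
    apply is_cderiv_mult; [apply is_cderiv_const|apply is_cderiv_id]. }
  assert (F0small : forall e, 0 < e -> exists w, 0 < Im w /\ Im (F0 w) <= e * Im w).
  { intros e He. apply NNPP. intros Hno.
    assert (c <= c - e); [|lra]. apply Hc2. intros v (z & Hz & ->).
    apply Rnot_lt_le. intros Hlt. apply Hno. exists z. split; [exact Hz|]. rewrite ImF0.
    assert (Im (F z) = Im (F z) / Im z * Im z) by (field; lra). nra. }
  intros k0 eps Heps.
  pose (k := Rmax 1 k0).
  assert (Hk1 : 1 <= k) by apply Rmax_l. assert (Hk0 : k0 <= k) by apply Rmax_r.
  (* The final estimate is [A <= (8 k + 1) e |z|] together with [|F0 w| <= e |z|]. *)
  pose (e := eps / (8 * k + 2)).
  assert (He : 0 < e) by (apply Rdiv_lt_0_compat; lra).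
  assert (Hee : eps = (8 * k + 2) * e) by (unfold e; field; lra).
  destruct (F0small e He) as [w [Hw Hwe]].
  exists (Cmod w + Cmod (F0 w) / e).
  intros z Hz Hkz HM.
  replace (F z - RtoC (- c) * z)%C with (F0 z)
    by (unfold F0; rewrite RtoC_opp; ring).
  assert (P1 : 0 <= Cmod (F0 w) / e).
  { apply Rdiv_le_0_compat; [apply Cmod_ge_0|exact He]. }
  pose proof (Cmod_ge_0 w) as P2.
  assert (P3 : Cmod (F0 w) <= e * Cmod z).
  { apply Rle_trans with (e * (Cmod (F0 w) / e)); [right; field; lra|].
    apply Rmult_le_compat_l; lra. }
  assert (P4 : Im w <= Cmod z).
  { pose proof (Im_le_Cmod w) as T. apply Rabs_le_between in T. lra. }
  assert (SP := schwarz_pick F0 F0hol F0pos z w Hz Hw).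
  set (A := Cmod (F0 z - F0 w)) in *.
  assert (PA : 0 <= A) by apply Cmod_ge_0.
  assert (Htri : Cmod (F0 z) <= A + Cmod (F0 w)).
  { replace (F0 z) with ((F0 z - F0 w) + F0 w)%C at 1 by ring. apply Cmod_triangle. }
  assert (HIm : Im (F0 z) <= A + Im (F0 w)).
  { pose proof (Im_le_Cmod (F0 z - F0 w)%C) as T. apply Rabs_le_between in T. fold A in T.
    replace (Im (F0 z - F0 w)%C) with (Im (F0 z) - Im (F0 w)) in T
      by (destruct (F0 z), (F0 w); reflexivity). lra. }
  assert (Hzw : Cmod (z - w) <= 2 * Cmod z).
  { eapply Rle_trans; [apply Cmod_triangle|]. rewrite Cmod_opp. lra. }
  assert (Pzw := Cmod_ge_0 (z - w)).
  assert (Hkz' : Cmod z <= k * Im z) by nra.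
  pose proof (F0pos w Hw) as PFw. pose proof (F0pos z Hz) as PFz.
  set (r := Cmod z) in *. set (y := Im z) in *. set (v := Im w) in *.
  assert (Hsq : Cmod (z - w) ^ 2 <= 4 * r * (k * y)).
  { apply Rle_trans with ((2 * r) ^ 2); [apply pow_incr; lra|].
    assert (0 <= r) by lra. nra. }
  assert (Hmain : A ^ 2 * (y * v) <= (4 * r * k * e * (A + e * v)) * (y * v)).
  { eapply Rle_trans; [exact SP|].
    apply Rle_trans with ((4 * r * (k * y)) * ((A + e * v) * (e * v))).
    - apply Rmult_le_compat; [apply pow2_ge_0| |exact Hsq|].
      + now apply Rmult_le_pos.
      + apply Rmult_le_compat; lra.
    - right. ring. }
  apply Rmult_le_reg_r in Hmain; [|now apply Rmult_lt_0_compat].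
  assert (HA : A <= (8 * k + 1) * e * r).
  (* Otherwise [A >= e v], so the Schwarz-Pick bound [A^2 <= 4 r k e (A + e v)] becomes
     [A <= 8 k e r]. *)
  { apply Rnot_lt_le. intros Hlt.
    assert (Hr : 0 <= r) by lra.
    assert (K1 : 0 <= k * e * r) by (apply Rmult_le_pos; [apply Rmult_le_pos|]; lra).
    assert (K2 : e * v <= e * r) by (apply Rmult_le_compat_l; lra).
    assert (K3 : 0 <= e * r) by nra.
    assert (K4 : e * v <= A) by lra.
    assert (K5 : A * A <= 8 * (k * e * r) * A) by nra.
    assert (K6 : A <= 8 * (k * e * r)) by (apply (Rmult_le_reg_r A); lra).
    lra. }
  rewrite Hee. lra.
Qed.

(** * Flows *)

Definition lim_0_right (f : R -> R) (l : R) : Prop :=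
  forall eps, 0 < eps -> exists d, 0 < d /\ forall t, 0 < t < d -> Rabs (f t - l) < eps.

Lemma is_derive_eps_cont (f : R -> R) (t l : R) : is_derive f t l ->
  forall eps, 0 < eps -> exists d, 0 < d /\ forall s, Rabs (s - t) < d -> Rabs (f s - f t) < eps.
Proof.
  intros H eps Heps.
  assert (Hc : continuous f t) by (apply (ex_derive_continuous (V := R_NormedModule)); now exists l).
  destruct (proj1 (filterlim_locally f (f t)) Hc (mkposreal eps Heps)) as [d Hd].
  exists d. split; [apply cond_pos|]. intros s Hs. exact (Hd s Hs).
Qed.

Lemma MVT_le (f f' : R -> R) (a b B : R) : a < b ->
  (forall t, a <= t <= b -> is_derive f t (f' t)) -> (forall t, a <= t <= b -> f' t <= B) ->
  f b - f a <= B * (b - a).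
Proof.
  intros Hab Hd HB. destruct (MVT_cor2 f f' a b Hab) as [c [Hc1 Hc2]].
  - intros c Hc. now apply is_derive_Reals, Hd.
  - rewrite Hc1. apply Rmult_le_compat_r; [lra|]. apply HB. lra.
Qed.

(** Orbits are differentiable only at positive times and reach their initial point as a right limit,
    so the mean value theorem is used on [[s, T]] with [s] small. *)
Lemma MVT_le_0 (f f' : R -> R) (f0 B T : R) : 0 < T -> lim_0_right f f0 ->
  (forall t, 0 < t <= T -> is_derive f t (f' t)) -> (forall t, 0 < t <= T -> f' t <= B) ->
  f T - f0 <= B * T.
Proof.
  intros HT H0 Hd HB. apply Rnot_lt_le. intros Hlt.
  pose (e := f T - f0 - B * T). assert (He : 0 < e) by (unfold e; lra).
  destruct (H0 (e / 2) ltac:(lra)) as [d [Hdp H]].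
  pose proof (Rabs_pos B) as PB.
  pose (s := Rmin (T / 2) (Rmin (d / 2) (e / (2 * (Rabs B + 1))))).
  assert (Hs : 0 < s).
  { repeat apply Rmin_pos; try lra. apply Rdiv_lt_0_compat; lra. }
  assert (Hs1 : s <= T / 2) by apply Rmin_l.
  assert (Hs2 : s <= d / 2) by (eapply Rle_trans; [apply Rmin_r|apply Rmin_l]).
  assert (Hs3 : s <= e / (2 * (Rabs B + 1))) by (eapply Rle_trans; [apply Rmin_r|apply Rmin_r]).
  apply (Rmult_le_compat_r (2 * (Rabs B + 1))) in Hs3; [|lra].
  unfold Rdiv in Hs3. rewrite Rmult_assoc, Rinv_l, Rmult_1_r in Hs3 by lra.
  specialize (H s ltac:(lra)). apply Rabs_def2 in H.
  assert (HM : f T - f s <= B * (T - s)).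
  { apply MVT_le with f'; [lra| |]; intros t Ht; [apply Hd|apply HB]; lra. }
  assert (- B * s <= Rabs B * s).
  { apply Rmult_le_compat_r; [lra|]. rewrite <- Rabs_Ropp. apply Rle_abs. }
  unfold e in *. lra.
Qed.

(** A bootstrap: while both functions stay below [m + 1] they decrease, so they stay at most [m] and
    never come near the barrier. The two are treated together because the sign condition needs both
    bounds. *)
Lemma trapped (f g f' g' : R -> R) (m : R) :
  lim_0_right f m -> lim_0_right g m ->
  (forall t, 0 < t -> is_derive f t (f' t)) -> (forall t, 0 < t -> is_derive g t (g' t)) ->
  (forall t, 0 < t -> f t < m + 1 -> g t < m + 1 -> f' t <= 0 /\ g' t <= 0) ->
  forall t, 0 < t -> f t <= m /\ g t <= m.
Proof.
  intros Hf0 Hg0 Hf Hg Hsgn t1 Ht1.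
  pose (E := fun t => t <= t1 /\ forall s, 0 < s <= t -> f s < m + 1 /\ g s < m + 1).
  destruct (Hf0 1 ltac:(lra)) as [d1 [Hd1 D1]]. destruct (Hg0 1 ltac:(lra)) as [d2 [Hd2 D2]].
  pose (e := Rmin t1 (Rmin d1 d2 / 2)).
  assert (Hmm : 0 < Rmin d1 d2) by now apply Rmin_pos.
  assert (He : 0 < e) by (apply Rmin_pos; lra).
  assert (He1 : e <= t1) by apply Rmin_l.
  assert (He2 : e <= Rmin d1 d2 / 2) by apply Rmin_r.
  pose proof (Rmin_l d1 d2). pose proof (Rmin_r d1 d2).
  assert (HEe : E e).
  { split; [exact He1|]. intros s Hs.
    specialize (D1 s ltac:(lra)). specialize (D2 s ltac:(lra)).
    apply Rabs_def2 in D1. apply Rabs_def2 in D2. lra. }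
  destruct (completeness E) as [T [HT1 HT2]].
  { exists t1. intros t [Ht _]. exact Ht. }
  { now exists e. }
  assert (HeT : e <= T) by now apply HT1.
  assert (HTt1 : T <= t1) by (apply HT2; intros t [Ht _]; exact Ht).
  assert (Hbelow : forall s, 0 < s < T -> f s < m + 1 /\ g s < m + 1).
  { intros s Hs. apply NNPP. intros Hno.
    assert (T <= s); [|lra]. apply HT2. intros t [_ Ht]. apply Rnot_lt_le. intros Hlt.
    apply Hno. apply Ht. lra. }
  assert (Hle : forall s, 0 < s < T -> f s <= m /\ g s <= m).
  { intros s Hs. split.
    - assert (f s - m <= 0 * s); [|lra].
      apply MVT_le_0 with f'; [lra|exact Hf0| |]; intros t Ht; [apply Hf; lra|].
      destruct (Hbelow t ltac:(lra)). apply Hsgn; lra.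
    - assert (g s - m <= 0 * s); [|lra].
      apply MVT_le_0 with g'; [lra|exact Hg0| |]; intros t Ht; [apply Hg; lra|].
      destruct (Hbelow t ltac:(lra)). apply Hsgn; lra. }
  assert (closed_at : forall u u' : R -> R, (forall t, 0 < t -> is_derive u t (u' t)) ->
     (forall s, 0 < s < T -> u s <= m) -> u T <= m).
  { intros u u' Hu Hus. apply Rnot_lt_le. intros Hlt.
    destruct (is_derive_eps_cont u T (u' T) (Hu T ltac:(lra)) (u T - m) ltac:(lra)) as [d [Hd HH]].
    pose (s := Rmax (T / 2) (T - d / 2)).
    assert (S1 : T / 2 <= s) by apply Rmax_l. assert (S2 : T - d / 2 <= s) by apply Rmax_r.
    assert (S3 : s < T) by (apply Rmax_lub_lt; lra).
    specialize (HH s ltac:(apply Rabs_def1; lra)). apply Rabs_def2 in HH.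
    specialize (Hus s ltac:(lra)). lra. }
  assert (HfT : f T <= m) by (apply (closed_at f f'); [exact Hf|]; intros s Hs; now apply Hle).
  assert (HgT : g T <= m) by (apply (closed_at g g'); [exact Hg|]; intros s Hs; now apply Hle).
  destruct (Rle_lt_or_eq_dec _ _ HTt1) as [Hlt| <-]; [exfalso|now split].
  destruct (is_derive_eps_cont f T _ (Hf T ltac:(lra)) 1 ltac:(lra)) as [d3 [Hd3 D3]].
  destruct (is_derive_eps_cont g T _ (Hg T ltac:(lra)) 1 ltac:(lra)) as [d4 [Hd4 D4]].
  pose (d := Rmin (t1 - T) (Rmin d3 d4 / 2)).
  assert (Hmm2 : 0 < Rmin d3 d4) by now apply Rmin_pos.
  assert (Hd : 0 < d) by (apply Rmin_pos; lra).
  assert (Hda : d <= t1 - T) by apply Rmin_l.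
  assert (Hdb : d <= Rmin d3 d4 / 2) by apply Rmin_r.
  pose proof (Rmin_l d3 d4). pose proof (Rmin_r d3 d4).
  assert (T + d <= T); [|lra]. apply HT1. split; [lra|]. intros s Hs.
  destruct (Rlt_le_dec s T); [apply Hbelow; lra|].
  specialize (D3 s ltac:(apply Rabs_def1; lra)). specialize (D4 s ltac:(apply Rabs_def1; lra)).
  apply Rabs_def2 in D3. apply Rabs_def2 in D4. lra.
Qed.

Lemma average_of_derive (f f' : R -> R) (a : R) :
  (forall t, 0 < t -> is_derive f t (f' t)) ->
  (forall eps, 0 < eps -> exists T, forall t, T < t -> Rabs (f' t - a) < eps) ->
  forall eps, 0 < eps -> exists T, 0 < T /\ forall t, T < t -> Rabs (f t - a * t) <= eps * t.
Proof.
  intros Hf Hlim eps Heps. destruct (Hlim (eps / 2) ltac:(lra)) as [T0 HT0].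
  pose (T1 := Rmax 1 (T0 + 1)).
  assert (HT1 : 1 <= T1) by apply Rmax_l. assert (HT1' : T0 + 1 <= T1) by apply Rmax_r.
  pose (K := Rabs (f T1 - a * T1)). assert (PK : 0 <= K) by apply Rabs_pos.
  exists (T1 + 2 * K / eps).
  assert (PK2 : 0 <= 2 * K / eps) by (apply Rdiv_le_0_compat; lra).
  split; [lra|]. intros t Ht.
  destruct (MVT_cor2 f f' T1 t) as [c [Hc1 Hc2]]; [lra| |].
  { intros c Hc. apply is_derive_Reals, Hf. lra. }
  specialize (HT0 c ltac:(lra)).
  replace (f t - a * t) with ((f T1 - a * T1) + (f' c - a) * (t - T1))
    by (rewrite Rmult_minus_distr_r, <- Hc1; ring).
  eapply Rle_trans; [apply Rabs_triang|]. rewrite Rabs_mult. fold K.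
  rewrite (Rabs_pos_eq (t - T1)) by lra.
  assert (Rabs (f' c - a) * (t - T1) <= eps / 2 * (t - T1)) by (apply Rmult_le_compat_r; lra).
  assert (K = 2 * K / eps * (eps / 2)) by (field; lra). nra.
Qed.

Lemma is_lim_infty_eps (f : R -> R) (l : R) : is_lim f p_infty l <->
  forall eps, 0 < eps -> exists T, forall t, T < t -> Rabs (f t - l) < eps.
Proof.
  split.
  - intros H eps Heps. apply is_lim_spec in H. exact (H (mkposreal eps Heps)).
  - intros H. apply is_lim_spec. intros eps. apply H. apply cond_pos.
Qed.

Definition flow (phi : R -> C -> C) (G : C -> C) : Prop :=
  semigroup_H phi /\ generator_of phi G /\ forall z, inH z -> inH (G z).

Lemma holo_H_cderiv (f : C -> C) : holo_H f -> forall z, inH z -> exists l, is_cderiv f z l.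
Proof. intros H z Hz. destruct (H z Hz) as [l Hl]. exists l. now apply is_derive_cderiv. Qed.

Lemma flow_inH (phi : R -> C -> C) (G : C -> C) (t : R) (z : C) :
  flow phi G -> 0 <= t -> inH z -> inH (phi t z).
Proof. intros [[H _] _] Ht Hz. now apply (H t Ht). Qed.

Lemma flow_derive (phi : R -> C -> C) (G F : C -> C) (t : R) (z l : C) :
  flow phi G -> 0 < t -> inH z -> is_cderiv F (phi t z) l ->
  is_derive (fun s => Re (F (phi s z))) t (Re (l * G (phi t z))%C) /\
  is_derive (fun s => Im (F (phi s z))) t (Im (l * G (phi t z))%C).
Proof.
  intros (_ & [_ HG] & _) Ht Hz HF. destruct (HG z t Hz Ht) as [H1 H2].
  assert (E : forall c : C, (Re c, Im c) = c) by (intros []; reflexivity).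
  destruct (is_cderiv_curve F (fun s => Re (phi s z)) (fun s => Im (phi s z)) t
    (Re (G (phi t z))) (Im (G (phi t z))) l) as [K1 K2];
    [rewrite E; exact HF|exact H1|exact H2|].
  rewrite E in K1, K2. split.
  - apply is_derive_ext with (2 := K1). intros s. now rewrite E.
  - apply is_derive_ext with (2 := K2). intros s. now rewrite E.
Qed.

Lemma flow_lim_0 (phi : R -> C -> C) (G F : C -> C) (z : C) :
  flow phi G -> inH z -> ccont F z ->
  lim_0_right (fun t => Re (F (phi t z))) (Re (F z)) /\
  lim_0_right (fun t => Im (F (phi t z))) (Im (F z)).
Proof.
  intros ((_ & _ & _ & H0) & _ & _) Hz HF.
  assert (H : forall eps, 0 < eps -> exists d, 0 < d /\ forall t, 0 < t < d ->
    Cmod (F (phi t z) - F z)%C < eps).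
  { intros eps Heps. destruct (HF eps Heps) as [d [Hd HH]].
    assert (Hloc : locally z (fun w => Cmod (w - z)%C < d)).
    { assert (Hd2 : 0 < d / 2) by lra. exists (mkposreal _ Hd2). intros w [B1 B2].
      eapply Rle_lt_trans; [apply Cmod_le_Rabs_sum|].
      change (Rabs (fst w - fst z) + Rabs (snd w - snd z) < d).
      change (Rabs (fst w - fst z) < d / 2) in B1. change (Rabs (snd w - snd z) < d / 2) in B2.
      lra. }
    destruct (H0 z Hz _ Hloc) as [e He].
    exists e. split; [apply cond_pos|]. intros t Ht. apply HH. apply He; [|lra].
    change (Rabs (t - 0) < e). apply Rabs_def1; lra. }
  split; intros eps Heps; destruct (H eps Heps) as [d [Hd HH]]; exists d; split; auto;
    intros t Ht; (eapply Rle_lt_trans; [|exact (HH t Ht)]).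
  - pose proof (Re_le_Cmod (F (phi t z) - F z)%C) as T.
    destruct (F (phi t z)), (F z). exact T.
  - pose proof (Im_le_Cmod (F (phi t z) - F z)%C) as T.
    destruct (F (phi t z)), (F z). exact T.
Qed.

Lemma is_cderiv_sq (z : C) : is_cderiv (fun w => w * w)%C z (2 * z)%C.
Proof.
  replace (2 * z)%C with (1 * z + z * 1)%C by ring.
  apply is_cderiv_mult; apply is_cderiv_id.
Qed.

Lemma stolz_orbit_exists (phi : R -> C -> C) (G : C -> C) (l : R) :
  flow phi G -> l < 0 -> stolz_lim (fun z => z * G z)%C l ->
  exists w, inH w /\ forall t, 0 < t -> Rabs (Re (phi t w)) <= Im (phi t w).
Proof.
  intros HF Hl Hlim. destruct (Hlim 2 (- l / 4) ltac:(lra)) as [M HM].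
  pose (r := Rabs M + 2).
  assert (Hr : 2 <= r) by (unfold r; pose proof (Rabs_pos M); lra).
  assert (Hw : inH (0, r)) by (unfold inH; simpl; lra).
  exists (0, r). split; [exact Hw|].
  pose (sq := fun z : C => (z * z)%C).
  destruct (flow_lim_0 phi G sq (0, r) HF Hw (is_cderiv_cont _ _ _ (is_cderiv_sq _))) as [L1 L2].
  replace (Re (sq (0, r))) with (- r ^ 2) in L1 by (simpl; ring).
  replace (Im (sq (0, r))) with 0 in L2 by (simpl; ring).
  pose (x := fun t => phi t (0, r)).
  assert (Hin : forall t, 0 < t -> 0 < Im (x t)).
  { intros t Ht. apply (flow_inH phi G); auto. lra. }
  assert (Hd : forall t, 0 < t ->
    is_derive (fun s => Re (sq (x s))) t (Re (2 * x t * G (x t))%C) /\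
    is_derive (fun s => Im (sq (x s))) t (Im (2 * x t * G (x t))%C)).
  { intros t Ht. apply flow_derive; auto. apply is_cderiv_sq. }
  assert (Hx2 : forall t, Re (sq (x t)) = Re (x t) ^ 2 - Im (x t) ^ 2 /\
     Im (sq (x t)) = 2 * (Re (x t) * Im (x t))).
  { intros t. unfold sq. destruct (x t). simpl. split; ring. }
  (* Both quantities start at [- r^2]. Below [- r^2 + 1] they force [|x| <= y] and
     [|z|^2 > r^2 - 1 > M^2], exactly the region where the limit controls their derivatives. *)
  assert (Hmain : forall t, 0 < t ->
    Re (sq (x t)) + Im (sq (x t)) <= - r ^ 2 /\ Re (sq (x t)) - Im (sq (x t)) <= - r ^ 2).
  { apply (trapped (fun t => Re (sq (x t)) + Im (sq (x t))) (fun t => Re (sq (x t)) - Im (sq (x t)))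
      (fun t => Re (2 * x t * G (x t))%C + Im (2 * x t * G (x t))%C)
      (fun t => Re (2 * x t * G (x t))%C - Im (2 * x t * G (x t))%C)).
    1, 2: intros eps Heps; destruct (L1 (eps / 2) ltac:(lra)) as [d1 [D1 E1]];
      destruct (L2 (eps / 2) ltac:(lra)) as [d2 [D2 E2]];
      exists (Rmin d1 d2); (split; [now apply Rmin_pos|]); intros t [Ht1 Ht2];
      specialize (E1 t (conj Ht1 (Rlt_le_trans _ _ _ Ht2 (Rmin_l _ _))));
      specialize (E2 t (conj Ht1 (Rlt_le_trans _ _ _ Ht2 (Rmin_r _ _))));
      apply Rabs_def2 in E1; apply Rabs_def2 in E2; unfold x; apply Rabs_def1; lra.
    - intros t Ht. apply @is_derive_plus; now apply Hd.
    - intros t Ht. apply @is_derive_minus; now apply Hd.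
    - intros t Ht Hp Hm. destruct (Hx2 t) as [E1 E2]. rewrite E1, E2 in Hp, Hm.
      assert (Hi := Hin t Ht).
      assert (Hsq := Cmod_sq (x t)). pose proof (Cmod_ge_0 (x t)) as PC.
      assert (Hbig : M < Cmod (x t)).
      { assert (M ^ 2 < Cmod (x t) ^ 2).
        { assert (Rabs M ^ 2 = M ^ 2) by apply pow2_abs. unfold r in *.
          pose proof (Rabs_pos M). nra. }
        nra. }
      assert (Hst : Cmod (x t) <= 2 * Im (x t)).
      { apply le_of_sq_le; [lra|]. nra. }
      specialize (HM (x t) Hi Hst Hbig).
      pose proof (Re_le_Cmod (x t * G (x t) - l)%C) as T1.
      pose proof (Im_le_Cmod (x t * G (x t) - l)%C) as T2.
      replace (2 * x t * G (x t))%C with (2 * (x t * G (x t)))%C by ring.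
      destruct (x t * G (x t))%C as [a b]. simpl in *.
      assert (T1' := Rle_lt_trans _ _ _ T1 HM). assert (T2' := Rle_lt_trans _ _ _ T2 HM).
      apply Rabs_def2 in T1'. apply Rabs_def2 in T2'. lra. }
  intros t Ht. destruct (Hmain t Ht) as [Hp Hm]. destruct (Hx2 t) as [E1 E2].
  rewrite E1, E2 in Hp, Hm. assert (Hi := Hin t Ht). fold (x t).
  apply Rabs_le. nra.
Qed.

(* Orbits stay at bounded hyperbolic distance from each other, so one orbit in a Stolz angle
   forces all of them into Stolz angles. *)
Lemma orbits_stolz (phi : R -> C -> C) (G : C -> C) (w : C) :
  flow phi G -> inH w -> (forall t, 0 < t -> Rabs (Re (phi t w)) <= Im (phi t w)) ->
  forall z, inH z -> exists k, forall t, 0 < t -> Cmod (phi t z) <= k * Im (phi t z).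
Proof.
  intros HF Hw Hst z Hz.
  pose (D := Cmod (z - w) ^ 2 / (Im z * Im w)).
  assert (Hzw : 0 < Im z * Im w) by now apply Rmult_lt_0_compat.
  assert (PD : 0 <= D) by (apply Rdiv_le_0_compat; [apply pow2_ge_0|exact Hzw]).
  (* From [(p - q)^2 <= D p q] follows [q <= (D + 2) p]; the distance to the reference orbit costs
     [(D + 2) p], and that orbit has modulus at most [2 q]. *)
  exists (3 * (D + 2)). intros t Ht.
  assert (Ha : 0 < Im (phi t z)) by (apply (flow_inH phi G); auto; lra).
  assert (Hb : 0 < Im (phi t w)) by (apply (flow_inH phi G); auto; lra).
  specialize (Hst t Ht).
  destruct (proj1 (proj1 HF) t ltac:(lra)) as [Hhol Hself].
  assert (SP := schwarz_pick (phi t) (holo_H_cderiv _ Hhol)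
    (fun v Hv => Rlt_le _ _ (Hself v Hv)) z w Hz Hw).
  set (p := Im (phi t z)) in *. set (q := Im (phi t w)) in *.
  assert (SP' : Cmod (phi t z - phi t w) ^ 2 <= D * (p * q)).
  { apply (Rmult_le_reg_r (Im z * Im w)); [exact Hzw|].
    eapply Rle_trans; [exact SP|]. right. unfold D. field.
    split; apply Rgt_not_eq; assumption. }
  assert (Hq : q <= (D + 2) * p).
  { pose proof (Im_le_Cmod (phi t z - phi t w)%C) as T.
    replace (Im (phi t z - phi t w)%C) with (p - q) in T
      by (unfold p, q; destruct (phi t z), (phi t w); reflexivity).
    assert (T2 : (p - q) ^ 2 <= Cmod (phi t z - phi t w) ^ 2).
    { rewrite <- pow2_abs. apply pow_incr. split; [apply Rabs_pos|exact T]. }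
    nra. }
  assert (Hd : Cmod (phi t z - phi t w) <= (D + 2) * p).
  { apply le_of_sq_le; [nra|]. eapply Rle_trans; [exact SP'|].
    assert (D * (p * q) <= D * (p * ((D + 2) * p))).
    { apply Rmult_le_compat_l; [exact PD|]. apply Rmult_le_compat_l; lra. }
    assert (0 <= p * p) by nra. nra. }
  assert (Hw2 : Cmod (phi t w) <= 2 * q).
  { eapply Rle_trans; [apply Cmod_le_Rabs_sum|]. fold q. rewrite (Rabs_pos_eq q); lra. }
  replace (phi t z) with ((phi t z - phi t w) + phi t w)%C by ring.
  eapply Rle_trans; [apply Cmod_triangle|]. lra.
Qed.

Lemma lim_of_sq_average (f : R -> R) (a : R) : 0 < a ->
  (forall t, 0 <= f t) ->
  (forall eps, 0 < eps -> exists T, 0 < T /\ forall t, T < t -> Rabs (f t ^ 2 - a * t) <= eps * t) ->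
  is_lim (fun t => f t / sqrt t) p_infty (sqrt a).
Proof.
  intros Ha Hf H. apply is_lim_infty_eps. intros eps Heps.
  assert (Hs := sqrt_lt_R0 a Ha). assert (Hsq := sqrt_sqrt a (Rlt_le _ _ Ha)).
  destruct (H (eps * sqrt a / 2)) as [T [HT HH]].
  { apply Rdiv_lt_0_compat; [now apply Rmult_lt_0_compat|lra]. }
  exists T. intros t Ht. specialize (HH t Ht).
  assert (Ht0 : 0 < t) by lra.
  assert (Hst := sqrt_lt_R0 t Ht0). assert (Hstq := sqrt_sqrt t (Rlt_le _ _ Ht0)).
  set (u := f t / sqrt t). assert (Pu : 0 <= u) by now apply Rdiv_le_0_compat.
  assert (Ef : f t ^ 2 = u ^ 2 * t).
  { transitivity (u ^ 2 * (sqrt t * sqrt t)); [unfold u; field; lra|now rewrite Hstq]. }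
  rewrite Ef in HH.
  replace (u ^ 2 * t - a * t) with ((u - sqrt a) * (u + sqrt a) * t) in HH
    by (transitivity (u ^ 2 * t - sqrt a * sqrt a * t); [ring|rewrite Hsq; ring]).
  rewrite !Rabs_mult, (Rabs_pos_eq t), (Rabs_pos_eq (u + sqrt a)) in HH by lra.
  apply Rmult_le_reg_r in HH; [|exact Ht0].
  pose proof (Rabs_pos (u - sqrt a)). nra.
Qed.

Lemma rate_of_ang_lim (phi : R -> C -> C) (G : C -> C) (l : R) :
  flow phi G -> DW_infty phi -> l < 0 -> ang_lim_infty (fun z => z * G z)%C l ->
  forall z, inH z -> is_lim (fun t => Cmod (phi t z) / sqrt t) p_infty (sqrt (-2 * l)).
Proof.
  intros HF HDW Hl Hang z Hz. apply ang_lim_stolz in Hang.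
  destruct (stolz_orbit_exists phi G l HF Hl Hang) as (w & Hw & Hwst).
  destruct (orbits_stolz phi G w HF Hw Hwst z Hz) as [k Hk].
  assert (Hlim : forall eps, 0 < eps -> exists T, 0 < T /\ forall t, T < t ->
     Cmod (phi t z * G (phi t z) - l)%C < eps).
  { intros eps Heps. destruct (Hang k eps Heps) as [M HM].
    assert (HD := HDW z Hz). apply is_lim_spec in HD. destruct (HD M) as [T HT].
    exists (Rmax 1 T). split; [eapply Rlt_le_trans; [|apply Rmax_l]; lra|].
    intros t Ht. pose proof (Rmax_l 1 T). pose proof (Rmax_r 1 T).
    apply HM; [|apply Hk; lra|apply HT; lra].
    apply (flow_inH phi G); auto; lra. }
  pose (sq := fun z : C => (z * z)%C).
  assert (Hd : forall t, 0 < t ->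
    is_derive (fun s => Re (sq (phi s z))) t (Re (2 * phi t z * G (phi t z))%C) /\
    is_derive (fun s => Im (sq (phi s z))) t (Im (2 * phi t z * G (phi t z))%C)).
  { intros t Ht. apply flow_derive; auto. apply is_cderiv_sq. }
  assert (HRe := average_of_derive (fun t => Re (sq (phi t z))) _ (2 * l)
    (fun t Ht => proj1 (Hd t Ht))).
  assert (HIm := average_of_derive (fun t => Im (sq (phi t z))) _ 0
    (fun t Ht => proj2 (Hd t Ht))).
  simpl in HRe, HIm.
  apply lim_of_sq_average; [lra|intros; apply Cmod_ge_0|].
  intros eps Heps.
  destruct (HRe) with (eps := eps / 2) as [T1 [P1 H1]]; [|lra|].
  { intros e He. destruct (Hlim (e / 2) ltac:(lra)) as [T [_ HT]]. exists T. intros t Ht.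
    specialize (HT t Ht).
    pose proof (Re_le_Cmod (phi t z * G (phi t z) - l)%C) as K.
    assert (K' := Rle_lt_trans _ _ _ K HT).
    destruct (phi t z), (G _). simpl in *. apply Rabs_def2 in K'. apply Rabs_def1; lra. }
  destruct (HIm) with (eps := eps / 2) as [T2 [P2 H2]]; [|lra|].
  { intros e He. destruct (Hlim (e / 2) ltac:(lra)) as [T [_ HT]]. exists T. intros t Ht.
    specialize (HT t Ht).
    pose proof (Im_le_Cmod (phi t z * G (phi t z) - l)%C) as K.
    assert (K' := Rle_lt_trans _ _ _ K HT).
    destruct (phi t z), (G _). simpl in *. apply Rabs_def2 in K'. apply Rabs_def1; lra. }
  pose proof (Rmax_l T1 T2). pose proof (Rmax_r T1 T2).
  exists (Rmax T1 T2). split; [lra|]. intros t Ht.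
  specialize (H1 t ltac:(lra)). specialize (H2 t ltac:(lra)).
  (* The square is compared with [2 l t] as a complex number, so both of its coordinates are
     averaged. *)
  assert (Esq : Cmod (phi t z) ^ 2 = Cmod (sq (phi t z))).
  { unfold sq. rewrite Cmod_mult. ring. }
  rewrite Esq.
  assert (El : - 2 * l * t = Cmod (RtoC (2 * l * t))).
  { rewrite Cmod_R, Rabs_left1; [ring|]. nra. }
  rewrite El.
  eapply Rle_trans; [apply Cmod_rev_triangle|].
  eapply Rle_trans; [apply Cmod_le_Rabs_sum|].
  unfold sq. destruct (phi t z) as [x y]. simpl in *.
  replace (x * x - y * y + - (2 * l * t)) with (x * x - y * y - 2 * l * t) by ring.
  replace (x * y + y * x + - 0) with (x * y + y * x - 0 * t) by ring. lra.
Qed.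

(** * The Koenigs function *)

(** The real and imaginary parts of [g dz] are closed forms, with [dy] coefficients the parts of
    [i g]; their potentials are the parts of [h]. *)
Lemma primitive_H (g : C -> C) : (forall z, inH z -> exists l, is_cderiv g z l) ->
  exists h, forall z, inH z -> is_cderiv h z (g z).
Proof.
  intros Hg.
  pose (D := fun x y : R => 0 < y).
  assert (HD : box_convex D).
  { intros x1 y1 x2 y2 x y H1 H2 _ Hy. unfold D in *. assert (0 < Rmin y1 y2) by now apply Rmin_pos. lra. }
  assert (HO : open_2d D).
  { intros x y Hy. exists (mkposreal y Hy). simpl. intros u v _ Hv.
    apply Rabs_def2 in Hv. unfold D. lra. }
  assert (Hcl : forall x y, D x y -> closed_form_at (fun u v => Re (g (u, v)))
      (fun u v => Re (Ci * g (u, v))%C) x y /\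
      closed_form_at (fun u v => Im (g (u, v))) (fun u v => Im (Ci * g (u, v))%C) x y).
  { intros x y Hy. destruct (Hg (x, y) Hy) as [[a b] Hl].
    assert (Hil : is_cderiv (fun w => Ci * g w)%C (x, y) (- b, a)).
    { replace (- b, a) with (Ci * (a, b))%C
        by (unfold Ci, Cmult; simpl; f_equal; ring).
      now apply is_cderiv_scal. }
    apply is_cderiv_components in Hl. apply is_cderiv_components in Hil.
    split; eexists _, _, _; split; [apply Hl|apply Hil|apply Hl|apply Hil]. }
  destruct (closed_form_potential D _ _ HD HO (fun x y H => proj1 (Hcl x y H))) as [U HU].
  destruct (closed_form_potential D _ _ HD HO (fun x y H => proj2 (Hcl x y H))) as [V HV].
  exists (fun z => (U (Re z) (Im z), V (Re z) (Im z))).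
  intros [x y] Hz. specialize (HU x y Hz). specialize (HV x y Hz).
  destruct (g (x, y)) as [a b] eqn:E. rewrite ?E in *. apply is_cderiv_components. simpl in *.
  replace (- b) with (0 * a - 1 * b) by ring.
  replace (0 * b + 1 * a) with a in HV by ring. split; assumption.
Qed.

(** The Noshiro-Warschawski argument: along the segment from [b] to [a], with [d = a - b], the
    function [Im (conj d * h)] has derivative [|d|^2 Im g < 0]. *)
Lemma primitive_injective (h g : C -> C) :
  (forall z, inH z -> is_cderiv h z (g z)) -> (forall z, inH z -> Im (g z) < 0) ->
  forall a b, inH a -> inH b -> h a = h b -> a = b.
Proof.
  intros Hh Hg a b Ha Hb Heq. apply NNPP. intros Hne.
  pose (d := (a - b)%C).
  assert (Hd : 0 < Cmod d) by (apply Cmod_gt_0; now apply Cminus_eq_contra).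
  pose (F := fun z => (Cconj d * h z)%C).
  pose (x := fun s => Re b + s * Re d). pose (y := fun s => Im b + s * Im d).
  assert (Hin : forall s, 0 <= s <= 1 -> inH (x s, y s)).
  { intros s Hs. unfold inH, y, d in *. destruct a as [a1 a2], b as [b1 b2]. simpl in *.
    destruct (Rle_lt_dec a2 b2); nra. }
  destruct (MVT_cor2 (fun s => Im (F (x s, y s)))
    (fun s => Im (Cconj d * g (x s, y s) * d)%C) 0 1) as [c [Hc1 Hc2]]; [lra| |].
  { intros s Hs. apply is_derive_Reals.
    assert (HF : is_cderiv F (x s, y s) (Cconj d * g (x s, y s))%C).
    { apply is_cderiv_scal, Hh, Hin; lra. }
    destruct (is_cderiv_curve F x y s (Re d) (Im d) _ HF) as [_ K].
    - unfold x. auto_derive; [exact I|unfold d; simpl; ring].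
    - unfold y. auto_derive; [exact I|unfold d; simpl; ring].
    - replace (Re d, Im d) with d in K by now destruct d. exact K. }
  assert (E1 : (x 1, y 1) = a).
  { unfold x, y, d. destruct a, b. simpl. f_equal; ring. }
  assert (E0 : (x 0, y 0) = b).
  { unfold x, y, d. destruct b. simpl. f_equal; ring. }
  rewrite E1, E0 in Hc1. unfold F in Hc1. rewrite Heq in Hc1.
  assert (Hgc := Hg (x c, y c) (Hin c ltac:(lra))).
  assert (Hsq := Cmod_sq d). assert (0 < Cmod d ^ 2) by (apply pow_lt; exact Hd).
  assert (Im (Cconj d * g (x c, y c) * d)%C = Cmod d ^ 2 * Im (g (x c, y c))).
  { rewrite Hsq. destruct d, (g _). simpl. ring. }
  nra.
Qed.

(** The principal branch, by the half-angle formula [2 (Re sqrt q)^2 = |q| + Re q]; it is meaningful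
    off [slit], where this quantity is positive. *)
Definition csqrt (q : C) : C :=
  (sqrt ((Cmod q + Re q) / 2), Im q / (2 * sqrt ((Cmod q + Re q) / 2))).

Definition slit (q : C) : Prop := Im q = 0 /\ Re q <= 0.

Lemma csqrt_spec (q : C) : ~ slit q -> (csqrt q * csqrt q)%C = q /\ 0 < Re (csqrt q).
Proof.
  intros Hq. unfold csqrt.
  assert (Hpos : 0 < (Cmod q + Re q) / 2).
  { apply Rnot_le_lt. intros Hle. apply Hq.
    pose proof (Cmod_sq q) as S. pose proof (Re_le_Cmod q) as T. apply Rabs_le_between in T.
    pose proof (Cmod_ge_0 q).
    assert (E : Cmod q = - Re q) by lra. rewrite E in S. split; [nra|lra]. }
  assert (Hs := sqrt_lt_R0 _ Hpos).
  assert (Hss := sqrt_sqrt _ (Rlt_le _ _ Hpos)).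
  set (u := sqrt ((Cmod q + Re q) / 2)) in *.
  split; [|exact Hs].
  pose proof (Cmod_sq q) as S. destruct q as [a b]. simpl in *.
  unfold Cmult. simpl. f_equal; [|field; lra].
  assert (E : u * u - b / (2 * u) * (b / (2 * u)) = u * u - b * b / (4 * (u * u))) by (field; lra).
  rewrite E, Hss.
  apply (Rmult_eq_reg_r (2 * (Cmod (a, b) + a))); [|lra]. field_simplify; [|lra]. nra.
Qed.

(** No prior continuity of the root is needed: both roots have positive real part, so
    [|s w + s z| >= p], and [(s w - s z) (s w + s z) = f w - f z] gives a Lipschitz bound. Then [2 s
    z (s w - s z) = (f w - f z) - (s w - s z)^2] has a second-order error. *)
Lemma is_cderiv_csqrt (f : C -> C) (z l : C) (r : R) :
  0 < r -> (forall w, Cmod (w - z)%C < r -> ~ slit (f w)) -> is_cderiv f z l ->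
  exists m, is_cderiv (fun w => csqrt (f w)) z m.
Proof.
  intros Hr Hsl Hf. exists (l / (2 * csqrt (f z)))%C.
  assert (Hsz : ~ slit (f z)).
  { apply Hsl. replace (z - z)%C with (RtoC 0) by ring. now rewrite Cmod_0. }
  destruct (csqrt_spec _ Hsz) as [Ez Pz].
  set (s := fun w => csqrt (f w)). change (csqrt (f z)) with (s z) in *.
  pose (p := Re (s z)). fold p in Pz.
  assert (Hsz0 : s z <> 0) by (intros H; unfold p in Pz; rewrite H in Pz; simpl in Pz; lra).
  assert (Hps : p <= Cmod (s z)).
  { unfold p. pose proof (Re_le_Cmod (s z)) as T. apply Rabs_le_between in T. lra. }
  intros eps Heps. pose proof (Cmod_ge_0 l) as Pl.
  assert (E1 : 0 < p * eps) by now apply Rmult_lt_0_compat.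
  pose (k := (Cmod l + 1) ^ 2). assert (Pk : 0 < k) by (apply pow_lt; lra).
  assert (E2 : 0 < p ^ 3 * eps / k).
  { apply Rdiv_lt_0_compat; [apply Rmult_lt_0_compat; [now apply pow_lt|exact Heps]|exact Pk]. }
  destruct (Hf _ E1) as [d1 [Hd1 H1]]. destruct (Hf 1 ltac:(lra)) as [d2 [Hd2 H2]].
  exists (Rmin (Rmin d1 d2) (Rmin r (p ^ 3 * eps / k))).
  split; [repeat apply Rmin_pos; assumption|]. intros w Hw.
  pose proof (Rmin_l (Rmin d1 d2) (Rmin r (p ^ 3 * eps / k))).
  pose proof (Rmin_r (Rmin d1 d2) (Rmin r (p ^ 3 * eps / k))).
  pose proof (Rmin_l d1 d2). pose proof (Rmin_r d1 d2).
  pose proof (Rmin_l r (p ^ 3 * eps / k)). pose proof (Rmin_r r (p ^ 3 * eps / k)).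
  specialize (H1 w ltac:(lra)). specialize (H2 w ltac:(lra)).
  destruct (csqrt_spec _ (Hsl w ltac:(lra))) as [Ew Pw]. fold (s w) in Ew, Pw.
  assert (Hn3 : Cmod (w - z) <= p ^ 3 * eps / k) by lra.
  set (n := Cmod (w - z)) in *. assert (Pn : 0 <= n) by apply Cmod_ge_0.
  assert (Hdiff : Cmod (f w - f z) <= (Cmod l + 1) * n).
  { replace (f w - f z)%C with ((f w - f z - l * (w - z)) + l * (w - z))%C by ring.
    eapply Rle_trans; [apply Cmod_triangle|]. rewrite Cmod_mult. fold n. lra. }
  assert (Hsum : p <= Cmod (s w + s z)).
  { pose proof (Re_le_Cmod (s w + s z)%C) as T. apply Rabs_le_between in T.
    replace (Re (s w + s z)%C) with (Re (s w) + Re (s z)) in T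
      by (destruct (s w), (s z); reflexivity). unfold p. lra. }
  assert (Hs1 : Cmod (s w - s z) * p <= (Cmod l + 1) * n).
  { eapply Rle_trans; [|exact Hdiff].
    replace (f w - f z)%C with ((s w - s z) * (s w + s z))%C
      by (rewrite <- Ew, <- Ez; ring).
    rewrite Cmod_mult. apply Rmult_le_compat_l; [apply Cmod_ge_0|exact Hsum]. }
  assert (Hs2 : Cmod (s w - s z) ^ 2 <= p * eps * n).
  { apply (Rmult_le_reg_r (p ^ 2)); [now apply pow_lt|].
    rewrite <- Rpow_mult_distr.
    apply Rle_trans with (((Cmod l + 1) * n) ^ 2).
    - apply pow_incr. split; [|exact Hs1]. apply Rmult_le_pos; [apply Cmod_ge_0|lra].
    - rewrite Rpow_mult_distr. fold k.
      apply (Rmult_le_compat_l k) in Hn3; [|lra].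
      replace (k * (p ^ 3 * eps / k)) with (p ^ 3 * eps) in Hn3 by (field; lra).
      apply Rle_trans with (n * (k * n)); [right; ring|].
      apply Rle_trans with (n * (p ^ 3 * eps)); [now apply Rmult_le_compat_l|right; ring]. }
  replace (s w - s z - l / (2 * s z) * (w - z))%C
    with (((f w - f z - l * (w - z)) + - ((s w - s z) * (s w - s z))) / (2 * s z))%C
    by (rewrite <- Ew, <- Ez; field; exact Hsz0).
  assert (H20 : (2 * s z)%C <> 0).
  { apply Cmult_neq_0; [|exact Hsz0]. intros H20. apply (f_equal Re) in H20. simpl in H20. lra. }
  rewrite Cmod_div by exact H20.
  apply (Rmult_le_reg_r (Cmod (2 * s z))); [now apply Cmod_gt_0|].
  unfold Rdiv. rewrite Rmult_assoc, Rinv_l, Rmult_1_r by (apply Rgt_not_eq; now apply Cmod_gt_0).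
  eapply Rle_trans; [apply Cmod_triangle|]. rewrite Cmod_opp, !Cmod_mult, Cmod_R.
  rewrite (Rabs_pos_eq 2) by lra.
  assert (eps * n * p <= eps * n * Cmod (s z)).
  { apply Rmult_le_compat_l; [apply Rmult_le_pos; lra|exact Hps]. }
  simpl in Hs2. lra.
Qed.

Lemma MVT_eq_0 (f : R -> R) (f0 B T : R) : 0 < T -> lim_0_right f f0 ->
  (forall t, 0 < t <= T -> is_derive f t B) -> f T = f0 + B * T.
Proof.
  intros HT H0 Hd.
  assert (H1 := MVT_le_0 f (fun _ => B) f0 B T HT H0 Hd (fun t _ => Rle_refl B)).
  assert (H2 : - f T - - f0 <= - B * T); [|lra].
  apply (MVT_le_0 (fun t => - f t) (fun _ => - B)); try (intros; lra).
  - intros eps Heps. destruct (H0 eps Heps) as [d [Hdp H]]. exists d. split; [exact Hdp|].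
    intros t Ht. replace (- f t - - f0) with (- (f t - f0)) by ring. rewrite Rabs_Ropp. auto.
  - intros t Ht. now apply @is_derive_opp, Hd.
Qed.

(** Along an orbit [h] has derivative [(1/G) * G = 1]. *)
Lemma koenigs_flow (phi : R -> C -> C) (G h : C -> C) :
  flow phi G -> (forall z, inH z -> is_cderiv h z (/ G z)%C) ->
  forall t z, 0 < t -> inH z -> h (phi t z) = (h z + t)%C.
Proof.
  intros HF Hh t z Ht Hz.
  destruct (flow_lim_0 phi G h z HF Hz (is_cderiv_cont _ _ _ (Hh z Hz))) as [L1 L2].
  assert (Hd : forall s, 0 < s ->
    is_derive (fun s => Re (h (phi s z))) s 1 /\ is_derive (fun s => Im (h (phi s z))) s 0).
  { intros s Hs. assert (Hin : inH (phi s z)) by (apply (flow_inH phi G); auto; lra).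
    assert (HG : inH (G (phi s z))) by now apply HF.
    destruct (flow_derive phi G h s z _ HF Hs Hz (Hh _ Hin)) as [K1 K2].
    rewrite Cinv_l in K1, K2; [now split|..]; intros E; unfold inH in HG; rewrite E in HG;
      simpl in HG; lra. }
  assert (E1 := MVT_eq_0 _ _ 1 t Ht L1 (fun s Hs => proj1 (Hd s (proj1 Hs)))).
  assert (E2 := MVT_eq_0 _ _ 0 t Ht L2 (fun s Hs => proj2 (Hd s (proj1 Hs)))).
  simpl in E1, E2. destruct (h (phi t z)), (h z). simpl in *.
  unfold Cplus, RtoC; simpl. f_equal; lra.
Qed.

Lemma flow_Im_incr (phi : R -> C -> C) (G : C -> C) (z : C) : flow phi G -> inH z ->
  (forall t, 0 < t -> Im z <= Im (phi t z)) /\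
  (forall s t, 0 < s -> s < t -> Im (phi s z) < Im (phi t z)).
Proof.
  intros HF Hz.
  destruct (flow_lim_0 phi G (fun w => w) z HF Hz (is_cderiv_cont _ _ _ (is_cderiv_id z))) as [_ L].
  simpl in L.
  assert (HGp : forall t, 0 < t -> 0 < Im (G (phi t z))).
  { intros t Ht. apply HF. apply (flow_inH phi G); auto. lra. }
  assert (Hd : forall t, 0 < t -> is_derive (fun s => Im (phi s z)) t (Im (G (phi t z)))).
  { intros t Ht. now apply (proj1 (proj2 HF)). }
  split.
  - intros t Ht.
    assert (- Im (phi t z) - - Im z <= 0 * t); [|lra].
    apply (MVT_le_0 (fun s => - Im (phi s z)) (fun s => - Im (G (phi s z)))); [exact Ht| | |].
    + intros eps Heps. destruct (L eps Heps) as [d [Hdp H]]. exists d. split; [exact Hdp|].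
      intros s Hs. rewrite <- Rabs_Ropp.
      replace (- (- Im (phi s z) - - Im z)) with (Im (phi s z) - Im z) by ring. auto.
    + intros s Hs. apply @is_derive_opp. now apply Hd.
    + intros s Hs. pose proof (HGp s (proj1 Hs)). lra.
  - intros s t Hs Hst.
    destruct (MVT_cor2 (fun s => Im (phi s z)) (fun s => Im (G (phi s z))) s t Hst)
      as [c [Hc1 Hc2]].
    + intros c Hc. apply is_derive_Reals, Hd. lra.
    + pose proof (HGp c ltac:(lra)). nra.
Qed.

(** * Orbits of extremal rate *)

Lemma continuity_pt_eps (f : R -> R) (t : R) : continuity_pt f t ->
  forall eps, 0 < eps -> exists d, 0 < d /\ forall s, Rabs (s - t) < d -> Rabs (f s - f t) < eps.
Proof.
  intros H eps Heps. destruct (H eps Heps) as [d [Hd HH]]. exists d. split; [exact Hd|].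
  intros s Hs. destruct (Req_dec s t) as [->|Hne].
  - rewrite Rminus_diag, Rabs_R0. exact Heps.
  - apply HH. split; [split; [exact I|auto]|exact Hs].
Qed.

Lemma IVT_value (f : R -> R) (a b v : R) : a < b ->
  (forall t, a <= t <= b -> continuity_pt f t) -> f a < v < f b ->
  exists t, a <= t <= b /\ f t = v.
Proof.
  intros Hab Hc [H1 H2].
  destruct (Ranalysis5.IVT_interv (fun t => f t - v) a b) as [t [Ht1 Ht2]]; try lra.
  - intros t Ht. apply continuity_pt_minus; [now apply Hc|].
    apply continuity_pt_const. now intros ? ?.
  - exists t. split; [exact Ht1|lra].
Qed.

(* The curve is a graph [x = X (y)] over the ordinate, so the part [K] of a box lying to its
   left is bounded by the curve, where [u >= a |z|], and by sides on which the barrier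
   [(1 - y/m)^2 - (x - 4m)^2/(2m)^2] is nonpositive.  The barrier is subharmonic, and the
   minimum principle propagates the lower bound on [u] from the curve to the point
   [4m + i m/2], which lies well inside the half-plane. *)
Lemma tangential_curve_absurd (u : R -> R -> R) (X Y : R -> R) (a b T0 : R) :
  (forall x y, b < y -> 0 <= u x y) ->
  (forall x y, b < y -> continuity_2d_pt u x y) ->
  (forall x0 y0 r al be A B, b < y0 -> 0 < r -> 0 < A + B ->
     ~ (forall x y, Rabs (x - x0) < r -> Rabs (y - y0) < r ->
          - u x y + al * (x - x0) + be * (y - y0) + A * (x - x0) ^ 2 + B * (y - y0) ^ 2
          <= - u x0 y0)) ->
  (forall eps, 0 < eps -> exists M, forall m, M < m -> u (4 * m) (m / 2) <= eps * m) ->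
  (forall t, 0 < t -> continuity_pt X t /\ continuity_pt Y t /\ b < Y t) ->
  (forall s t, 0 < s -> s < t -> Y s < Y t) ->
  (forall M, exists T, forall t, T < t -> M < X t) ->
  0 < a -> 0 < T0 -> 0 <= b ->
  (forall t, T0 <= t -> 9 * Y t < X t /\ a * X t <= u (X t) (Y t)) ->
  False.
Proof.
  intros Hu0 Huc Hmin Hsmall Hcurve Hmono HXinf Ha HT0 Hb Htan.
  assert (Hmono' : forall s t, 0 < s -> 0 < t -> Y s < Y t -> s < t).
  { intros s t Hs Ht HY. apply Rnot_le_lt. intros [Hlt| ->]; [|lra].
    pose proof (Hmono t s Ht Hlt). lra. }
  (* At [(4 m, m / 2)] the scaled barrier is [a m / 2], so [u <= a m / 4] there makes [f]
     positive. *)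
  destruct (Hsmall (a / 4) ltac:(lra)) as [M HM].
  set (x1 := X T0). set (y1 := Y T0).
  assert (Hy1 : b < y1) by now apply Hcurve.
  assert (Hx1 : 9 * y1 < x1) by (apply Htan; lra).
  pose (m := Rmax (M + 1) x1).
  assert (Hm1 : M < m) by (pose proof (Rmax_l (M + 1) x1); unfold m; lra).
  assert (Hm2 : x1 <= m) by apply Rmax_r.
  specialize (HM m Hm1). clearbody m.
  (* A height that the curve does not attain imposes no condition. No point of [K] lies on the
     bottom edge, because the curve passes there at [x1 <= m]. *)
  pose (K := fun x y => (2 * m <= x <= 6 * m /\ y1 <= y <= m) /\
    forall t, 0 < t -> Y t = y -> x <= X t).
  (* The factor [2 a m] is the least value of [a * X] on the part of the curve in the box, and the
     bracket is at most 1, so [f <= 0] on the curve. *)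
  pose (f := fun x y => 2 * a * m * ((1 - y / m) ^ 2 - ((x - 4 * m) / (2 * m)) ^ 2) - u x y).
  destruct (usc_max K f (2 * m) y1 (4 * m) (m - y1) (4 * m) (m / 2))
    as (x & y & [[Hx Hy] HK] & Hmax).
  - intros x y [H _]. lra.
  - intros x y HnK.
    destruct (classic (2 * m <= x <= 6 * m /\ y1 <= y <= m)) as [Hbox|Hbox].
    + assert (Hex : exists t, 0 < t /\ Y t = y /\ X t < x).
      { apply NNPP. intros Hno. apply HnK. split; [exact Hbox|]. intros t Ht HYt.
        apply Rnot_lt_le. intros Hlt. apply Hno. now exists t. }
      destruct Hex as (t & Ht & HYt & HXt).
      destruct (Hcurve t Ht) as (HcX & _ & _).
      destruct (continuity_pt_eps X t HcX ((x - X t) / 2) ltac:(lra)) as [e [He HXe]].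
      pose (e' := Rmin e t / 2).
      assert (He' : 0 < e') by (assert (0 < Rmin e t) by (now apply Rmin_pos); unfold e'; lra).
      assert (He1 : e' < e) by (pose proof (Rmin_l e t); unfold e' in *; lra).
      assert (He2 : e' < t) by (pose proof (Rmin_r e t); unfold e' in *; lra).
      assert (M1 := Hmono (t - e') t ltac:(lra) ltac:(lra)).
      assert (M2 := Hmono t (t + e') ltac:(lra) ltac:(lra)).
      exists (Rmin (Rmin (y - Y (t - e')) (Y (t + e') - y)) ((x - X t) / 2)).
      split; [repeat apply Rmin_pos; lra|]. intros x' y' Hx' Hy' [_ HK'].
      assert (Hx'' := Rlt_le_trans _ _ _ Hx' (Rmin_r _ _)).
      assert (Hy'' := Rlt_le_trans _ _ _ Hy' (Rmin_l _ _)).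
      assert (Hy1' := Rlt_le_trans _ _ _ Hy'' (Rmin_l _ _)).
      assert (Hy2' := Rlt_le_trans _ _ _ Hy'' (Rmin_r _ _)).
      apply Rabs_def2 in Hx''. apply Rabs_def2 in Hy1'. apply Rabs_def2 in Hy2'.
      destruct (IVT_value Y (t - e') (t + e') y') as [s [Hs1 Hs2]]; [lra| |lra|].
      { intros s Hs. apply Hcurve. lra. }
      specialize (HK' s ltac:(lra) Hs2).
      specialize (HXe s ltac:(apply Rabs_def1; lra)). apply Rabs_def2 in HXe. lra.
    + pose (d := Rmax (Rmax (2 * m - x) (x - 6 * m)) (Rmax (y1 - y) (y - m))).
      assert (Hd : 0 < d).
      { apply Rnot_le_lt. intros Hle. apply Hbox.
        pose proof (Rmax_l (Rmax (2 * m - x) (x - 6 * m)) (Rmax (y1 - y) (y - m))).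
        pose proof (Rmax_r (Rmax (2 * m - x) (x - 6 * m)) (Rmax (y1 - y) (y - m))).
        pose proof (Rmax_l (2 * m - x) (x - 6 * m)). pose proof (Rmax_r (2 * m - x) (x - 6 * m)).
        pose proof (Rmax_l (y1 - y) (y - m)). pose proof (Rmax_r (y1 - y) (y - m)).
        fold d in H, H0. lra. }
      exists d. split; [exact Hd|]. intros x' y' Hx' Hy' [[B1 B2] _].
      apply Rabs_def2 in Hx'. apply Rabs_def2 in Hy'.
      assert (d < d); [|lra]. unfold d at 1. repeat apply Rmax_lub_lt; lra.
  - intros x y eps [[_ Hy] _] Heps.
    assert (Hf : continuity_2d_pt f x y).
    { unfold f. apply continuity_2d_pt_minus; [|apply Huc; lra].
      apply continuity_2d_pt_mult; [apply continuity_2d_pt_const|].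
      apply continuity_2d_pt_minus.
      - apply (continuity_2d_pt_ext (fun _ v => (1 - v * / m) * (1 - v * / m)));
          [intros; unfold Rdiv; ring|].
        apply continuity_2d_pt_mult; (apply continuity_2d_pt_minus; [apply continuity_2d_pt_const|];
          apply continuity_2d_pt_mult; [apply continuity_2d_pt_id2|apply continuity_2d_pt_const]).
      - apply (continuity_2d_pt_ext (fun v _ => ((v - 4 * m) * / (2 * m)) * ((v - 4 * m) * / (2 * m))));
          [intros; unfold Rdiv; ring|].
        apply continuity_2d_pt_mult; (apply continuity_2d_pt_mult; [|apply continuity_2d_pt_const];
          apply continuity_2d_pt_minus; [apply continuity_2d_pt_id1|apply continuity_2d_pt_const]). }
    destruct (Hf (mkposreal eps Heps)) as [d Hd]. exists d. split; [apply cond_pos|].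
    intros x' y' Hx' Hy' _. specialize (Hd x' y' Hx' Hy'). simpl in Hd.
    apply Rabs_def2 in Hd. lra.
  - split; [lra|]. intros t Ht HYt.
    assert (Ht0 : T0 < t) by (apply Hmono'; auto; fold y1; lra).
    destruct (Htan t ltac:(lra)). lra.
  - assert (Hmpos : 0 < m) by lra.
    assert (Hfp : 0 < f x y).
    { apply Rlt_le_trans with (f (4 * m) (m / 2)).
      - unfold f. replace (2 * a * m * _) with (a * m / 2) by (field; lra).
        assert (0 < a * m) by now apply Rmult_lt_0_compat. lra.
      (* The constant 9 enters here: at height [m / 2] the curve has abscissa above [9 m / 2], to
         the right of the test point. *)
      - apply Hmax. split; [lra|]. intros t Ht HYt.
        assert (Ht0 : T0 < t) by (apply Hmono'; auto; fold y1; lra).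
        destruct (Htan t ltac:(lra)). lra. }
    assert (Pam : 0 < 2 * a * m) by (repeat apply Rmult_lt_0_compat; lra).
    pose (p := (1 - y / m)). pose (q := ((x - 4 * m) / (2 * m))).
    assert (Hp : 0 <= p <= 1).
    { assert (0 <= y / m) by (apply Rdiv_le_0_compat; lra).
      assert (y / m <= 1).
      { apply (Rmult_le_reg_r m); [lra|]. unfold Rdiv. rewrite Rmult_assoc, Rinv_l; lra. }
      unfold p. lra. }
    assert (Hup := Hu0 x y ltac:(lra)).
    assert (Hf : f x y = 2 * a * m * (p ^ 2 - q ^ 2) - u x y) by reflexivity.
    assert (Hpq : 0 < p ^ 2 - q ^ 2) by (apply (Rmult_lt_reg_l (2 * a * m)); lra).
    assert (Hqx : q * (2 * m) = x - 4 * m) by (unfold q; field; lra).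
    assert (Hpy : p * m = m - y) by (unfold p; field; lra).
    assert (Hq : -1 < q < 1) by nra.
    assert (Hx' : 2 * m < x < 6 * m) by nra.
    assert (Hy' : y < m).
    { assert (p <> 0) by (intros ->; nra). nra. }
    assert (Hyy : y1 < y).
    { destruct (Rle_lt_or_eq_dec y1 y ltac:(lra)) as [H| <-]; [exact H|exfalso].
      specialize (HK T0 HT0 eq_refl). fold x1 in HK. lra. }
    assert (Hleft : forall t, 0 < t -> Y t = y -> x < X t).
    { intros t Ht HYt. destruct (HK t Ht HYt) as [H| ->]; [exact H|exfalso].
      assert (Ht0 : T0 < t) by (apply Hmono'; auto; fold y1; lra).
      destruct (Htan t ltac:(lra)) as [_ H]. rewrite HYt in H.
      assert (a * (2 * m) <= a * X t) by (apply Rmult_le_compat_l; lra).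
      assert (p ^ 2 - q ^ 2 <= 1) by nra. nra. }
    assert (Hnb : exists d, 0 < d /\ forall y', Rabs (y' - y) < d ->
       forall t, 0 < t -> Y t = y' -> x + d <= X t).
    { destruct (classic (exists t, 0 < t /\ Y t = y)) as [(t & Ht & HYt)|Hno].
      - assert (HXt := Hleft t Ht HYt).
        destruct (Hcurve t Ht) as (HcX & _ & _).
        destruct (continuity_pt_eps X t HcX ((X t - x) / 2) ltac:(lra)) as [e [He HXe]].
        pose (e' := Rmin e t / 2).
        assert (He' : 0 < e') by (assert (0 < Rmin e t) by (now apply Rmin_pos); unfold e'; lra).
        assert (He1 : e' < e) by (pose proof (Rmin_l e t); unfold e' in *; lra).
        assert (He2 : e' < t) by (pose proof (Rmin_r e t); unfold e' in *; lra).
        assert (M1 := Hmono (t - e') t ltac:(lra) ltac:(lra)).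
        assert (M2 := Hmono t (t + e') ltac:(lra) ltac:(lra)).
        exists (Rmin (Rmin (y - Y (t - e')) (Y (t + e') - y)) ((X t - x) / 2)).
        split; [repeat apply Rmin_pos; lra|]. intros y' Hd s Hs HYs.
        assert (Hy'' := Rlt_le_trans _ _ _ Hd (Rmin_l _ _)).
        assert (Hy1' := Rlt_le_trans _ _ _ Hy'' (Rmin_l _ _)).
        assert (Hy2' := Rlt_le_trans _ _ _ Hy'' (Rmin_r _ _)).
        apply Rabs_def2 in Hy1'. apply Rabs_def2 in Hy2'.
        assert (t - e' < s) by (apply Hmono'; lra).
        assert (s < t + e') by (apply Hmono'; lra).
        specialize (HXe s ltac:(apply Rabs_def1; lra)). apply Rabs_def2 in HXe.
        pose proof (Rmin_r (Rmin (y - Y (t - e')) (Y (t + e') - y)) ((X t - x) / 2)). lra.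
      (* If height [y] is never attained, continuity keeps the whole curve below it after [T0];
         heights near [y] are then reached only at late times, when [X] exceeds [6 m]. *)
      - destruct (HXinf (6 * m)) as [T HT].
        pose (T' := Rmax T T0 + 1).
        assert (HT1 : T < T') by (pose proof (Rmax_l T T0); unfold T'; lra).
        assert (HT2 : T0 < T') by (pose proof (Rmax_r T T0); unfold T'; lra).
        assert (HYT : Y T' < y).
        { apply Rnot_le_lt. intros [Hlt|Heq].
          - destruct (IVT_value Y T0 T' y) as [s [Hs1 Hs2]]; [lra| |fold y1; lra|].
            + intros s Hs. apply Hcurve. lra.
            + apply Hno. exists s. split; [lra|exact Hs2].
          - apply Hno. exists T'. split; [lra|auto]. }
        exists (Rmin (y - Y T') (6 * m - x)). split; [apply Rmin_pos; lra|].
        intros y' Hd t Ht HYt.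
        assert (Hd1 := Rlt_le_trans _ _ _ Hd (Rmin_l _ _)). apply Rabs_def2 in Hd1.
        assert (T' < t) by (apply Hmono'; lra).
        specialize (HT t ltac:(lra)). pose proof (Rmin_r (y - Y T') (6 * m - x)). lra. }
    destruct Hnb as [d [Hd Hnb]].
    pose (r := Rmin d (Rmin (Rmin (x - 2 * m) (6 * m - x)) (Rmin (y - y1) (m - y)))).
    assert (Hr : 0 < r) by (repeat apply Rmin_pos; lra).
    (* The coefficients expand the barrier around [(x, y)]. Its horizontal scale [2 m] is twice the
       vertical one, so the positive second derivative dominates and [A + B > 0]. *)
    apply (Hmin x y r (- (2 * a * m) * q / m) (- (2 * a * m) * (2 * p) / m)
      (- (2 * a * m) / (2 * m) ^ 2) ((2 * a * m) / m ^ 2)); [lra|exact Hr| |].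
    + replace (- (2 * a * m) / (2 * m) ^ 2 + 2 * a * m / m ^ 2) with (2 * a * m * (3 / 4) / m ^ 2)
        by (field; lra).
      apply Rdiv_lt_0_compat; [lra|apply pow_lt; lra].
    + intros x' y' Hxr Hyr.
      assert (R1 : r <= d) by apply Rmin_l.
      assert (R2 : r <= Rmin (Rmin (x - 2 * m) (6 * m - x)) (Rmin (y - y1) (m - y))) by apply Rmin_r.
      pose proof (Rmin_l (Rmin (x - 2 * m) (6 * m - x)) (Rmin (y - y1) (m - y))).
      pose proof (Rmin_r (Rmin (x - 2 * m) (6 * m - x)) (Rmin (y - y1) (m - y))).
      pose proof (Rmin_l (x - 2 * m) (6 * m - x)). pose proof (Rmin_r (x - 2 * m) (6 * m - x)).
      pose proof (Rmin_l (y - y1) (m - y)). pose proof (Rmin_r (y - y1) (m - y)).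
      assert (Hin : K x' y').
      { split.
        - apply Rabs_def2 in Hxr. apply Rabs_def2 in Hyr. lra.
        - intros t Ht HYt. specialize (Hnb y' ltac:(lra) t Ht HYt).
          apply Rabs_def2 in Hxr. lra. }
      specialize (Hmax x' y' Hin). rewrite Hf in Hmax. unfold f in Hmax.
      assert (E : (1 - y' / m) ^ 2 - ((x' - 4 * m) / (2 * m)) ^ 2
        = p ^ 2 - q ^ 2 - q / m * (x' - x) - 2 * p / m * (y' - y)
          - (x' - x) ^ 2 / (2 * m) ^ 2 + (y' - y) ^ 2 / m ^ 2).
      { unfold p, q. field. lra. }
      rewrite E in Hmax.
      replace (- (2 * a * m) * q / m * (x' - x)) with ((2 * a * m) * (- (q / m * (x' - x))))
        by (field; lra).
      replace (- (2 * a * m) * (2 * p) / m * (y' - y))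
        with ((2 * a * m) * (- (2 * p / m * (y' - y)))) by (field; lra).
      replace (- (2 * a * m) / (2 * m) ^ 2 * (x' - x) ^ 2)
        with ((2 * a * m) * (- ((x' - x) ^ 2 / (2 * m) ^ 2))) by (field; lra).
      replace (2 * a * m / m ^ 2 * (y' - y) ^ 2)
        with ((2 * a * m) * ((y' - y) ^ 2 / m ^ 2)) by (field; lra).
      lra.
Qed.

Lemma inH_neq_0 (z : C) : inH z -> z <> 0.
Proof. intros H E. unfold inH in H. rewrite E in H. simpl in H. lra. Qed.

Lemma Im_inv (z : C) : z <> 0 -> Im (/ z)%C = - Im z / Cmod z ^ 2.
Proof. intros Hz. rewrite Cmod_sq. destruct z as [x y]. simpl. reflexivity. Qed.

Lemma Im_inv_neg (z : C) : inH z -> Im (/ z)%C < 0.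
Proof.
  intros Hz. rewrite Im_inv by now apply inH_neq_0.
  assert (0 < Im z / Cmod z ^ 2).
  { apply Rdiv_lt_0_compat; [exact Hz|]. now apply pow_lt, inH_Cmod_pos. }
  unfold Rdiv in *. lra.
Qed.

Lemma is_cderiv_shift (f : C -> C) (c z l : C) :
  is_cderiv f (z + c)%C l -> is_cderiv (fun w => f (w + c))%C z l.
Proof.
  intros H eps Heps. destruct (H eps Heps) as [d [Hd HH]]. exists d. split; [exact Hd|].
  intros w Hw. specialize (HH (w + c)%C).
  replace (w + c - (z + c))%C with (w - z)%C in HH by ring. auto.
Qed.

Definition small_in_stolz (f : C -> C) : Prop :=
  forall k eps, 0 < eps -> exists M, forall z,
    inH z -> Cmod z <= k * Im z -> M < Cmod z -> Cmod (f z) <= eps * Cmod z.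

(** Integrating an [o(s)] derivative up the imaginary axis gives [o(s^2)]; [K] absorbs the initial
    segment. *)
Lemma primitive_vertical_growth (h g : C -> C) :
  (forall z, inH z -> is_cderiv h z (g z)) -> small_in_stolz g ->
  forall eps, 0 < eps -> exists S K, forall s, S < s ->
    Cmod (h (0, s) - h Ci)%C <= eps * s ^ 2 + K.
Proof.
  intros Hh Hg eps Heps. destruct (Hg 1 (eps / 2) ltac:(lra)) as [M HM].
  pose (s0 := Rmax M 0 + 1).
  assert (Hs0 : 0 < s0) by (pose proof (Rmax_r M 0); unfold s0; lra).
  assert (HMs : M < s0) by (pose proof (Rmax_l M 0); unfold s0; lra).
  exists s0, (Cmod (h (0, s0) - h Ci)%C). intros s Hs.
  assert (Hb : forall c, s0 <= c <= s -> Cmod (g (0, c)) <= eps / 2 * s).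
  { intros c Hc.
    assert (Ec : Cmod (0, c) = c).
    { apply Rle_antisym.
      - eapply Rle_trans; [apply Cmod_le_Rabs_sum|]. simpl. rewrite Rabs_R0, Rabs_pos_eq; lra.
      - pose proof (Im_le_Cmod (0, c)) as T. simpl in T. apply Rabs_le_between in T. lra. }
    eapply Rle_trans; [apply HM|].
    - unfold inH; simpl; lra.
    - rewrite Ec. simpl. lra.
    - rewrite Ec. lra.
    - rewrite Ec. apply Rmult_le_compat_l; lra. }
  assert (Hd : forall c, s0 <= c <= s ->
     is_derive (fun v => Re (h (0, v))) c (Re (g (0, c) * (0, 1))%C) /\
     is_derive (fun v => Im (h (0, v))) c (Im (g (0, c) * (0, 1))%C)).
  { intros c Hc. apply (is_cderiv_curve h (fun _ => 0) (fun v => v)).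
    - apply Hh. unfold inH; simpl; lra.
    - apply @is_derive_const.
    - apply @is_derive_id. }
  assert (Hb1 : forall c, s0 <= c <= s -> Cmod (g (0, c) * (0, 1))%C <= eps / 2 * s).
  { intros c Hc. rewrite Cmod_mult. replace (Cmod (0, 1)) with 1; [rewrite Rmult_1_r; auto|].
    unfold Cmod; simpl. replace (0 * (0 * 1) + 1 * (1 * 1)) with 1 by ring. now rewrite sqrt_1. }
  destruct (MVT_cor2 (fun v => Re (h (0, v))) (fun c => Re (g (0, c) * (0, 1))%C) s0 s Hs)
    as [c1 [E1 B1]]; [intros c Hc; apply is_derive_Reals; now apply Hd|].
  destruct (MVT_cor2 (fun v => Im (h (0, v))) (fun c => Im (g (0, c) * (0, 1))%C) s0 s Hs)
    as [c2 [E2 B2]]; [intros c Hc; apply is_derive_Reals; now apply Hd|].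
  replace (h (0, s) - h Ci)%C with ((h (0, s) - h (0, s0)) + (h (0, s0) - h Ci))%C by ring.
  eapply Rle_trans; [apply Cmod_triangle|]. apply Rplus_le_compat_r.
  eapply Rle_trans; [apply Cmod_le_Rabs_sum|].
  replace (Re (h (0, s) - h (0, s0))%C) with (Re (h (0, s)) - Re (h (0, s0)))
    by (destruct (h (0, s)), (h (0, s0)); reflexivity).
  replace (Im (h (0, s) - h (0, s0))%C) with (Im (h (0, s)) - Im (h (0, s0)))
    by (destruct (h (0, s)), (h (0, s0)); reflexivity).
  rewrite E1, E2, !Rabs_mult, (Rabs_pos_eq (s - s0)) by lra.
  assert (D1 := Rle_trans _ _ _ (Re_le_Cmod _) (Hb1 c1 ltac:(lra))).
  assert (D2 := Rle_trans _ _ _ (Im_le_Cmod _) (Hb1 c2 ltac:(lra))).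
  apply Rle_trans with (eps / 2 * s * s + eps / 2 * s * s); [|right; field].
  apply Rplus_le_compat; (apply Rmult_le_compat; [apply Rabs_pos| | |]; lra).
Qed.

(* Composing the Koenigs function, which omits the half-line ending at [h i] on [Im z > 1],
   with a square root. *)
Lemma koenigs_sqrt (phi : R -> C -> C) (G : C -> C) :
  flow phi G -> small_in_stolz (fun z => / G z)%C ->
  exists k : C -> C, (forall z, inH z -> exists l, is_cderiv k z l) /\
    (forall z, inH z -> inH (k z)) /\ small_in_stolz k /\
    (forall z, 1 < Im z -> exists T, forall t, T < t -> sqrt t / 2 <= Im (k (phi t z - Ci)%C)).
Proof.
  intros HF Hsm.
  assert (HGin : forall z, inH z -> inH (G z)) by apply HF.
  destruct (primitive_H (fun z => / G z)%C) as [h Hh].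
  { intros z Hz. destruct (holo_H_cderiv G (proj1 (proj1 (proj2 HF))) z Hz) as [l Hl].
    eexists. apply is_cderiv_inv; [exact Hl|]. now apply inH_neq_0, HGin. }
  assert (Hi : inH Ci) by (unfold inH; simpl; lra).
  assert (Hinj := primitive_injective h _ Hh (fun z Hz => Im_inv_neg _ (HGin z Hz))).
  assert (Homit : forall z, 1 < Im z -> ~ slit (h z - h Ci)%C).
  { intros z Hz [Him Hre]. assert (HzH : inH z) by (unfold inH; lra).
    destruct Hre as [Hre|Hre].
    - assert (Ht : 0 < - Re (h z - h Ci)%C) by lra.
      assert (E : phi (- Re (h z - h Ci)%C) z = Ci).
      { apply Hinj; [apply (flow_inH phi G); auto; lra|exact Hi|].
        rewrite (koenigs_flow phi G h HF Hh _ z Ht HzH).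
        destruct (h z), (h Ci). simpl in *. unfold Cplus, RtoC; simpl. f_equal; lra. }
      pose proof (proj1 (flow_Im_incr phi G z HF HzH) _ Ht) as Hmon. rewrite E in Hmon.
      simpl in Hmon. lra.
    - assert (E : z = Ci).
      { apply Hinj; [exact HzH|exact Hi|].
        destruct (h z), (h Ci). simpl in *. f_equal; lra. }
      rewrite E in Hz. simpl in Hz. lra. }
  (* The shift by [i] moves [Im z > 1] onto the whole half-plane, where the angular derivative
     theorem applies. *)
  pose (q := fun z => (h (z + Ci) + - h Ci)%C).
  assert (Hq : forall z, inH z -> ~ slit (q z)).
  { intros z Hz. apply Homit. destruct z. unfold inH in Hz. simpl in *. lra. }
  pose (k := fun z => (Ci * csqrt (q z))%C).
  assert (HkIm : forall z, Im (k z) = Re (csqrt (q z))).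
  { intros z. unfold k. destruct (csqrt (q z)). simpl. ring. }
  assert (Hkhol : forall z, inH z -> exists l, is_cderiv k z l).
  { intros z Hz.
    assert (Hz1 : inH (z + Ci)%C) by (destruct z; unfold inH in *; simpl in *; lra).
    destruct (is_cderiv_csqrt q z (/ G (z + Ci) + 0)%C (Im z)) as [m Hm].
    - exact Hz.
    - intros w Hw. apply Hq. unfold inH in *.
      pose proof (Im_le_Cmod (w - z)%C) as T.
      assert (T' := Rle_lt_trans _ _ _ T Hw). apply Rabs_def2 in T'.
      destruct w, z. simpl in *. lra.
    - apply is_cderiv_plus; [|apply is_cderiv_const]. now apply is_cderiv_shift, Hh.
    - eexists. apply is_cderiv_scal. exact Hm. }
  assert (Hkin : forall z, inH z -> inH (k z)).
  { intros z Hz. unfold inH. rewrite HkIm. now apply csqrt_spec, Hq. }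
  exists k. split; [exact Hkhol|]. split; [exact Hkin|]. split.
  - destruct (julia_wolff_caratheodory k Hkhol Hkin) as [c [Hc Hlim]].
    destruct Hc as [Hc|<-].
    + exfalso.
      destruct (Hlim 1 (c / 2) ltac:(lra)) as [M HM].
      destruct (primitive_vertical_growth h _ Hh Hsm (c ^ 2 / 32)) as (S & K & HSK).
      { apply Rdiv_lt_0_compat; [now apply pow_lt|lra]. }
      (* At such a height [c y / 2 <= |k (i y)|] and the growth of [h] give
         [y^2 / 4 <= (y + 1)^2 / 32 + y / 16], false for [y >= 2]. *)
      pose (y := Rmax (Rmax M S) 1 + Rabs K * 16 / c ^ 2 + 1).
      assert (PK : 0 <= Rabs K * 16 / c ^ 2).
      { apply Rdiv_le_0_compat; [pose proof (Rabs_pos K); lra|now apply pow_lt]. }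
      assert (Y1 : M < y /\ S < y /\ 2 <= y /\ Rabs K * 16 / c ^ 2 <= y).
      { pose proof (Rmax_l (Rmax M S) 1). pose proof (Rmax_r (Rmax M S) 1).
        pose proof (Rmax_l M S). pose proof (Rmax_r M S). unfold y. lra. }
      clearbody y. destruct Y1 as (Y1 & Y2 & Y3 & Y4).
      assert (Ey : Cmod (0, y) = y).
      { apply Rle_antisym.
        - eapply Rle_trans; [apply Cmod_le_Rabs_sum|]. simpl. rewrite Rabs_R0, Rabs_pos_eq; lra.
        - pose proof (Im_le_Cmod (0, y)) as T. simpl in T. apply Rabs_le_between in T. lra. }
      assert (Hin : inH (0, y)) by (unfold inH; simpl; lra).
      specialize (HM (0, y) Hin ltac:(rewrite Ey; simpl; lra) ltac:(rewrite Ey; lra)).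
      rewrite Ey in HM.
      assert (Hlow : c / 2 * y <= Cmod (k (0, y))).
      { pose proof (Cmod_rev_triangle (c * (0, y))%C (k (0, y))) as T.
        apply Rabs_le_between in T. rewrite Cmod_mult, Cmod_R, Ey, Rabs_pos_eq in T by lra.
        replace (c * (0, y) - k (0, y))%C with (- (k (0, y) - c * (0, y)))%C in T by ring.
        rewrite Cmod_opp in T. lra. }
      assert (Hup : Cmod (k (0, y)) ^ 2 <= c ^ 2 / 32 * (y + 1) ^ 2 + K).
      { replace (Cmod (k (0, y)) ^ 2) with (Cmod (h (0, y + 1)%R - h Ci)%C).
        - apply HSK. lra.
        - replace (Cmod (k (0, y)) ^ 2) with (Cmod (k (0, y) * k (0, y))%C)
            by (rewrite Cmod_mult; ring).
          unfold k.
          replace (Ci * csqrt (q (0, y)) * (Ci * csqrt (q (0, y))))%C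
            with (- (csqrt (q (0, y)) * csqrt (q (0, y))))%C
            by (destruct (csqrt (q (0, y))); unfold Ci, Cmult, Copp; simpl; f_equal; ring).
          rewrite (proj1 (csqrt_spec _ (Hq _ Hin))), Cmod_opp. unfold q.
          f_equal. unfold Cminus. f_equal. f_equal. unfold Ci, Cplus; simpl. f_equal; ring. }
      assert (Pc : 0 < c ^ 2) by now apply pow_lt.
      assert (Hsq : (c / 2 * y) ^ 2 <= Cmod (k (0, y)) ^ 2).
      { apply pow_incr. split; [|exact Hlow]. apply Rmult_le_pos; lra. }
      assert (HK : K <= c ^ 2 / 16 * y).
      { apply Rle_trans with (Rabs K); [apply Rle_abs|].
        replace (Rabs K) with (c ^ 2 / 16 * (Rabs K * 16 / c ^ 2)) by (field; lra).
        apply Rmult_le_compat_l; lra. }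
      assert (c ^ 2 * y ^ 2 / 4 <= c ^ 2 * ((y + 1) ^ 2 / 32 + y / 16)) by lra.
      assert (y ^ 2 / 4 <= (y + 1) ^ 2 / 32 + y / 16).
      { apply (Rmult_le_reg_l (c ^ 2)); lra. }
      nra.
    + intros kk eps Heps. destruct (Hlim kk eps Heps) as [M HM]. exists M.
      intros z Hz Hk HMz. specialize (HM z Hz Hk HMz).
      now replace (k z - 0 * z)%C with (k z) in HM by ring.
  - intros z Hz. assert (HzH : inH z) by (unfold inH; lra).
    (* Beyond this time the real part of [h (phi t z) - h i] exceeds [t / 2]. *)
    exists (2 * Rabs (Re (h z - h Ci)%C)). intros t Ht.
    pose proof (Rabs_pos (Re (h z - h Ci)%C)) as Pr.
    rewrite HkIm. unfold q. replace (phi t z - Ci + Ci)%C with (phi t z) by ring.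
    rewrite (koenigs_flow phi G h HF Hh t z ltac:(lra) HzH).
    set (w := (h z + t + - h Ci)%C).
    assert (Hre : Re w = Re (h z - h Ci)%C + t).
    { unfold w. destruct (h z), (h Ci). simpl. ring. }
    pose proof (Rle_abs (- Re (h z - h Ci)%C)) as T. rewrite Rabs_Ropp in T.
    pose proof (Re_le_Cmod w) as T2. apply Rabs_le_between in T2.
    change (Re (csqrt w)) with (sqrt ((Cmod w + Re w) / 2)).
    replace (sqrt t / 2) with (sqrt (t / 4)).
    + apply sqrt_le_1_alt. lra.
    + rewrite sqrt_div_alt by lra. replace 4 with (2 * 2) by ring. rewrite sqrt_square; lra.
Qed.

Lemma stolz_small_not_extremal (phi : R -> C -> C) (G : C -> C) :
  flow phi G -> DW_infty phi -> small_in_stolz (fun z => / G z)%C -> ~ extremal_rate phi.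
Proof.
  intros HF HDW Hsm [L [HL Hrate]].
  destruct (koenigs_sqrt phi G HF Hsm) as (k & Hkhol & Hkin & Hksm & Hkorb).
  pose (z0 := (0, 2)). assert (Hz0 : inH z0) by (unfold inH; simpl; lra).
  destruct (Hkorb z0) as [T1 HT1]; [simpl; lra|].
  assert (Hr := Hrate z0 Hz0). apply (proj1 (is_lim_infty_eps _ _)) with (eps := L) in Hr; [|exact HL].
  destruct Hr as [T2 HT2].
  assert (HD := HDW z0 Hz0). apply is_lim_spec in HD.
  pose (x := fun t => Re (phi t z0)). pose (y := fun t => Im (phi t z0)).
  (* Eventually [|phi t z0| <= 2 L sqrt t], while [Im k] is at least [sqrt t / 2]. *)
  pose (a := / (4 * L)). assert (Ha : 0 < a) by (apply Rinv_0_lt_compat; lra).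
  destruct (flow_Im_incr phi G z0 HF Hz0) as [Hy2 Hymono]. simpl in Hy2.
  fold (y) in Hymono.
  assert (Hlow : forall t, Rmax 0 (Rmax T1 T2) < t -> a * Cmod (phi t z0) <= Im (k (phi t z0 - Ci)%C)).
  { intros t Ht. pose proof (Rmax_l 0 (Rmax T1 T2)). pose proof (Rmax_r 0 (Rmax T1 T2)).
    pose proof (Rmax_l T1 T2). pose proof (Rmax_r T1 T2).
    specialize (HT1 t ltac:(lra)). specialize (HT2 t ltac:(lra)). apply Rabs_def2 in HT2.
    assert (Hs := sqrt_lt_R0 t ltac:(lra)).
    eapply Rle_trans; [|exact HT1].
    assert (Cmod (phi t z0) <= 2 * L * sqrt t).
    { apply (Rmult_le_reg_r (/ sqrt t)); [now apply Rinv_0_lt_compat|].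
      rewrite Rmult_assoc, Rinv_r, Rmult_1_r by lra. unfold Rdiv in HT2. lra. }
    apply (Rmult_le_reg_l (4 * L)); [lra|]. unfold a. rewrite <- Rmult_assoc, Rinv_r by lra. lra. }
  (* If [|x| <= 9 y] far out, then [|phi t z0| <= 10 y] with [y > 2], so the shifted point lies in
     the Stolz angle of constant 40. There [|k| <= a |phi t z0| / 2] contradicts [Hlow]. *)
  destruct (Hksm 40 (a / 4) ltac:(lra)) as [M HM].
  destruct (HD (Rabs M + 20)) as [T3 HT3].
  pose (T0 := Rmax 0 (Rmax T1 T2) + Rabs T3 + 1).
  assert (HT0 : 0 < T0 /\ Rmax 0 (Rmax T1 T2) < T0 /\ T3 < T0).
  { pose proof (Rmax_l 0 (Rmax T1 T2)). pose proof (Rle_abs T3). pose proof (Rabs_pos T3).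
    unfold T0. lra. }
  destruct HT0 as (HT0a & HT0b & HT0c). clearbody T0.
  assert (Hy : forall t, 0 < t -> 1 < y t) by (intros t Ht; specialize (Hy2 t Ht); unfold y; simpl; lra).
  assert (Hcm : forall t, Cmod (phi t z0) <= Rabs (x t) + Rabs (y t)) by (intros; apply Cmod_le_Rabs_sum).
  assert (Htan : forall t, T0 <= t -> 9 * y t < Rabs (x t)).
  { intros t Ht. apply Rnot_le_lt. intros Hle.
    specialize (HT3 t ltac:(lra)). pose proof (Hy t ltac:(lra)) as Hyt.
    specialize (Hcm t). rewrite (Rabs_pos_eq (y t)) in Hcm by lra.
    pose proof (Rabs_pos M). pose proof (Rle_abs M).
    specialize (Hlow t ltac:(lra)).
    set (w := (phi t z0 - Ci)%C) in *.
    assert (HCi : Cmod Ci = 1).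
    { unfold Cmod, Ci; simpl. replace (0 * (0 * 1) + 1 * (1 * 1)) with 1 by ring. apply sqrt_1. }
    assert (Hw1 : Cmod (phi t z0) - 1 <= Cmod w <= Cmod (phi t z0) + 1).
    { pose proof (Cmod_rev_triangle (phi t z0) w) as T. apply Rabs_le_between in T.
      replace (phi t z0 - w)%C with Ci in T by (unfold w; ring). lra. }
    assert (HwIm : Im w = y t - 1) by (unfold w, y; destruct (phi t z0); reflexivity).
    specialize (HM w). rewrite HwIm in HM. unfold inH in HM. rewrite HwIm in HM.
    specialize (HM ltac:(lra) ltac:(lra) ltac:(lra)).
    pose proof (Im_le_Cmod (k w)) as T. apply Rabs_le_between in T.
    assert (a / 4 * Cmod w <= a / 4 * (2 * Cmod (phi t z0))) by (apply Rmult_le_compat_l; lra).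
    assert (0 < a * Cmod (phi t z0)) by (apply Rmult_lt_0_compat; lra).
    lra. }
  assert (Hd : forall t, 0 < t -> continuity_pt x t /\ continuity_pt y t).
  { intros t Ht. destruct (proj2 (proj1 (proj2 HF)) z0 t Hz0 Ht) as [D1 D2].
    split; apply derivable_continuous_pt; eexists; apply is_derive_Reals; eassumption. }
  assert (Hx0 : x T0 <> 0).
  { intros E. pose proof (Htan T0 ltac:(lra)) as H. rewrite E, Rabs_R0 in H.
    pose proof (Hy T0 HT0a). lra. }
  (* [sg] reflects the half-plane so that the orbit escapes to the right *)
  assert (Hsg : exists sg, sg * sg = 1 /\ 0 < sg * x T0).
  { destruct (Rtotal_order (x T0) 0) as [H|[H|H]]; [exists (-1)|tauto|exists 1]; lra. }
  destruct Hsg as (sg & Hsg1 & Hsg2).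
  assert (Hsga : Rabs sg = 1).
  { pose proof (Rabs_pos sg). assert (Rabs sg * Rabs sg = 1); [|nra].
    rewrite <- Rabs_mult, Hsg1. apply Rabs_R1. }
  assert (Hcx : forall t, 0 < t -> continuity_pt (fun t => sg * x t) t).
  { intros t Ht. apply continuity_pt_mult; [|now apply Hd].
    apply continuity_pt_const. now intros ? ?. }
  (* A change of sign would make [x] vanish somewhere, against [|x| > 9 y > 0]. *)
  assert (Hpos : forall t, T0 <= t -> 9 * y t < sg * x t).
  { intros t Ht. pose proof (Htan t Ht) as H.
    assert (Habs : Rabs (sg * x t) = Rabs (x t)) by (rewrite Rabs_mult, Hsga; ring).
    rewrite <- Habs in H. pose proof (Hy t ltac:(lra)).
    destruct (Rle_lt_dec 0 (sg * x t)) as [Hp|Hn]; [rewrite Rabs_pos_eq in H; lra|exfalso].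
    destruct (Rle_lt_or_eq_dec _ _ Ht) as [Hlt|Heq]; [|rewrite Heq in Hsg2; lra].
    destruct (IVT_value (fun t => - (sg * x t)) T0 t 0) as [s [Hs1 Hs2]]; [lra| |lra|].
    - intros s Hs. apply continuity_pt_opp, Hcx. lra.
    - pose proof (Htan s ltac:(lra)) as H'.
      assert (Habs' : Rabs (sg * x s) = Rabs (x s)) by (rewrite Rabs_mult, Hsga; ring).
      rewrite <- Habs' in H'. replace (sg * x s) with 0 in H' by lra. rewrite Rabs_R0 in H'.
      pose proof (Hy s ltac:(lra)). lra. }
  pose (u := fun x y : R => Im (k (((sg * x)%R, y) - Ci)%C)).
  assert (Hsub : forall p v, (((sg * p)%R, v) - Ci)%C = (sg * p, v - 1)).
  { intros. unfold Ci, Cminus, Cplus, Copp; simpl. f_equal; ring. }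
  assert (HsubH : forall p v, 1 < v -> inH (((sg * p)%R, v) - Ci)%C).
  { intros. rewrite Hsub. unfold inH; simpl. lra. }
  apply (tangential_curve_absurd u (fun t => sg * x t) y a 1 T0); try assumption; try lra.
  - intros p v Hv. left. now apply Hkin, HsubH.
  - intros p v Hv eps. destruct (Hkhol _ (HsubH p v Hv)) as [l Hl].
    destruct (is_cderiv_cont _ _ _ Hl eps (cond_pos eps)) as [d [Hd1 Hd2]].
    assert (Hd3 : 0 < d / 2) by lra. exists (mkposreal _ Hd3). simpl. intros p' v' Hp' Hv'.
    unfold u.
    eapply Rle_lt_trans; [|apply (Hd2 (((sg * p')%R, v') - Ci)%C)].
    + pose proof (Im_le_Cmod (k (((sg * p')%R, v') - Ci) - k (((sg * p)%R, v) - Ci))%C) as T.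
      destruct (k (((sg * p')%R, v') - Ci)%C), (k (((sg * p)%R, v) - Ci)%C). exact T.
    + replace (((sg * p')%R, v') - Ci - (((sg * p)%R, v) - Ci))%C with ((sg * (p' - p))%R, (v' - v)%R)
        by (unfold Ci, Cminus, Cplus, Copp; simpl; f_equal; ring).
      eapply Rle_lt_trans; [apply Cmod_le_Rabs_sum|]. simpl. rewrite Rabs_mult, Hsga. lra.
  - intros p0 v0 r al be A B Hv0 Hr HAB Hloc.
    pose (r0 := Rmin r (v0 - 1)). assert (Hr0 : 0 < r0) by (apply Rmin_pos; lra).
    assert (R1 : r0 <= r) by apply Rmin_l. assert (R2 : r0 <= v0 - 1) by apply Rmin_r.
    assert (HderK : forall z, 1 < Im z -> exists l, is_cderiv (fun z => Ci * k (z + - Ci))%C z l).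
    { intros z Hz. destruct (Hkhol (z + - Ci)%C) as [l Hl].
      - destruct z. unfold inH. simpl in *. lra.
      - exists (Ci * l)%C. now apply is_cderiv_scal, (is_cderiv_shift k). }
    (* [Re (i k) = - Im k] turns the minimum principle for [u] into the maximum principle; the
       reflection multiplies the linear coefficient in [x] by [sg]. *)
    apply (no_local_max (fun z => Ci * k (z + - Ci))%C ((sg * p0)%R, v0) r0 (sg * al) be A B Hr0 HAB).
    + intros z [_ Hz]. apply HderK.
      pose proof (Im_le_Cmod (z - ((sg * p0)%R, v0))%C) as T.
      assert (T' := Rle_lt_trans _ _ _ T Hz). apply Rabs_def2 in T'.
      destruct z. simpl in *. lra.
    + destruct (HderK ((sg * p0)%R, v0)) as [l Hl]; [simpl; lra|]. exact (is_cderiv_cont _ _ _ Hl).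
    + intros [p v] Hz.
      pose proof (Re_le_Cmod ((p, v) - ((sg * p0)%R, v0))%C) as T1'.
      pose proof (Im_le_Cmod ((p, v) - ((sg * p0)%R, v0))%C) as T2'.
      simpl (Re _) in T1'. simpl (Im _) in T2'.
      specialize (Hloc (sg * p) v).
      assert (Esg : sg * p - p0 = sg * (p + - (sg * p0))).
      { rewrite Rmult_plus_distr_l. replace (sg * - (sg * p0)) with (- (sg * sg * p0)) by ring.
        rewrite Hsg1. ring. }
      rewrite Esg, Rabs_mult, Hsga, Rmult_1_l in Hloc.
      specialize (Hloc ltac:(lra) ltac:(unfold Rminus in *; lra)).
      unfold u in Hloc. replace (sg * (sg * p)) with p in Hloc
        by (rewrite <- Rmult_assoc, Hsg1; ring).
      rewrite Rpow_mult_distr in Hloc. replace (sg ^ 2) with 1 in Hloc by (rewrite <- Hsg1; ring).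
      change ((p, v) + - Ci)%C with ((p, v) - Ci)%C.
      change (((sg * p0)%R, v0) + - Ci)%C with (((sg * p0)%R, v0) - Ci)%C.
      destruct (k ((p, v) - Ci)%C) as [k1 k2]. destruct (k (((sg * p0)%R, v0) - Ci)%C) as [k3 k4].
      simpl in *. unfold Rminus in *. lra.
  (* The shifted test point has modulus between [4 m] and [5 m] and height [m / 2 - 1], hence lies
     in the Stolz angle of constant 20 once [m > 4]. *)
  - intros eps Heps. destruct (Hksm 20 (eps / 5) ltac:(lra)) as [M' HM'].
    exists (Rabs M' + 4). intros m Hm. pose proof (Rabs_pos M'). pose proof (Rle_abs M').
    unfold u. rewrite Hsub.
    assert (Hc1 : Cmod (sg * (4 * m), m / 2 - 1) <= 5 * m).
    { eapply Rle_trans; [apply Cmod_le_Rabs_sum|]. simpl.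
      rewrite Rabs_mult, Hsga, !Rabs_pos_eq; lra. }
    assert (Hc2 : 4 * m <= Cmod (sg * (4 * m), m / 2 - 1)).
    { eapply Rle_trans; [|apply Re_le_Cmod]. simpl.
      rewrite Rabs_mult, Hsga, Rabs_pos_eq; lra. }
    eapply Rle_trans; [eapply Rle_trans; [apply Rle_abs|apply Im_le_Cmod]|].
    eapply Rle_trans; [apply HM'|].
    + unfold inH; simpl; lra.
    + simpl. lra.
    + lra.
    + apply Rle_trans with (eps / 5 * (5 * m)); [apply Rmult_le_compat_l; lra|lra].
  - intros t Ht. split; [now apply Hcx|]. split; [now apply Hd|now apply Hy].
  - intros M'. destruct (HD (2 * Rabs M')) as [T4 HT4].
    exists (Rmax T4 T0). intros t Ht. pose proof (Rmax_l T4 T0). pose proof (Rmax_r T4 T0).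
    specialize (HT4 t ltac:(lra)). specialize (Hpos t ltac:(lra)). pose proof (Hy t ltac:(lra)).
    specialize (Hcm t). rewrite (Rabs_pos_eq (y t)) in Hcm by lra.
    assert (Habs : Rabs (x t) = sg * x t).
    { rewrite <- (Rabs_pos_eq (sg * x t)) by lra. rewrite Rabs_mult, Hsga. ring. }
    pose proof (Rle_abs M'). lra.
  - intros t Ht. split; [now apply Hpos|].
    apply Rle_trans with (a * Cmod (phi t z0)).
    + apply Rmult_le_compat_l; [lra|]. eapply Rle_trans; [apply Rle_abs|].
      rewrite Rabs_mult, Hsga, Rmult_1_l. apply Re_le_Cmod.
    + unfold u. replace (sg * (sg * x t)) with (x t) by (rewrite <- Rmult_assoc, Hsg1; ring).
      replace (x t, y t) with (phi t z0) by (unfold x, y; now destruct (phi t z0)).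
      apply Hlow. lra.
Qed.

Theorem theorem4p7 (phi : R -> C -> C) (G : C -> C) :
  semigroup_H phi ->
  non_elliptic phi ->
  DW_infty phi ->
  parabolic phi ->
  zero_hyp_step phi ->
  generator_of phi G ->
  (forall z, inH z -> inH (G z)) ->
  (extremal_rate phi <->
     exists l : R, l < 0 /\ ang_lim_infty (fun z => (z * G z)%C) (RtoC l)) /\
  (forall l : R, l < 0 -> ang_lim_infty (fun z => (z * G z)%C) (RtoC l) ->
     forall z, inH z ->
       is_lim (fun t => Cmod (phi t z) / sqrt t) p_infty (sqrt (-2 * l))).
Proof.
  intros Hsg _ HDW _ _ Hgen HGin.
  assert (HF : flow phi G) by (split; [|split]; assumption).
  assert (Hrate := fun l => rate_of_ang_lim phi G l HF HDW).
  split; [split|exact Hrate].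
  - intros Hext.
    destruct (julia_wolff_caratheodory (fun z => -1 * / G z)%C) as [c [[Hc|<-] Hlim]].
    + intros z Hz. destruct (holo_H_cderiv G (proj1 Hgen) z Hz) as [l Hl].
      eexists. apply is_cderiv_scal, is_cderiv_inv; [exact Hl|]. now apply inH_neq_0, HGin.
    + intros z Hz. unfold inH. pose proof (Im_inv_neg _ (HGin z Hz)) as H.
      destruct (/ G z)%C. simpl in *. lra.
    + exists (- / c). split; [assert (0 < / c) by (now apply Rinv_0_lt_compat); lra|].
      apply ang_lim_stolz. intros k eps Heps.
      (* The first bound gives [|F| >= c |z| / 2]. The second then makes [|F - c z| / (c |F|)], the
         distance from [z G z] to [- 1 / c], at most [eps / 2]. *)
      pose (e := Rmin (c / 2) (c ^ 2 * eps / 4)).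
      assert (He : 0 < e).
      { apply Rmin_pos; [lra|]. apply Rdiv_lt_0_compat; [|lra].
        apply Rmult_lt_0_compat; [now apply pow_lt|exact Heps]. }
      assert (E1 : e <= c / 2) by apply Rmin_l. assert (E2 : e <= c ^ 2 * eps / 4) by apply Rmin_r.
      destruct (Hlim k e He) as [M HM]. exists M. intros z Hz Hk HMz.
      specialize (HM z Hz Hk HMz).
      assert (HG0 := inH_neq_0 _ (HGin z Hz)).
      assert (Hzp := inH_Cmod_pos z Hz).
      assert (Hc0 : RtoC c <> 0) by (intros E; apply RtoC_inj in E; lra).
      set (F := (-1 * / G z)%C) in *.
      assert (HFG : (F * G z)%C = (-1)%C) by (unfold F; field; exact HG0).
      assert (HF0 : F <> 0).
      { intros E. rewrite E in HFG. apply (f_equal Re) in HFG. destruct (G z). simpl in HFG. lra. }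
      assert (HFlow : c / 2 * Cmod z <= Cmod F).
      { pose proof (Cmod_rev_triangle (c * z)%C F) as T. apply Rabs_le_between in T.
        rewrite Cmod_mult, Cmod_R, (Rabs_pos_eq c) in T by lra.
        replace (c * z - F)%C with (- (F - c * z))%C in T by ring. rewrite Cmod_opp in T.
        assert (e * Cmod z <= c / 2 * Cmod z) by (apply Rmult_le_compat_r; lra). lra. }
      replace (z * G z - RtoC (- / c))%C with ((F - c * z) / (c * F))%C.
      * rewrite Cmod_div by now apply Cmult_neq_0.
        rewrite Cmod_mult, Cmod_R, (Rabs_pos_eq c) by lra.
        assert (HFp := proj1 (Cmod_gt_0 _) HF0).
        assert (Hden : 0 < c * Cmod F) by now apply Rmult_lt_0_compat.
        apply (Rmult_lt_reg_r (c * Cmod F)); [exact Hden|].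
        unfold Rdiv. rewrite Rmult_assoc, Rinv_l, Rmult_1_r by lra.
        eapply Rle_lt_trans; [exact HM|].
        assert (e * Cmod z <= c ^ 2 * eps / 4 * Cmod z) by (apply Rmult_le_compat_r; lra).
        assert (eps * c * (c / 2 * Cmod z) <= eps * c * Cmod F).
        { apply Rmult_le_compat_l; [|exact HFlow]. apply Rmult_le_pos; lra. }
        assert (0 < c ^ 2 * eps * Cmod z).
        { apply Rmult_lt_0_compat; [|exact Hzp].
          apply Rmult_lt_0_compat; [now apply pow_lt|exact Heps]. }
        lra.
      * rewrite RtoC_opp, RtoC_inv by lra. unfold F. field. now split.
    + exfalso. apply (stolz_small_not_extremal phi G HF HDW); [|exact Hext].
      intros k eps Heps. destruct (Hlim k eps Heps) as [M HM]. exists M.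
      intros z Hz Hk HMz. specialize (HM z Hz Hk HMz).
      replace (-1 * / G z - 0 * z)%C with (- / G z)%C in HM by ring.
      now rewrite Cmod_opp in HM.
  - intros [l [Hl Hlim]]. exists (sqrt (-2 * l)). split.
    + apply sqrt_lt_R0. lra.
    + now apply Hrate.
Qed.
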